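(* Let $M=\{\mu_{i,j}\}$ be a $K\times K$ preference matrix whose Condorcet winner is arm $1$ and for which the minimizer $b^\star(i)$ is unique for each $i\in[K]\setminus\{1\}$; let $\alpha>0$ and $f(K)\ge0$. For any sufficiently small $\delta>0$, the regret of the RMED2FH algorithm is bounded as $$\mathbb{E}[R(T)]\le\sum_{i\in[K]\setminus\{1\}}\frac{(\Delta_{1,i}+\Delta_{1,b^\star(i)})\,(1+\delta)\log T}{2\,d(\mu_{i,b^\star(i)},1/2)}+O(\alpha K^2\log\log T)+O(Ke^{AK-f(K)})+O\!\left(\frac{K\log T}{\log\log T}\right)+O\!\left(\frac{K}{\delta^2}\right)+O(Kf(K)),$$ where $A=A(\{\mu_{i,j}\})>0$ is a constant as a function of $T$. By setting $\delta=O((\log T)^{-1/3})$ and choosing $f(K)=cK^{1+\epsilon}$ ($c,\epsilon>0$), $$\mathbb{E}[R(T)]\le\sum_{i\in[K]\setminus\{1\}}\frac{(\Delta_{1,i}+\Delta_{1,b^\star(i)})\log T}{2\,d(\mu_{i,b^\star(i)},1/2)}+O(\alpha K^2\log\log T)+O\!\left(\frac{K\log T}{\log\log T}\right)+O(K^{2+\epsilon}).$$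
   Context: $K$-armed dueling bandit: $[K]=\{1,\dots,K\}$ is the set of arms. A preference matrix is $M=\{\mu_{i,j}\}\in[0,1]^{K\times K}$ with $\mu_{i,j}=1-\mu_{j,i}$, $\mu_{i,i}=1/2$. At each round $t=1,\dots,T$ the algorithm selects (draws) a pair $(l(t),m(t))\in[K]^2$ and receives feedback distributed as $\mathrm{Bernoulli}(\mu_{l(t),m(t)})$, independent of the past given the pair (value $1$ means $l(t)$ is preferred to $m(t)$). Arm $1$ is the Condorcet winner: $\mu_{1,j}>1/2$ for all $j\ne 1$. $\Delta_{i,j}=\mu_{i,j}-1/2$; the regret of a round in which $(i,j)$ is selected is $r(t)=(\Delta_{1,i}+\Delta_{1,j})/2$, and $R(T)=\sum_{t=1}^T r(t)$. $d(p,q)=p\log\frac pq+(1-p)\log\frac{1-p}{1-q}$ (with $0\log0=0$); $d^+(p,q)=d(p,q)$ if $p<q$ and $0$ otherwise. $\mathcal{O}_i=\{j\in[K]:\mu_{i,j}<1/2\}$ and, for $i\neq 1$, $b^\star(i)=\arg\min_{j\in\mathcal{O}_i}\frac{\Delta_{1,i}+\Delta_{1,j}}{d(\mu_{i,j},1/2)}$, assumed unique. Statistics: for $i\ne j$, $N_{i,j}(t)$ is the number of rounds $t'\le t-1$ in which the unordered pair $\{i,j\}$ was compared; $\hat\mu_{i,j}(t)$ is the number of those rounds in which $i$ was preferred to $j$ divided by $N_{i,j}(t)$ (with $0/0=1/2$); $\hat\mu_{i,i}(t)=1/2$. The opponents of $i$ are $\hat{\mathcal{O}}_i(t)=\{j\in[K]\setminus\{i\}:\hat\mu_{i,j}(t)\le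 1/2\}$. $I_i(t)=\sum_{j\in\hat{\mathcal{O}}_i(t)}N_{i,j}(t)\,d(\hat\mu_{i,j}(t),1/2)$; $i^*(t)=\arg\min_{i\in[K]}I_i(t)$ (ties broken arbitrarily), $I^*(t)=I_{i^*(t)}(t)$. $\mathcal{J}_i(t)$ is the event $\{I_i(t)-I^*(t)\le\log t+f(K)\}$, where $f(K)\ge0$ is an input, independent of $t$. RMED2FH algorithm (inputs: $K$, $f(K)\ge0$, $\alpha>0$, horizon $T$). Initial phase: draw each unordered pair of distinct arms $\lceil\alpha\log\log T\rceil$ times; it ends at round $T_{\mathrm{init}}=\lceil\alpha\log\log T\rceil K(K-1)/2$. Then, for each arm $i$, fix once and for all, using the estimates at the end of the initial phase, $$\hat b^\star(i)=\arg\min_{j\in[K]\setminus\{i\}}\frac{\hat\Delta_{i^*(t),i}+\hat\Delta_{i^*(t),j}}{d^+(\hat\mu_{i,j}(t),1/2)},\qquad \hat\Delta_{i,j}=\hat\mu_{i,j}(t)-1/2,$$ with $x/0=+\infty$ and ties broken arbitrarily. Set $L_C=L_R=[K]$, $L_N=\emptyset$. From round $t=T_{\mathrm{init}}+1$, while $t\le T$, repeat the following loop: for each $l(t)\in L_C$ in an arbitrarily fixed order: (1) choose $m(t)$: if $\hat b^\star(l(t))\in\hat{\mathcal{O}}_{l(t)}(t)$ and $N_{l(t),i^*(t)}(t)\ge N_{l(t),\hat b^\star(l(t))}(t)/\log\log T$, then $m(t)=\hat b^\star(l(t))$; otherwise, if $i^*(t)\in\hat{\mathcal{O}}_{l(t)}(t)$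 or $\hat{\mathcal{O}}_{l(t)}(t)=\emptyset$, then $m(t)=i^*(t)$; otherwise $m(t)=\arg\min_{j\ne l(t)}\hat\mu_{l(t),j}(t)$; (2) draw the pair $(l(t),m(t))$; (3) $L_R\leftarrow L_R\setminus\{l(t)\}$; (4) add to $L_N$ (without duplicates) every $j\notin L_R$ for which $\mathcal{J}_j(t)$ holds; (5) $t\leftarrow t+1$. When all of $L_C$ has been processed, set $L_C\leftarrow L_N$, $L_R\leftarrow L_N$, $L_N\leftarrow\emptyset$ and start the next loop. Conventions: ''for any sufficiently small $\delta$'' means for all $\delta\in(0,\delta_0)$ with some $\delta_0>0$ not depending on $T$. The implied constants in the $O(\cdot)$ terms do not depend on $T$ or $\delta$ (they may depend on the problem instance, i.e. the preference matrix, and on the choice of $f$ and $\alpha$). $O(\cdot)$ is understood for large $T$ (in particular $\log\log T>0$). *)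

(* Defs.v *)
From HB Require Import structures.
From mathcomp Require Export all_boot all_order all_algebra.
From mathcomp Require Export all_classical all_reals all_analysis.

Set Implicit Arguments.
Unset Strict Implicit.
Unset Printing Implicit Defensive.

Import Order.TTheory GRing.Theory Num.Theory.
Local Open Scope ring_scope.

(* "x minimizes F over S", with ties left open.  Nothing is required when S is
   empty (only relevant for K = 1, where no arm differs from the given one). *)
Definition is_argmin d (V : porderType d) (I : finType) (S : {set I})
    (F : I -> V) (x : I) : Prop :=
  forall y, y \in S -> x \in S /\ (F x <= F y)%O.

Definition is_unique_argmin d (V : porderType d) (I : finType) (S : {set I})
    (F : I -> V) (x : I) : Prop :=
  x \in S /\ forall y, y \in S -> y != x -> (F x < F y)%O.

(* Bernoulli Kullback-Leibler divergence.  The convention 0 log 0 = 0 is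
   automatic, as 0 * _ = 0; d is only ever used with q = 1/2. *)
Definition kl (R : realType) (p q : R) : R :=
  p * ln (p / q) + (1 - p) * ln ((1 - p) / (1 - q)).

Definition klp (R : realType) (p q : R) : R := if p < q then kl p q else 0.

(* x / y with the convention x / 0 = +oo. *)
Definition ediv (R : realType) (x y : R) : \bar R :=
  if y == 0 then +oo%E else (x / y)%:E.

Definition log (R : realType) (n : nat) : R := ln n%:R.
Definition loglog (R : realType) (n : nat) : R := ln (ln n%:R).

(* Instance: 'I_K is the set of arms, and arm 1 of the usual 1-based
   numbering is the ordinal 0. *)
Definition arm1 K (hK : (0 < K)%N) : 'I_K := Ordinal hK.

Definition preference_matrix (R : realType) K (mu : 'M[R]_K) : Prop :=
  [/\ forall i j, 0 <= mu i j <= 1,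
      forall i j, mu i j = 1 - mu j i &
      forall i, mu i i = 1 / 2].

Definition condorcet_winner (R : realType) K (mu : 'M[R]_K) (w : 'I_K) : Prop :=
  forall j, j != w -> 1 / 2 < mu w j.

Definition gap (R : realType) K (mu : 'M[R]_K) (i j : 'I_K) : R :=
  mu i j - 1 / 2.

Definition superiors (R : realType) K (mu : 'M[R]_K) (i : 'I_K) : {set 'I_K} :=
  [set j | mu i j < 1 / 2].

Definition is_bstar (R : realType) K (mu : 'M[R]_K) (w i b : 'I_K) : Prop :=
  is_unique_argmin (superiors mu i)
    (fun j => (gap mu w i + gap mu w j) / kl (mu i j) (1 / 2)) b.

(* One realization of the interaction.  Rounds are numbered from 1; the values
   at round 0 are never read. *)
Record path K := Path {
  left_arm : nat -> 'I_K;
  right_arm : nat -> 'I_K;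
  feedback : nat -> bool (* true: the left arm is preferred *)
}.

Definition regret (R : realType) K (mu : 'M[R]_K) (w : 'I_K) (h : path K)
    (T : nat) : R :=
  \sum_(1 <= t < T.+1) (gap mu w (left_arm h t) + gap mu w (right_arm h t)) / 2.

Section Statistics.
Variables (R : realType) (K : nat) (h : path K).

(* On the diagonal this counts the draws of the pair (i, i). *)
Definition ncmp (i j : 'I_K) (t : nat) : nat :=
  (\sum_(1 <= s < t)
    (((left_arm h s == i) && (right_arm h s == j)) ||
     ((left_arm h s == j) && (right_arm h s == i)) : bool))%N.

Definition nwin (i j : 'I_K) (t : nat) : nat :=
  (\sum_(1 <= s < t)
    ([&& left_arm h s == i, right_arm h s == j & feedback h s] ||
     [&& left_arm h s == j, right_arm h s == i & ~~ feedback h s] : bool))%N.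

Definition muhat (t : nat) (i j : 'I_K) : R :=
  if (i == j) || (ncmp i j t == 0)%N then 1 / 2
  else (nwin i j t)%:R / (ncmp i j t)%:R.

Definition gaphat (t : nat) (i j : 'I_K) : R := muhat t i j - 1 / 2.

Definition opponents (t : nat) (i : 'I_K) : {set 'I_K} :=
  [set j | (j != i) && (muhat t i j <= 1 / 2)].

Definition divI (t : nat) (i : 'I_K) : R :=
  \sum_(j in opponents t i) (ncmp i j t)%:R * kl (muhat t i j) (1 / 2).

End Statistics.

Section RMED2FH.
Variables (R : realType) (K : nat) (alpha fK : R) (T : nat).

Definition ninit : nat := `|Num.ceil (alpha * loglog R T)|%N.
Definition Tinit : nat := (ninit * (K * K.-1) %/ 2)%N.

(* [order] is the fixed order in which the arms of L_C are processed.
   [istar] and [bhat] record how the ties in i^*(t) and \hat b^\star are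
   broken along the path [h]. *)
Variables (order : seq 'I_K) (h : path K).
Variables (istar : nat -> 'I_K) (bhat : 'I_K -> 'I_K).

Definition bhat_objective (i j : 'I_K) : \bar R :=
  let t := Tinit.+1 in
  ediv (gaphat R h t (istar t) i + gaphat R h t (istar t) j)
       (klp (muhat R h t i j) (1 / 2)).

Definition evJ (t : nat) (j : 'I_K) : bool :=
  divI R h t j - divI R h t (istar t) <= log R t + fK.

(* [todo] lists, in processing order, the arms of L_C that remain to be
   processed in the current loop; its head is l(t). *)
Record loop_state := LoopState {
  todo : seq 'I_K;
  LR : {set 'I_K};
  LN : {set 'I_K}
}.

Definition start_loop (LC : {set 'I_K}) : loop_state :=
  LoopState [seq i <- order | i \in LC] LC finset.set0.

Definition loop_step (t : nat) (s : loop_state) : loop_state :=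
  if todo s is l :: rest then
    let LR' := LR s :\ l in
    let LN' := LN s :|: [set j | (j \notin LR') && evJ t j] in
    if rest is [::] then start_loop LN' else LoopState rest LR' LN'
  else s.

(* State at the beginning of round Tinit + 1 + n. *)
Fixpoint loop_at (n : nat) : loop_state :=
  if n is n'.+1 then loop_step (Tinit + n) (loop_at n')
  else start_loop [set: 'I_K].

Definition right_arm_rule (t : nat) : Prop :=
  let l := left_arm h t in
  let m := right_arm h t in
  if (bhat l \in opponents R h t l) &&
     ((ncmp h l (bhat l) t)%:R / loglog R T <= (ncmp h l (istar t) t)%:R)
  then m = bhat l
  else if (istar t \in opponents R h t l) || (opponents R h t l == finset.set0)
  then m = istar t
  else is_argmin [set j | j != l] (fun j => muhat R h t l j) m.

(* The draws of the initial phase may come in any order and orientation: as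
   the phase has exactly Tinit = ninit * K * (K - 1) / 2 rounds, the counts
   leave room for no other draw. *)
Definition RMED2FH_follows : Prop :=
  [/\ forall t, is_argmin [set: 'I_K] (divI R h t) (istar t),
      forall i j, i != j -> ncmp h i j Tinit.+1 = ninit,
      forall i, is_argmin [set j | j != i] (bhat_objective i) (bhat i) &
      forall t, (Tinit < t <= T)%N ->
        ohead (todo (loop_at (t - Tinit.+1))) = Some (left_arm h t) /\
        right_arm_rule t].

End RMED2FH.

Definition RMED2FH_path (R : realType) K (alpha fK : R) (T : nat)
    (order : seq 'I_K) (h : path K) : Prop :=
  exists istar bhat, RMED2FH_follows alpha fK T order h istar bhat.

Section Feedback.
Variables (R : realType) (K : nat) (mu : 'M[R]_K) (T : nat).
Variables (d : measure_display) (Om : measurableType d) (P : probability Om R).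
Variable H : Om -> path K.
Local Open Scope classical_set_scope.

(* The pairs drawn at rounds 1..t and the feedback of rounds 1..t-1 are those
   of [h]. *)
Definition past_event (h : path K) (t : nat) : set Om :=
  [set w | (forall s, (1 <= s <= t)%N ->
              left_arm (H w) s = left_arm h s /\
              right_arm (H w) s = right_arm h s) /\
           (forall s, (1 <= s < t)%N -> feedback (H w) s = feedback h s)].

(* Conditionally on the past and on the pair drawn at round t, the feedback of
   round t is Bernoulli(mu_{l(t), m(t)}).  The pairs themselves may depend on
   extra randomness, so randomized tie-breaking is covered. *)
Definition dueling_feedback : Prop :=
  [/\ forall t i, (1 <= t <= T)%N -> measurable [set w | left_arm (H w) t = i],
      forall t i, (1 <= t <= T)%N -> measurable [set w | right_arm (H w) t = i],
      forall t, (1 <= t <= T)%N -> measurable [set w | feedback (H w) t] &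
      forall t h, (1 <= t <= T)%N ->
        P (past_event h t `&` [set w | feedback (H w) t]) =
        ((mu (left_arm h t) (right_arm h t))%:E * P (past_event h t))%E].

End Feedback.

(* [H] is the random path generated by RMED2FH with horizon T. *)
Definition RMED2FH_process (R : realType) K (mu : 'M[R]_K) (alpha fK : R)
    (T : nat) (d : measure_display) (Om : measurableType d)
    (P : probability Om R) (H : Om -> path K) : Prop :=
  dueling_feedback mu T P H /\
  exists2 order : seq 'I_K, perm_eq order (enum 'I_K) &
    forall w, RMED2FH_path alpha fK T order (H w).

Definition expected_regret (R : realType) K (mu : 'M[R]_K) (w : 'I_K) (T : nat)
    (d : measure_display) (Om : measurableType d) (P : probability Om R)
    (H : Om -> path K) : \bar R :=
  expectation P (fun om => regret mu w (H om) T).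

(* Main.v *)
Require Import Defs.
From mathcomp Require Import measurable_realfun ring lra zify.
Set Implicit Arguments.
Unset Strict Implicit.
Unset Printing Implicit Defensive.
Import Order.TTheory GRing.Theory Num.Theory.
Import numFieldNormedType.Exports.
Local Open Scope ring_scope.

(* Call a round "unopposed" when the set of opponents of arm 1 is empty; then
   i^* = 1 and I^* = 0.

   Opposed rounds are O(1) in expectation.  If J_1 holds, arm 1 is drawn within two
   loops, so a pair {1, j} with muhat_{1,j} <= 1/2 is compared, which happens O(1)
   times in expectation since each comparison raises N_{1,j}.  If J_1 fails at round
   s then s < exp(I_1(s)), and exp(I_1) is at most the product over j of
   sum_n 1[muhat_{1,j} <= 1/2] exp(n d(muhat_{1,j}, 1/2)) over the sample sizes n;
   its expectation is bounded by a product because the results of distinct pairs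
   behave as independent tables (a martingale argument).

   At a round where the last 2K rounds were unopposed, l(t) = i <> 1 means that
   I_i <= log T + f(K) shortly before.  Hence N_{i,j} is at most
   (1 + delta)(log T + f(K)) / d(mu_{i,j}, 1/2), up to rounds whose estimate deviates,
   O(1/delta^2) by Chernoff.  For j = b^*(i) this is the main term.  Comparisons with
   arm 1 cost O(log T / loglog T) by the ratio test of the algorithm.  If bhat is
   wrong, the ratio test bounds the cost by O(log T loglog T), and this has
   probability at most (log T)^(-c), because the initial phase has about
   alpha loglog T samples per pair. *)

(** The obstacle is adaptivity: how often a pair has been compared at a given round is decided by
    the algorithm in view of the results, so concentration at a fixed sample size does not apply.
    Events are therefore dominated by [psum], a sum over all sample sizes. Such a sum only grows
    when samples are added, so the actual samples can be completed to a table of [T] results per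
    pair, and its mean becomes a sum of fixed-size Bernoulli expectations. For this reason a
    deterministic part is separated from a probabilistic one. Each run satisfies a regret bound
    whose right side depends only on the trace of pairs and results; the ties, which may be broken
    differently on each run, have disappeared from it. Expectations are then finite sums over
    traces, and the bounds are uniform over the way pairs are chosen. The parameter delta is spent
    only on the leading term, the comparisons of i with b^*(i); all other deviations of a divergence
    are measured with [delta = 1]. *)

(** * Elementary inequalities for the exponential, the logarithm and the divergence *)

Section RealFacts.
Variable R : realType.
Implicit Types (p q r x y : R) (n : nat).

(** Inverting [1 - x <= expR (- x)] gives [expR x <= (1 - x)^-1], and
    [(1 - x) * (1 + x + 2 * x ^+ 2)] exceeds 1 by [x ^+ 2 * (1 - 2 * x)]. *)
Lemma expR_le_quad x : x <= 1 / 2 -> expR x <= 1 + x + 2 * x ^+ 2.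
Proof.
move=> hx; have h1 : 0 < 1 - x by lra.
have hE : expR x <= (1 - x)^-1.
  rewrite -[expR x]invrK lef_pV2 ?posrE ?invr_gt0 ?expR_gt0 //.
  by rewrite -expRN; have := expR_ge1Dx (- x); lra.
apply: (le_trans hE); rewrite -[leLHS]mul1r ler_pdivrMr //.
have : 0 <= x ^+ 2 * (1 - 2 * x) by rewrite mulr_ge0 ?sqr_ge0 //; lra.
by lra.
Qed.

(** Makes a geometric series of ratio [expR (- c)] cost at most [2 / c]; with [c] of order
    [delta ^+ 2] this is the origin of the [delta ^- 2] in the regret. *)
Lemma oneB_expRN_ge x : 0 <= x <= 1 -> x / 2 <= 1 - expR (- x).
Proof.
move=> /andP[x0 x1]; rewrite expRN.
have h : (expR x)^-1 <= (1 + x)^-1.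
  by rewrite lef_pV2 ?posrE ?expR_gt0 ?expR_ge1Dx //; lra.
suff : (1 + x)^-1 <= 1 - x / 2 by lra.
rewrite -[leLHS]mul1r ler_pdivrMr; last lra.
rewrite -subr_ge0; have -> : (1 - x / 2) * (1 + x) - 1 = x * (1 - x) / 2 by field.
by rewrite divr_ge0 // mulr_ge0 //; lra.
Qed.

Lemma sum_geo_le r n : 0 <= r < 1 -> \sum_(0 <= i < n) r ^+ i <= (1 - r)^-1.
Proof.
move=> /andP[r0 r1]; have h : 0 < 1 - r by lra.
rewrite -[leRHS]mul1r ler_pdivlMr // mulrC.
suff -> : (1 - r) * (\sum_(0 <= i < n) r ^+ i) = 1 - r ^+ n.
  by rewrite gerBl exprn_ge0.
elim: n => [|n IH]; first by rewrite big_geq // mulr0 expr0 subrr.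
by rewrite big_nat_recr //= mulrDr IH exprS; ring.
Qed.

Lemma sum_arith_geo_le r n : 0 <= r < 1 ->
  \sum_(0 <= i < n) (i.+1)%:R * r ^+ i <= (1 - r) ^- 2.
Proof.
move=> /andP[r0 r1]; have h : 0 < 1 - r by lra.
rewrite -[leRHS]mul1r ler_pdivlMr ?exprn_gt0 // mulrC.
suff -> : (1 - r) ^+ 2 * (\sum_(0 <= i < n) (i.+1)%:R * r ^+ i) =
          1 - r ^+ n - n%:R * (r ^+ n * (1 - r)).
  have h1 := exprn_ge0 n r0.
  have : 0 <= n%:R * (r ^+ n * (1 - r)) by rewrite !mulr_ge0 ?ler0n // ltW.
  by lra.
elim: n => [|n IH]; first by rewrite big_geq // mulr0n expr0 mul0r mulr0 subr0 subrr.
by rewrite big_nat_recr //= mulrDr IH (exprS r) -natr1; ring.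
Qed.

Lemma ln_ge_1BV x : 0 < x -> 1 - x^-1 <= ln x.
Proof.
move=> x0; have := le_ln1Dx (x := x^-1 - 1).
rewrite (_ : 1 + (x^-1 - 1) = x^-1); last ring.
rewrite lnV ?posrE // => /(_ _) h.
have : -1 < x^-1 - 1 by rewrite ltrBrDr addNr invr_gt0.
by move=> /h; lra.
Qed.

Lemma ln_gt_1BV x : 0 < x -> x != 1 -> 1 - x^-1 < ln x.
Proof.
move=> x0 x1; have h : - ln x != 0 by rewrite oppr_eq0 ln_eq0.
by have := expR_gt1Dx h; rewrite expRN lnK ?posrE //; lra.
Qed.

Lemma klE p : 0 <= p <= 1 ->
  kl p (1 / 2) = p * ln (2 * p) + (1 - p) * ln (2 * (1 - p)).
Proof.
move=> _; rewrite /kl; congr (_ * ln _ + _ * ln _); first by field.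
by rewrite (_ : 1 - 1 / 2 = 1 / 2 :> R); [field|lra].
Qed.

Lemma xln_ge p : 0 <= p -> p - 1 / 2 <= p * ln (2 * p).
Proof.
rewrite le_eqVlt => /orP[/eqP <-|p0]; first by rewrite mul0r; lra.
have h : 1 - (2 * p)^-1 <= ln (2 * p) by apply: ln_ge_1BV; lra.
have -> : p - 1 / 2 = p * (1 - (2 * p)^-1) by field; rewrite gt_eqF.
by rewrite ler_pM2l.
Qed.

Lemma kl_ge0 p : 0 <= p <= 1 -> 0 <= kl p (1 / 2).
Proof.
move=> hp; rewrite klE //.
have /xln_ge h1 : 0 <= p by lra.
have /xln_ge h2 : 0 <= 1 - p by lra.
lra.
Qed.

Lemma kl_gt0 p : 0 <= p < 1 / 2 -> 0 < kl p (1 / 2).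
Proof.
move=> hp; rewrite klE; last lra.
have /xln_ge h1 : 0 <= p by lra.
have h2 : 1 - (2 * (1 - p))^-1 < ln (2 * (1 - p)).
  apply: ln_gt_1BV; first lra.
  by rewrite gt_eqF //; lra.
have : (1 - p) * (1 - (2 * (1 - p))^-1) < (1 - p) * ln (2 * (1 - p)).
  by rewrite ltr_pM2l //; lra.
have -> : (1 - p) * (1 - (2 * (1 - p))^-1) = (1 - p) - 1 / 2.
  by field; apply/eqP; lra.
lra.
Qed.

Lemma klp_ge0 p : 0 <= p <= 1 -> 0 <= klp p (1 / 2).
Proof. by move=> hp; rewrite /klp; case: ifP => // _; exact: kl_ge0. Qed.

(** [ln_ge_1BV] at [p / q], multiplied by [p]. The factors 2 cancel; they put the logarithms in the
    form of [klE]. *)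
Lemma gibbs_term p q : 0 <= p -> 0 < q -> p - q <= p * (ln (2 * p) - ln (2 * q)).
Proof.
rewrite le_eqVlt => /orP[/eqP <-|p0] q0; first by rewrite mul0r; lra.
rewrite -ln_div ?posrE; [|lra|lra].
have h : 1 - (2 * p / (2 * q))^-1 <= ln (2 * p / (2 * q)).
  by apply: ln_ge_1BV; rewrite divr_gt0 //; lra.
have -> : p - q = p * (1 - (2 * p / (2 * q))^-1).
  by field; rewrite !gt_eqF.
by rewrite ler_pM2l.
Qed.

(* Gibbs' inequality d(p,q) >= 0, read as: kl lies above its tangent at q. *)
Lemma kl_tangent p q : 0 <= p <= 1 -> 0 < q < 1 ->
  kl q (1 / 2) + (p - q) * (ln (2 * q) - ln (2 * (1 - q))) <= kl p (1 / 2).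
Proof.
move=> hp hq; rewrite !klE; [|lra|lra].
have h1 : p - q <= p * (ln (2 * p) - ln (2 * q)) by apply: gibbs_term; lra.
have h2 : (1 - p) - (1 - q) <= (1 - p) * (ln (2 * (1 - p)) - ln (2 * (1 - q))).
  by apply: gibbs_term; lra.
lra.
Qed.

(** Since [ln 0 = 0], the left side is 1 at [x = 0], which agrees with the power only for [m = 0];
    an empirical frequency 0 does come with the exponent 0. *)
Lemma expR_n_ln x (m : nat) : 0 <= x -> (x = 0 -> m = 0%N) ->
  expR (m%:R * ln x) = x ^+ m.
Proof.
rewrite le_eqVlt => /orP[/eqP <- /(_ erefl) ->|x0 _]; first by rewrite mul0r expR0.
by rewrite mulrC expRM_natr lnK.
Qed.

(* exp(n d(k/n, 1/2)) is the likelihood ratio of k successes in n trials between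
   the empirical parameter k/n and 1/2. *)
Lemma expR_kl n k : (k <= n)%N ->
  expR (n%:R * kl (k%:R / n%:R) (1 / 2)) =
  2 ^+ n * ((k%:R / n%:R) ^+ k * (1 - k%:R / n%:R) ^+ (n - k)) :> R.
Proof.
case: n => [|n] kn; first by move: kn; rewrite leqn0 => /eqP ->; rewrite mul0r expR0 !expr0 !mulr1.
set q : R := k%:R / _.
have n0 : 0 < n.+1%:R :> R by rewrite ltr0n.
have q0 : 0 <= q by rewrite divr_ge0 ?ler0n.
have q1 : q <= 1 by rewrite ler_pdivrMr // mul1r ler_nat.
have qk : n.+1%:R * q = k%:R by rewrite mulrC divfK // gt_eqF.
have qk' : n.+1%:R * (1 - q) = (n.+1 - k)%:R by rewrite natrB // mulrBr qk mulr1.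
have q01 : 0 <= q <= 1 by rewrite q0.
have q0' : 0 <= 1 - q by rewrite subr_ge0.
rewrite (klE q01) mulrDr [_ * (q * _)]mulrA [X in _ + X]mulrA qk qk' expRD.
rewrite !expR_n_ln ?mulr_ge0 //.
- have -> : 2 ^+ n.+1 = 2 ^+ k * 2 ^+ (n.+1 - k) :> R by rewrite -exprD subnKC.
  by rewrite !exprMn; ring.
- move/eqP; rewrite mulf_eq0 pnatr_eq0 /= => /eqP h.
  by apply/eqP; rewrite -(eqr_nat R) -qk' h mulr0.
- move/eqP; rewrite mulf_eq0 pnatr_eq0 /= => /eqP h.
  by apply/eqP; rewrite -(eqr_nat R) -qk h mulr0.
Qed.

End RealFacts.

(** * Bernoulli samples *)

Section Bernoulli.
Variable R : realType.
Implicit Types (p : R) (n : nat) (s : seq bool) (F G phi : seq bool -> R).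

(** Expectation over [n] independent Bernoulli(p) results, the earliest at the head. Recursion on
    the first result is what makes extending a sample by one result a conditional mean. *)
Fixpoint bernE p n F : R :=
  if n is n'.+1 then
    p * bernE p n' (fun s => F (true :: s)) +
    (1 - p) * bernE p n' (fun s => F (false :: s))
  else F [::].

Lemma eq_bernE p n F G : (forall s, size s = n -> F s = G s) ->
  bernE p n F = bernE p n G.
Proof.
elim: n F G => [|n IH] F G FG /=; first exact: FG.
by congr (_ * _ + _ * _); apply: IH => s sn; apply: FG; rewrite /= sn.
Qed.

Lemma le_bernE p n F G : 0 <= p <= 1 ->
  (forall s, size s = n -> F s <= G s) -> bernE p n F <= bernE p n G.
Proof.
move=> /andP[p0 p1]; elim: n F G => [|n IH] F G FG /=; first exact: FG.
by rewrite lerD // ler_wpM2l ?subr_ge0 //; apply: IH => s sn; apply: FG; rewrite /= sn.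
Qed.

Lemma bernE_cst p n (c : R) : bernE p n (fun=> c) = c.
Proof. by elim: n => //= n ->; ring. Qed.

Lemma bernED p n F G :
  bernE p n (fun s => F s + G s) = bernE p n F + bernE p n G.
Proof. by elim: n F G => //= n IH F G; rewrite !IH; ring. Qed.

Lemma bernEZ p n (c : R) F : bernE p n (fun s => c * F s) = c * bernE p n F.
Proof. by elim: n F => //= n IH F; rewrite !IH; ring. Qed.

Lemma bernE_sum p n I (r : seq I) (F : I -> seq bool -> R) :
  bernE p n (fun s => \sum_(i <- r) F i s) = \sum_(i <- r) bernE p n (F i).
Proof.
elim: r => [|i r IH].
  by rewrite big_nil -[RHS](bernE_cst p n); apply: eq_bernE => s _; rewrite big_nil.
rewrite big_cons -IH -bernED; apply: eq_bernE => s _; by rewrite big_cons.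
Qed.

Lemma bernE_prod p n (g : bool -> R) :
  bernE p n (fun s => \prod_(b <- s) g b) = (p * g true + (1 - p) * g false) ^+ n.
Proof.
elim: n => [|n IH] /=; first by rewrite big_nil.
have H b : bernE p n (fun s => \prod_(c <- b :: s) g c) =
    g b * bernE p n (fun s => \prod_(c <- s) g c).
  by rewrite -bernEZ; apply: eq_bernE => s _; rewrite big_cons.
by rewrite !H IH exprS; ring.
Qed.

Lemma bernE_take p n N F : (n <= N)%N ->
  bernE p N (fun s => F (take n s)) = bernE p n F.
Proof.
elim: n N F => [|n IH] [|N] F //= nN.
- by rewrite !bernE_cst; ring.
- by rewrite (IH N (fun s => F (true :: s))) // (IH N (fun s => F (false :: s))).
Qed.

Lemma bernE_ge0 p n F : 0 <= p <= 1 -> (forall s, 0 <= F s) -> 0 <= bernE p n F.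
Proof.
by move=> p01 F0; rewrite -(bernE_cst p n 0); apply: le_bernE => // s _.
Qed.

Lemma bernE0 n F : bernE 0 n F = F (nseq n false).
Proof. by elim: n F => //= n IH F; rewrite !IH; ring. Qed.

(** It dominates a nonnegative [phi] at whatever sample size the algorithm happens to have reached,
    see [psum_ge]. *)
Definition psum phi s : R := \sum_(n < (size s).+1) phi (take n s).

Lemma bernE_psum p N phi : bernE p N (psum phi) = \sum_(n < N.+1) bernE p n phi.
Proof.
have -> : bernE p N (psum phi) =
    bernE p N (fun s => \sum_(n < N.+1) phi (take n s)).
  by apply: eq_bernE => s sN; rewrite /psum sN.
rewrite bernE_sum; apply: eq_bigr => i _; apply: bernE_take.
by rewrite -ltnS.
Qed.

Lemma psum_ge0 phi s : (forall s, 0 <= phi s) -> 0 <= psum phi s.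
Proof. by move=> h; apply: sumr_ge0. Qed.

Lemma psum_ge phi s n : (forall s, 0 <= phi s) -> (n <= size s)%N ->
  phi (take n s) <= psum phi s.
Proof.
move=> h ns; have ns' : (n < (size s).+1)%N by [].
rewrite /psum (bigD1 (Ordinal ns')) //= lerDl; exact: sumr_ge0.
Qed.

(** The monotonicity under further samples that [trE_star] demands in order to complete samples to a
    full table. *)
Lemma psum_cat phi s s' : (forall s, 0 <= phi s) -> psum phi s <= psum phi (s ++ s').
Proof.
move=> h; rewrite /psum -!(big_mkord xpredT (fun n => phi (take n _))).
have le : ((size s).+1 <= (size (s ++ s')).+1)%N by rewrite ltnS size_cat leq_addr.
rewrite [leRHS](big_cat_nat (leq0n _) le) //=.
have -> : \sum_(0 <= i < (size s).+1) phi (take i (s ++ s')) =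
          \sum_(0 <= i < (size s).+1) phi (take i s).
  rewrite !big_nat; apply: eq_bigr => i /andP[_ iS].
  by rewrite takel_cat.
by rewrite lerDl; apply: sumr_ge0.
Qed.

(** [expR_le_quad] on both outcomes: the linear terms cancel, and the quadratic ones add up to
    [2 * l ^+ 2] times the variance [p * (1 - p) <= 1]. *)
Lemma mgf_step p (l : R) : 0 <= p <= 1 -> -(1 / 2) <= l <= 1 / 2 ->
  p * expR (l * (1 - p)) + (1 - p) * expR (l * (0 - p)) <= expR (2 * l ^+ 2).
Proof.
move=> hp hl.
have h1 : expR (l * (1 - p)) <= 1 + l * (1 - p) + 2 * (l * (1 - p)) ^+ 2.
  by apply: expR_le_quad; nra.
have h2 : expR (l * (0 - p)) <= 1 + l * (0 - p) + 2 * (l * (0 - p)) ^+ 2.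
  by apply: expR_le_quad; nra.
have h3 : p * expR (l * (1 - p)) <= p * (1 + l * (1 - p) + 2 * (l * (1 - p)) ^+ 2).
  by rewrite ler_wpM2l //; lra.
have h4 : (1 - p) * expR (l * (0 - p)) <=
    (1 - p) * (1 + l * (0 - p) + 2 * (l * (0 - p)) ^+ 2).
  by rewrite ler_wpM2l //; lra.
apply: le_trans (lerD h3 h4) _.
have h5 : 1 + 2 * l ^+ 2 <= expR (2 * l ^+ 2) by exact: expR_ge1Dx.
apply: le_trans h5; rewrite -subr_ge0.
have -> : 1 + 2 * l ^+ 2 - (p * (1 + l * (1 - p) + 2 * (l * (1 - p)) ^+ 2) +
   (1 - p) * (1 + l * (0 - p) + 2 * (l * (0 - p)) ^+ 2)) =
   2 * l ^+ 2 * (p ^+ 2 + (1 - p)) by ring.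
have := sqr_ge0 l; have := sqr_ge0 p; move: (l ^+ 2) (p ^+ 2) => u v v0 u0.
by apply: mulr_ge0; lra.
Qed.

Definition nsucc s : R := (count id s)%:R.

Lemma prod_expR s (l p : R) :
  \prod_(b <- s) expR (l * ((b : bool)%:R - p)) =
  expR (l * (nsucc s - (size s)%:R * p)).
Proof.
rewrite /nsucc; elim: s => [|b s IH]; first by rewrite big_nil /= mul0r subrr mulr0 expR0.
by rewrite big_cons IH -expRD /= natrD -addn1 natrD; congr expR; ring.
Qed.

Lemma mgf p n (l : R) : 0 <= p <= 1 -> -(1 / 2) <= l <= 1 / 2 ->
  bernE p n (fun s => expR (l * (nsucc s - n%:R * p))) <= expR (2 * l ^+ 2) ^+ n.
Proof.
move=> hp hl.
rewrite (@eq_bernE p n _ (fun s => \prod_(b <- s) expR (l * (b%:R - p)))); last first.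
  by move=> s <-; rewrite prod_expR.
rewrite (@bernE_prod p n (fun b : bool => expR (l * (b%:R - p)))) lerXn2r ?nnegrE ?expR_ge0 //.
  by rewrite addr_ge0 ?mulr_ge0 ?expR_ge0 //; lra.
exact: mgf_step.
Qed.

(** Markov's inequality for [expR (l * (nsucc s - n%:R * p))]: the threshold gives [e ^+ 2 / 4] per
    sample and [mgf] takes back [2 * l ^+ 2 = e ^+ 2 / 8]. The sign of [l] selects the tail. *)
Lemma chernoff_gen p n (e l : R) (Q : pred (seq bool)) : 0 <= p <= 1 -> 0 <= e <= 1 ->
  l = e / 4 \/ l = - (e / 4) ->
  (forall s, size s = n -> Q s -> n%:R * e ^+ 2 / 4 <= l * (nsucc s - n%:R * p)) ->
  bernE p n (fun s => (Q s)%:R) <= expR (- (e ^+ 2 / 8 * n%:R)).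
Proof.
move=> hp he hl HQ.
have hl2 : l ^+ 2 = e ^+ 2 / 16 by case: hl => ->; field.
have hl3 : -(1 / 2) <= l <= 1 / 2 by case: hl => ->; lra.
pose a := expR (- (n%:R * e ^+ 2 / 4)) : R.
apply: (@le_trans _ _ (bernE p n (fun s => a * expR (l * (nsucc s - n%:R * p))))).
  apply: le_bernE => // s sn; rewrite -expRD.
  case: (boolP (Q s)) => /= Qs; last exact: expR_ge0.
  by rewrite mulr1n -[leLHS]expR0 ler_expR; have := HQ s sn Qs; lra.
rewrite bernEZ; apply: (le_trans (ler_wpM2l (expR_ge0 _) (mgf n hp hl3))).
by rewrite -expRM_natr -expRD ler_expR hl2; lra.
Qed.

Lemma chernoff_up p n (e : R) : 0 <= p <= 1 -> 0 <= e <= 1 ->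
  bernE p n (fun s => (n%:R * (p + e) <= nsucc s)%R%:R) <= expR (- (e ^+ 2 / 8 * n%:R)).
Proof.
move=> hp he; apply: (@chernoff_gen _ _ e (e / 4)) => //; first by left.
move=> s _ h.
have h1 : n%:R * e <= nsucc s - n%:R * p by lra.
have h2 : 0 <= e / 4 by lra.
by have := ler_wpM2l h2 h1; rewrite expr2; lra.
Qed.

Lemma chernoff_lo p n (e : R) : 0 <= p <= 1 -> 0 <= e <= 1 ->
  bernE p n (fun s => (nsucc s <= n%:R * (p - e))%R%:R) <= expR (- (e ^+ 2 / 8 * n%:R)).
Proof.
move=> hp he; apply: (@chernoff_gen _ _ e (- (e / 4))) => //; first by right.
move=> s _ h.
have h1 : n%:R * e <= - (nsucc s - n%:R * p) by lra.
have h2 : 0 <= e / 4 by lra.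
by have := ler_wpM2l h2 h1; rewrite expr2; lra.
Qed.

(** The value on the empty sample is the default of [muhat], so that the two agree before any
    comparison. *)
Definition phat s : R := if s is [::] then 1 / 2 else nsucc s / (size s)%:R.

Lemma phat01 s : 0 <= phat s <= 1.
Proof.
case: s => [|b s]; first by rewrite /=; lra.
rewrite /phat; set z := b :: s.
rewrite divr_ge0 ?ler0n //= ler_pdivrMr ?ltr0n // mul1r ler_nat; exact: count_size.
Qed.

Lemma nsucc_phat s : nsucc s = (size s)%:R * phat s.
Proof.
case: s => [|b s]; first by rewrite mul0r.
by rewrite /phat mulrC divfK // pnatr_eq0.
Qed.

(* The contribution exp(n d(muhat, 1/2)), muhat <= 1/2, of one opponent to exp(I). *)
Definition zeta s : R :=
  (phat s <= 1 / 2)%R%:R * expR ((size s)%:R * kl (phat s) (1 / 2)).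

Lemma zeta_ge0 s : 0 <= zeta s.
Proof. by rewrite mulr_ge0 ?ler0n ?expR_ge0. Qed.

Lemma prod_tilt s (a b : R) :
  \prod_(x <- s) (if x then a else b) = a ^+ count id s * b ^+ (size s - count id s).
Proof.
elim: s => [|x s IH]; first by rewrite big_nil !expr0 mulr1.
rewrite big_cons IH; case: x => /=; first by rewrite add1n subSS exprS mulrA.
by rewrite add0n subSn ?count_size // exprS mulrCA.
Qed.

(* d(muhat,1/2) is a maximum over q of log-likelihood ratios; the union bound over the
   possible values q = k/n turns zeta into a sum of products over the samples. *)
Lemma bernE_zeta_le p n (r rho : R) : 0 <= p <= 1 -> 0 < r <= 1 -> 
  2 * p * r <= rho -> 2 * (1 - p) / r <= rho -> 0 <= rho ->
  bernE p n zeta <= n.+1%:R * rho ^+ n.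
Proof.
move=> hp /andP[r0 r1] h1 h2 rho0.
have r1' : 1 <= r^-1 by rewrite invf_ge1.
case: n => [|n].
  by rewrite /= /zeta /= mul0r expR0 expr0 !mulr1 ler_nat leq_b1.
pose q (k : nat) : R := k%:R / n.+1%:R.
(* The tilt [r] exploits [phat s <= 1 / 2]: failures are then at least as many as successes, so
   [r ^+ k * r^-1 ^+ (n - k) >= 1]. It brings down the factor [2 * p], which is above 1 in the
   application. *)
pose g k (x : bool) : R := if x then 2 * q k * r else 2 * (1 - q k) / r.
have n0 : 0 < n.+1%:R :> R by rewrite ltr0n.
have q0 k : 0 <= q k by rewrite divr_ge0 ?ler0n.
have q1 k : (k <= n.+1)%N -> 0 <= 1 - q k.
  by move=> kn; rewrite subr_ge0 ler_pdivrMr // mul1r ler_nat.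
have pw s k : size s = n.+1 -> \prod_(x <- s) g k x =
   2 ^+ n.+1 * (q k ^+ count id s * (1 - q k) ^+ (n.+1 - count id s)) *
   (r ^+ count id s * r^-1 ^+ (n.+1 - count id s)).
  move=> sn; rewrite prod_tilt sn.
  have cs : (count id s <= n.+1)%N by rewrite -sn count_size.
  have -> : 2 ^+ n.+1 = 2 ^+ count id s * 2 ^+ (n.+1 - count id s) :> R.
    by rewrite -exprD subnKC.
  by rewrite !exprMn; ring.
have g0 s k : (k <= n.+1)%N -> 0 <= \prod_(x <- s) g k x.
  move=> kn; apply: prodr_ge0 => x _; rewrite /g; case: x.
    by rewrite !mulr_ge0 // ltW.
  by rewrite divr_ge0 ?mulr_ge0 ?q1 // ltW.
have le1 : bernE p n.+1 zeta <=
    bernE p n.+1 (fun s => \sum_(k < n.+2) \prod_(x <- s) g k x).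
  apply: le_bernE => // s sn; rewrite /zeta.
  have cs : (count id s <= n.+1)%N by rewrite -sn count_size.
  case: (boolP (phat s <= 1 / 2)) => hs; last first.
    by rewrite mul0r; apply: sumr_ge0 => k _; apply: g0; rewrite -ltnS.
  have phE : phat s = q (count id s) by rewrite /phat /q /nsucc -sn; case: s sn {pw g0 hs cs}.
  have cs' : (count id s < n.+2)%N by [].
  rewrite (bigD1 (Ordinal cs')) //= [leLHS]mul1r; apply: ler_wpDr.
    by apply: sumr_ge0 => k _; apply: g0; rewrite -ltnS.
  have klq := expR_kl R cs; rewrite -/(q (count id s)) in klq.
  rewrite pw // phE sn klq ler_peMr //.
    by rewrite !mulr_ge0 ?exprn_ge0 ?q1.
  have hle : (count id s <= n.+1 - count id s)%N.
    rewrite leq_subRL // addnn -mul2n -(ler_nat R) natrM.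
    move: hs; rewrite phE /q ler_pdivrMr //; lra.
  rewrite -(subnKC hle) exprD mulrA -exprMn divff ?gt_eqF // expr1n mul1r.
  by rewrite exprn_ege1.
apply: le_trans le1 _; rewrite bernE_sum.
rewrite [leRHS](_ : _ = \sum_(k < n.+2) rho ^+ n.+1); last first.
  by rewrite sumr_const card_ord mulr_natl.
apply: ler_sum => k _.
rewrite bernE_prod lerXn2r ?nnegrE //; have k1 : (k <= n.+1)%N by rewrite -ltnS.
  rewrite /g; apply: addr_ge0; first by rewrite !mulr_ge0 ?q0 ?(ltW r0) //; lra.
  by rewrite mulr_ge0 ?divr_ge0 ?mulr_ge0 ?q1 ?(ltW r0) //; lra.
rewrite /g.
(* The mean of one factor is a convex combination of two numbers below [rho], whatever the value of
   [q k]. *)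
have -> : p * (2 * q k * r) + (1 - p) * (2 * (1 - q k) / r) =
   q k * (2 * p * r) + (1 - q k) * (2 * (1 - p) / r) by field; rewrite gt_eqF.
have a1 := ler_wpM2l (q0 k) h1.
have a2 := ler_wpM2l (q1 k k1) h2.
by apply: le_trans (lerD a1 a2) _; rewrite -mulrDl; lra.
Qed.

Lemma sum_bernE_zeta p : 1 / 2 < p <= 1 ->
  exists2 C : R, 0 <= C & forall N, \sum_(n < N) bernE p n zeta <= C.
Proof.
(* The midpoint of [2 * (1 - p)] and [(2 * p)^-1], the two limits that [2 * (1 - p) / r < 1] and
   [2 * p * r < 1] set for [r]; they are distinct because [4 * p * (1 - p) < 1]. *)
move=> hp; pose r := (1 - p) + (4 * p)^-1.
have p0 : 0 < p by lra.
have pV : 4 * p * (4 * p)^-1 = 1 by rewrite divff // gt_eqF //; lra.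
have V0 : 0 < (4 * p)^-1 by rewrite invr_gt0; lra.
have r0 : 0 < r by rewrite /r; lra.
have pp : 4 * p * (1 - p) < 1 by nra.
have h1 : 2 * p * r < 1 by rewrite /r; nra.
have r1 : r <= 1 by rewrite /r in h1 *; nra.
have h2 : 2 * (1 - p) / r < 1.
  rewrite ltr_pdivrMr // mul1r /r.
  suff : 1 - p < (4 * p)^-1 by lra.
  by rewrite -[ltRHS]mul1r ltr_pdivlMr; lra.
have h3 : 0 <= 2 * (1 - p) / r by rewrite divr_ge0 //; lra.
pose rho := Num.max (2 * p * r) (2 * (1 - p) / r).
have rho0 : 0 <= rho by rewrite le_max h3 orbT.
have rho1 : rho < 1 by rewrite gt_max h1 h2.
exists ((1 - rho) ^- 2); first by rewrite invr_ge0 exprn_ge0 // subr_ge0 ltW.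
move=> N; rewrite -(big_mkord xpredT (fun n => bernE p n zeta)).
apply: le_trans (sum_arith_geo_le N (_ : 0 <= rho < 1)); last by rewrite rho0.
apply: ler_sum => n _; apply: (@bernE_zeta_le _ _ r) => //.
- by lra.
- by rewrite r0.
- by rewrite le_max lexx.
- by rewrite le_max lexx orbT.
Qed.

(** Absence of deviation at size n turns n d^+(muhat, 1/2) <= log T + f(K) into n <= (1 + delta)(log
    T + f(K)) / d(q, 1/2). *)
Definition dev (delta q : R) s : bool :=
  (1 + delta) * klp (phat s) (1 / 2) < kl q (1 / 2).

Lemma bernE_le1 p n (Q : pred (seq bool)) : 0 <= p <= 1 ->
  bernE p n (fun s => (Q s)%:R) <= 1.
Proof.
move=> hp; rewrite -[leRHS](bernE_cst p n); apply: le_bernE => // s _.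
by case: (Q s).
Qed.

(** By the tangent inequality, an estimate below [q + e] loses at most [e] times the slope at [q] in
    divergence. A deviation thus forces [phat] above [q] by a multiple of [delta], to which
    [chernoff_up] applies. *)
Lemma bernE_dev q : 0 <= q < 1 / 2 ->
  exists2 c : R, 0 < c <= 1 & forall delta n, 0 < delta <= 1 ->
    bernE q n (fun s => (dev delta q s)%:R) <= expR (- (c * delta ^+ 2 * n%:R)).
Proof.
move=> /andP[]; rewrite le_eqVlt => /orP[/eqP <- _|q0 q1].
  (* At [q = 0] the tangent is vertical, but every result is a failure: a nonempty sample estimates
     [q] exactly and cannot deviate. *)
  exists 1; first lra.
  move=> delta [|n] hd; first by rewrite mulr0 oppr0 expR0 bernE_le1 //; lra.
  rewrite bernE0 /dev.
  have -> : phat (nseq n.+1 false) = 0.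
    by rewrite /phat /nsucc /= count_nseq /= mul0n mul0r.
  have k0 : 0 < kl 0 (1 / 2) :> R by apply: kl_gt0; lra.
  rewrite /klp ifT; last lra.
  rewrite ltNge [X in ~~ X]ler_peMl /=; [exact: expR_ge0|exact: ltW|lra].
have kq : 0 < kl q (1 / 2) by apply: kl_gt0; lra.
set k := kl q (1 / 2) in kq *.
pose a := ln (2 * (1 - q)) - ln (2 * q).
have a0 : 0 < a by rewrite subr_gt0 ltr_ln ?posrE; lra.
(* The first bound makes the loss [e0 * delta * a] at most [k * delta / 2], and
   [(1 + delta) * (1 - delta / 2) >= 1]. The second keeps the estimate below 1/2, where [klp] is
   [kl]. *)
pose e0 := Num.min (k / (2 * a)) (1 / 2 - q).
have e00 : 0 < e0 by rewrite lt_min divr_gt0 //=; lra.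
have e01 : e0 <= k / (2 * a) by rewrite ge_min lexx.
have e02 : e0 <= 1 / 2 - q by rewrite ge_min lexx orbT.
have e03 : e0 * a <= k / 2.
  by have := ler_wpM2r (ltW a0) e01; rewrite (_ : _ / _ * a = k / 2) //; field; rewrite gt_eqF.
exists (e0 ^+ 2 / 8); first by apply/andP; split; [rewrite divr_gt0 ?exprn_gt0 | nra].
move=> delta n /andP[d0 d1].
have -> : e0 ^+ 2 / 8 * delta ^+ 2 = (e0 * delta) ^+ 2 / 8 by field.
have ed0 : 0 < e0 * delta by rewrite mulr_gt0.
have ed1 : e0 * delta <= e0 by rewrite ler_piMr // ltW.
case: n => [|n]; first by rewrite mulr0 oppr0 expR0 bernE_le1 //; lra.
have hq : 0 <= q <= 1 by lra.
have he : 0 <= e0 * delta <= 1 by lra.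
apply: le_trans (chernoff_up n.+1 hq he).
apply: le_bernE => // s sn; rewrite ler_nat.
case: (boolP (dev _ _ _)) => //; case: (boolP (_ <= nsucc s)) => //.
rewrite -ltNge nsucc_phat sn ltr_pM2l ?ltr0n // /dev => hph.
have hk : k - e0 * delta * a <= kl (phat s) (1 / 2).
  apply: le_trans (kl_tangent (phat01 s) (_ : 0 < q < 1)); last lra.
  rewrite -/k lerD2l -[ln _ - _]opprB -/a mulrN lerN2 ler_pM2r //; lra.
rewrite ltNge => /negP[]; rewrite /klp ifT; last lra.
have : (1 + delta) * (k - e0 * delta * a) <= (1 + delta) * kl (phat s) (1 / 2).
  by rewrite ler_pM2l //; lra.
apply: le_trans; rewrite -/k.
have h : e0 * a * delta <= k / 2 * delta by rewrite ler_pM2r.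
have -> : e0 * delta * a = e0 * a * delta by ring.
have : (1 + delta) * (k - k / 2 * delta) <= (1 + delta) * (k - e0 * a * delta).
  by rewrite ler_pM2l; lra.
apply: le_trans; rewrite -subr_ge0.
have -> : (1 + delta) * (k - k / 2 * delta) - k = k * delta * (1 - delta) / 2 by field.
by rewrite divr_ge0 // !mulr_ge0 //; [exact: ltW|exact: ltW|lra].
Qed.

(** The start [m] serves twice: 0 counts all deviations, the initial sample size only the late ones,
    at an exponentially small price. *)
Lemma sum_expRN_le (c : R) m N : 0 < c <= 1 ->
  \sum_(n < N | (m <= n)%N) expR (- (c * n%:R)) <= expR (- (c * m%:R)) * (2 / c).
Proof.
move=> hc; have c0 : 0 < c by lra.
set r := expR (- c).
have H : \sum_(0 <= i < N) r ^+ i <= 2 / c.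
  have r1 : c / 2 <= 1 - r by apply: oneB_expRN_ge; lra.
  apply: (le_trans (sum_geo_le _ (_ : 0 <= r < 1))).
    by rewrite expR_ge0 /=; lra.
  by rewrite -invf_div lef_pV2 ?posrE //; lra.
rewrite -(big_mkord (fun n => (m <= n)%N) (fun n => expR (- (c * n%:R)))).
apply: le_trans (ler_wpM2l (expR_ge0 _) H).
case: (leqP m N) => mN; last first.
  rewrite big_nat_cond big1 ?mulr_ge0 ?expR_ge0 ?sumr_ge0 // => [i _|i].
    by rewrite exprn_ge0 // expR_ge0.
  by move=> /andP[/andP[_ iN] mi]; move: (leq_ltn_trans mi iN); rewrite ltnNge (ltnW mN).
rewrite (big_cat_nat (leq0n _) mN) //= [X in X + _]big_nat_cond [X in X + _]big1 ?add0r; last first.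
  by move=> i /andP[/andP[_ im] mi]; move: im; rewrite ltnNge mi.
rewrite [leLHS](_ : _ = \sum_(0 <= i < N - m | (m <= i + m)%N) expR (- (c * (i + m)%:R))); last first.
  by rewrite -{1}[m]add0n big_addn.
rewrite mulr_sumr.
rewrite [leRHS](big_cat_nat (leq0n (N - m)) (leq_subr m N)) //= -[leLHS]addr0 lerD //; last first.
  by rewrite sumr_ge0 // => i _; rewrite mulr_ge0 ?exprn_ge0 ?expR_ge0.
rewrite big_mkcond /=; apply: ler_sum => i _; case: ifP => _.
  by rewrite -expRM_natr -expRD ler_expR natrD; lra.
by rewrite mulr_ge0 ?exprn_ge0 ?expR_ge0.
Qed.

End Bernoulli.

(** * Finite traces of a run and the samples they contain *)

Notation outcome K := ('I_K * 'I_K * bool)%type.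

Section Traces.
Variable K : nat.
Implicit Types (h : path K) (x : seq (outcome K)).

(* The most recent round comes first. *)
Fixpoint trace h n : seq (outcome K) :=
  if n is n'.+1 then (left_arm h n, right_arm h n, feedback h n) :: trace h n'
  else [::].

Lemma size_trace h n : size (trace h n) = n.
Proof. by elim: n => //= n ->. Qed.

Lemma eq_traceP h h' n :
  trace h n = trace h' n <->
  (forall s, (1 <= s <= n)%N -> left_arm h s = left_arm h' s /\
     right_arm h s = right_arm h' s /\ feedback h s = feedback h' s).
Proof.
elim: n => [|n IH] /=; first by split => // _ [].
split=> [[e1 e2 e3 /IH e] s /andP[s1]|H].
  rewrite leq_eqVlt => /orP[/eqP ->//|sn]; apply: e; by rewrite s1.
have [|-> [-> ->]] := H n.+1; first by rewrite leqnn.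
by congr (_ :: _); apply/IH => s /andP[s1 sn]; apply: H; rewrite s1 leqW.
Qed.

(** Results are read from the side of [a]. As a trace starts with its latest round, [rcons] restores
    the chronological order, so that earlier samples are prefixes of later ones. *)
Fixpoint obs (a b : 'I_K) x : seq bool :=
  if x is (l, m, y) :: x' then
    if (l == a) && (m == b) then rcons (obs a b x') y
    else if (l == b) && (m == a) then rcons (obs a b x') (~~ y)
    else obs a b x'
  else [::].

Lemma size_obs a b x : (size (obs a b x) <= size x)%N.
Proof.
elim: x => // -[[l m] y] x IH /=; case: ifP => _; first by rewrite size_rcons.
by case: ifP => _; [rewrite size_rcons|exact: leqW].
Qed.

Fixpoint traces n : seq (seq (outcome K)) :=
  if n is n'.+1 then [seq a :: x | a <- enum {: outcome K}, x <- traces n'] else [:: [::]].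

Lemma mem_traces n x : (x \in traces n) = (size x == n).
Proof.
elim: n x => [|n IH] x /=; first by rewrite inE; case: x.
case: x => [|a x] /=.
  by apply/negbTE/negP => /allpairsP[[? ?]] /= [].
rewrite eqSS -IH; apply/allpairsP/idP => [[[b y]] /= [_ yt [_ ->]]//|xt].
by exists (a, x); rewrite mem_enum.
Qed.

Lemma uniq_traces n : uniq (traces n).
Proof.
elim: n => //= n IH; apply: allpairs_uniq => //; first exact: enum_uniq.
by move=> [a x] [b y] _ _ [-> ->].
Qed.

End Traces.

(** * The law of the trace under an arbitrary choice of pairs *)

Section Process.
Variables (R : realType) (K : nat) (mu : 'M[R]_K) (T : nat).
Hypothesis hmu : preference_matrix mu.
Variables (d : measure_display) (Om : measurableType d) (P : probability Om R).
Variable H : Om -> path K.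
Hypothesis hfb : dueling_feedback mu T P H.
Local Open Scope classical_set_scope.

Definition trace_event n x : set Om := [set w | trace (H w) n = x].
Definition pair_event n x l m : set Om :=
  trace_event n x `&` ([set w | left_arm (H w) n.+1 = l] `&`
                       [set w | right_arm (H w) n.+1 = m]).
Definition fb_event n y : set Om := [set w | feedback (H w) n.+1 = y].

Lemma trace_eventS n x l m y :
  trace_event n.+1 ((l, m, y) :: x) = pair_event n x l m `&` fb_event n y.
Proof.
apply/seteqP; split=> w; rewrite /trace_event /pair_event /fb_event /=.
  by move=> [-> -> -> <-].
by move=> [[<- [-> ->]] ->].
Qed.

Lemma measurable_left n l : (n < T)%N ->
  measurable [set w | left_arm (H w) n.+1 = l].
Proof. by case: hfb => h _ _ _ nT; apply: h. Qed.

Lemma measurable_right n l : (n < T)%N ->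
  measurable [set w | right_arm (H w) n.+1 = l].
Proof. by case: hfb => _ h _ _ nT; apply: h. Qed.

Lemma measurable_fb n y : (n < T)%N -> measurable (fb_event n y).
Proof.
case: hfb => _ _ h _ nT.
have m1 : measurable [set w | feedback (H w) n.+1] by apply: h.
case: y; first exact: m1.
rewrite (_ : fb_event n false = ~` [set w | feedback (H w) n.+1]); first exact: measurableC.
apply/seteqP; split=> w; rewrite /fb_event /=; first by move=> ->.
by move/negP/negbTE.
Qed.

Lemma measurable_trace n x : (n <= T)%N -> measurable (trace_event n x).
Proof.
elim: n x => [|n IH] x nT.
  case: x => [|a x].
    by rewrite (_ : trace_event 0 [::] = setT) //; apply/seteqP; split.
  by rewrite (_ : trace_event 0 _ = set0) //; apply/seteqP; split.
case: x => [|[[l m] y] x].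
  by rewrite (_ : trace_event _ _ = set0) //; apply/seteqP; split.
rewrite trace_eventS /pair_event.
apply: measurableI; last exact: measurable_fb.
apply: measurableI; first by apply: IH; exact: ltnW.
by apply: measurableI; [exact: measurable_left|exact: measurable_right].
Qed.

Lemma measurable_pair n x l m : (n < T)%N -> measurable (pair_event n x l m).
Proof.
move=> nT; apply: measurableI; first by apply: measurable_trace; exact: ltnW.
by apply: measurableI; [exact: measurable_left|exact: measurable_right].
Qed.

(** A nonempty [pair_event] is the [past_event] of any of its runs, so the feedback hypothesis
    applies to it; for an empty one both sides are 0. *)
Lemma pair_fb n x l m : (n < T)%N ->
  P (pair_event n x l m `&` fb_event n true) = ((mu l m)%:E * P (pair_event n x l m))%E.
Proof.
move=> nT; have [[w0 hw0]|/forallNP e] := pselect (exists w, pair_event n x l m w).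
  case: hfb => _ _ _ /(_ n.+1 (H w0)) h.
  have E : past_event H (H w0) n.+1 = pair_event n x l m.
    move: hw0; rewrite /pair_event /trace_event /= => -[<- [<- <-]].
    apply/seteqP; split=> w /=; rewrite /past_event /=.
      move=> [h1 h2]; have [|-> ->] := h1 n.+1; rewrite ?leqnn //.
      split=> //; apply/eq_traceP => s /andP[s1 sn].
      have [|-> ->] := h1 s; first by rewrite s1 leqW.
      by rewrite h2 // s1 ltnS.
    move=> [/eq_traceP h1 [h2 h3]]; split=> s /andP[s1].
      rewrite leq_eqVlt => /orP[/eqP -> //|sn].
      by have [|-> [-> _]] := h1 s; rewrite ?s1.
    by rewrite ltnS => sn; have [|_ [_ ->]] := h1 s; rewrite ?s1.
  by move: h; rewrite E /fb_event; case: hw0 => _ [-> ->]; apply.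
have -> : pair_event n x l m = set0 by rewrite -subset0 => w /e.
by rewrite set0I measure0 mule0.
Qed.

Definition pr n x : R := fine (P (trace_event n x)).
Definition ppair n x l m : R := fine (P (pair_event n x l m)).

Lemma ppair_ge0 n x l m : 0 <= ppair n x l m.
Proof. by rewrite fine_ge0. Qed.

Lemma pr_ge0 n x : 0 <= pr n x.
Proof. by rewrite fine_ge0. Qed.

Lemma pr_true n x l m : (n < T)%N ->
  pr n.+1 ((l, m, true) :: x) = mu l m * ppair n x l m.
Proof.
move=> nT; rewrite /pr trace_eventS pair_fb // fineM //.
exact: fin_num_measure (measurable_pair _ _ _ nT).
Qed.

Lemma fine_partition (A : set Om) (f : Om -> 'I_K) : measurable A ->
  (forall i, measurable [set w | f w = i]) ->
  fine (P A) = \sum_(i < K) fine (P (A `&` [set w | f w = i])).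
Proof.
move=> mA mf; pose F i := A `&` [set w | f w = i].
have mF i : measurable (F i) by exact: measurableI.
have E : A = \big[setU/set0]_(i < K) F i.
  apply/seteqP; split=> w.
    by move=> Aw; rewrite (bigD1 (f w)) //=; left.
  by apply: (big_ind (fun S : set Om => S w -> A w)) => // [S S' h1 h2 []//|i _ []].
rewrite {1}E measure_semi_additive_ord //.
- by rewrite sum_fine // => i _; apply: fin_num_measure; exact: mF.
- by move=> i j _ _ [w [[_ <-] [_ <-]]].
- by rewrite -E.
Qed.

Lemma sum_ppair n x : (n < T)%N -> \sum_l \sum_m ppair n x l m = pr n x.
Proof.
move=> nT; rewrite /pr (@fine_partition _ (fun w => left_arm (H w) n.+1)).
- apply: eq_bigr => l _.
  rewrite (@fine_partition _ (fun w => right_arm (H w) n.+1)).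
  + by apply: eq_bigr => m _; rewrite /ppair /pair_event setIA.
  + by apply: measurableI; [apply: measurable_trace; exact: ltnW|exact: measurable_left].
  + by move=> i; exact: measurable_right.
- by apply: measurable_trace; exact: ltnW.
- by move=> i; exact: measurable_left.
Qed.

Lemma pr_false n x l m : (n < T)%N ->
  pr n.+1 ((l, m, false) :: x) = (1 - mu l m) * ppair n x l m.
Proof.
move=> nT; rewrite mulrBl mul1r -pr_true //; apply/eqP; rewrite eq_sym subr_eq; apply/eqP.
rewrite /pr /ppair !trace_eventS.
have E : pair_event n x l m = (pair_event n x l m `&` fb_event n false) `|`
   (pair_event n x l m `&` fb_event n true).
  rewrite -setIUr (_ : _ `|` _ = setT) ?setIT //.
  by apply/seteqP; split=> // w _ /=; rewrite /fb_event /=; case: feedback; [right|left].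
have m1 := measurable_pair x l m nT.
have mF y : measurable (pair_event n x l m `&` fb_event n y).
  by apply: measurableI => //; exact: measurable_fb.
rewrite {1}E measureU //; first by rewrite fineD //; apply: fin_num_measure; exact: mF.
by apply/seteqP; split=> // w [[_ h1] [_ h2]]; move: h1; rewrite /fb_event /= h2.
Qed.

Definition trE n (f : seq (outcome K) -> R) : R := \sum_(x <- traces K n) pr n x * f x.

Lemma sum_round (F : outcome K -> R) :
  \sum_(a <- enum {: outcome K}) F a =
  \sum_l \sum_m (F (l, m, true) + F (l, m, false)).
Proof.
rewrite big_enum /= pair_bigA /=.
rewrite (eq_bigr (fun p : 'I_K * 'I_K => \sum_(y : bool) F (p, y))); last first.
  by move=> [l m] _; rewrite big_bool.
by rewrite pair_bigA /=; apply: eq_bigr => -[[l m] y].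
Qed.

(** Given the trace and the pair, the next result is Bernoulli. As the decrease is required for
    every pair, it survives averaging over pairs, however they are chosen and even with extra
    randomness. *)
Lemma trE_supermartingale (g : seq (outcome K) -> R) :
  (forall x l m, (size x < T)%N ->
     mu l m * g ((l, m, true) :: x) + (1 - mu l m) * g ((l, m, false) :: x) <= g x) ->
  forall n, (n <= T)%N -> trE n g <= g [::].
Proof.
move=> hg; elim=> [|n IH] nT.
  rewrite /trE /= big_seq1 /pr (_ : trace_event 0 [::] = setT); last first.
    by apply/seteqP; split.
  by rewrite probability_setT mul1r.
apply: le_trans (IH (ltnW nT)); rewrite /trE /= big_allpairs_dep exchange_big /=.
rewrite [leLHS]big_seq [leRHS]big_seq; apply: ler_sum => x; rewrite mem_traces => /eqP sx.
rewrite sum_round -sum_ppair // mulr_suml; apply: ler_sum => l _.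
rewrite mulr_suml; apply: ler_sum => m _; rewrite pr_true // pr_false //.
have -> : mu l m * ppair n x l m * g ((l, m, true) :: x) +
  (1 - mu l m) * ppair n x l m * g ((l, m, false) :: x) =
  ppair n x l m * (mu l m * g ((l, m, true) :: x) + (1 - mu l m) * g ((l, m, false) :: x)).
  by ring.
by rewrite ler_wpM2l ?ppair_ge0 // hg // sx.
Qed.

(** Traces that no point of [Om] realizes have probability 0, so an inequality along actual runs
    suffices. *)
Lemma le_trE (f g : seq (outcome K) -> R) :
  (forall w, f (trace (H w) T) <= g (trace (H w) T)) -> trE T f <= trE T g.
Proof.
move=> fg; apply: ler_sum => x _.
have [[w <-]|/forallNP e] := pselect (exists w, trace_event T x w).
  by rewrite ler_wpM2l ?pr_ge0.
rewrite /pr (_ : trace_event T x = set0) ?measure0 ?mul0r //.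
by rewrite -subset0 => w /e.
Qed.

Lemma trED n f g : trE n (fun x => f x + g x) = trE n f + trE n g.
Proof. by rewrite /trE -big_split; apply: eq_bigr => x _; rewrite mulrDr. Qed.

Lemma trEZ n (c : R) f : trE n (fun x => c * f x) = c * trE n f.
Proof. by rewrite /trE mulr_sumr; apply: eq_bigr => x _; rewrite mulrCA. Qed.

Lemma trE_sum n I (r : seq I) (Q : pred I) (F : I -> seq (outcome K) -> R) :
  trE n (fun x => \sum_(i <- r | Q i) F i x) = \sum_(i <- r | Q i) trE n (F i).
Proof.
rewrite /trE exchange_big; apply: eq_bigr => x _ /=; by rewrite mulr_sumr.
Qed.

Lemma trE_cst_le (c : R) : 0 <= c -> trE T (fun=> c) <= c.
Proof. by move=> c0; apply: (@trE_supermartingale (fun=> c)) => // x l m _; lra. Qed.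

(** The trace takes finitely many values, each on a measurable set, so a function of it is a finite
    combination of indicators. *)
Lemma integral_trace (f : seq (outcome K) -> R) : (forall x, 0 <= f x) ->
  (\int[P]_w (f (trace (H w) T))%:E = (trE T f)%:E)%E.
Proof.
move=> f0.
have E w : (f (trace (H w) T))%:E =
    (\sum_(x <- traces K T) (f x * \1_(trace_event T x) w)%:E)%E.
  have ht : trace (H w) T \in traces K T by rewrite mem_traces size_trace.
  rewrite (bigD1_seq _ ht (uniq_traces K T)) /= indicE mem_set // mulr1.
  rewrite big1 ?adde0 // => x /eqP xn; rewrite indicE memNset ?mulr0 //.
  by move=> e; apply: xn; rewrite -e.
under eq_integral do rewrite E.
rewrite ge0_integral_sum //.
- rewrite /trE -sumEFin; apply: eq_bigr => x _.
  under eq_integral do rewrite EFinM.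
  rewrite ge0_integralZl //; last 2 first.
    by apply/measurable_EFinP; apply: measurable_indic; exact: measurable_trace.
    by rewrite lee_fin.
  rewrite integral_indic ?setIT //; last exact: measurable_trace.
  rewrite muleC EFinM fineK //; apply: fin_num_measure; exact: measurable_trace.
- move=> x; apply/measurable_EFinP; apply: measurable_funM => //.
  by apply: measurable_indic; exact: measurable_trace.
- by move=> x w _; rewrite lee_fin mulr_ge0.
Qed.

End Process.

(** * Independence of the pairs *)

Section Star.
Variables (R : realType) (K : nat) (mu : 'M[R]_K) (T : nat).
Hypothesis hmu : preference_matrix mu.
Variables (d : measure_display) (Om : measurableType d) (P : probability Om R).
Variable H : Om -> path K.
Hypothesis hfb : dueling_feedback mu T P H.

Section Center.
Variables (a : 'I_K) (F : 'I_K -> seq bool -> R).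
Hypothesis F0 : forall j s, 0 <= F j s.
Hypothesis Fmono : forall j s s', F j s <= F j (s ++ s').

(* Conditional expectation of F given the first samples s, were the pair (a, j) to
   be compared T times in all. *)
Let V j s := bernE (mu a j) (T - size s) (fun s' => F j (s ++ s')).

Let mu01 i j : 0 <= mu i j <= 1. Proof. by case: hmu. Qed.

Let V_step j s : (size s < T)%N ->
  V j s = mu a j * V j (rcons s true) + (1 - mu a j) * V j (rcons s false).
Proof.
move=> sT; rewrite /V !size_rcons -[(T - size s)%N]prednK ?subn_gt0 //= subnS.
by congr (_ * _ + _ * _); apply: eq_bernE => s' _; rewrite cat_rcons.
Qed.

Let g x := \prod_(j < K | j != a) V j (obs a j x).


(* If every pair had its own table of i.i.d. results the factors would be independent;
   g is the corresponding martingale, whatever the order in which pairs are drawn. *)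
Lemma trE_star :
  trE P H T (fun x => \prod_(j < K | j != a) F j (obs a j x)) <=
  \prod_(j < K | j != a) bernE (mu a j) T (F j).
Proof.
have -> : \prod_(j < K | j != a) bernE (mu a j) T (F j) = g [::].
  by apply: eq_bigr => j _; rewrite /V subn0.
(* Passing to [g] completes each sample to [T] results, which by [Fmono] can only increase the
   product. *)
apply: (@le_trans _ _ (trE P H T g)).
  apply: le_trE => w; apply: ler_prod => j ja; rewrite F0 /= /V.
  rewrite -{1}(bernE_cst (mu a j) (T - size (obs a j (trace (H w) T))) (F j _)).
  by apply: le_bernE => // s _; exact: Fmono.
apply: (trE_supermartingale hfb) => // x l m xT.
have sT j : (size (obs a j x) < T)%N by exact: leq_ltn_trans (size_obs _ _ _) xT.
have muC i j : 1 - mu i j = mu j i by case: hmu => _ -> _; ring.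
have same y : (forall j, j != a -> obs a j ((l, m, y) :: x) = obs a j x) ->
    g ((l, m, y) :: x) = g x.
  by move=> h; apply: eq_bigr => j ja; rewrite h.
have upd j0 y b : j0 != a ->
    (forall j, j != a -> obs a j ((l, m, y) :: x) =
       if j == j0 then rcons (obs a j x) b else obs a j x) ->
    g ((l, m, y) :: x) = V j0 (rcons (obs a j0 x) b) *
       \prod_(j < K | (j != a) && (j != j0)) V j (obs a j x).
  move=> ja0 h; rewrite /g (bigD1 j0) // h // eqxx; congr (_ * _).
  by apply: eq_bigr => j /andP[ja jj]; rewrite h // (negbTE jj).
have old j0 : j0 != a -> g x = V j0 (obs a j0 x) *
    \prod_(j < K | (j != a) && (j != j0)) V j (obs a j x).
  by move=> ja; rewrite /g (bigD1 j0).
(* If [a] is drawn in neither or in both positions, no factor changes. Otherwise exactly one is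
   updated, and [V_step] is its conditional mean; with [a] on the right the result is negated, which
   matches [mu l a = 1 - mu a l]. *)
have [la|la] := eqVneq l a; have [ma|ma] := eqVneq m a.
- have h y j : j != a -> obs a j ((l, m, y) :: x) = obs a j x.
    by move=> ja; rewrite /= la ma eqxx eq_sym (negbTE ja).
  by rewrite !(same _ (h _)) -mulrDl addrC subrK mul1r.
- have h y j : j != a -> obs a j ((l, m, y) :: x) =
      if j == m then rcons (obs a j x) y else obs a j x.
    by move=> ja; rewrite /= la eqxx /= [m == j]eq_sym (negbTE ma) andbF.
  rewrite (upd m true true ma (h true)) (upd m false false ma (h false)) (old m) // (V_step m (sT m)) la.
  by rewrite le_eqVlt; apply/orP; left; apply/eqP; ring.
- have h y j : j != a -> obs a j ((l, m, y) :: x) =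
      if j == l then rcons (obs a j x) (~~ y) else obs a j x.
    by move=> ja; rewrite /= ma eqxx (negbTE la) /= [l == j]eq_sym andbT.
  rewrite (upd l true false la (h true)) (upd l false true la (h false)) (old l) // (V_step l (sT l)) ma.
  rewrite (muC l a) -(muC a l) le_eqVlt; apply/orP; left; apply/eqP; ring.
- have h y j : j != a -> obs a j ((l, m, y) :: x) = obs a j x.
    by move=> ja; rewrite /= (negbTE la) (negbTE ma) andbF.
  by rewrite !(same _ (h _)) -mulrDl addrC subrK mul1r.
Qed.

End Center.

(** The case of [trE_star] in which every factor but that of [j] is constantly 1. *)
Lemma trE_psum i j (phi : seq bool -> R) : i != j -> (forall s, 0 <= phi s) ->
  trE P H T (fun x => psum phi (obs i j x)) <= \sum_(n < T.+1) bernE (mu i j) n phi.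
Proof.
move=> ij phi0; rewrite -bernE_psum.
pose F k := if k == j then psum phi else fun=> 1.
have := @trE_star i F.
have E x : \prod_(k < K | k != i) F k (obs i k x) = psum phi (obs i j x).
  rewrite (bigD1 j) 1?eq_sym //= {1}/F eqxx big1 ?mulr1 // => k /andP[_ kj].
  by rewrite /F (negbTE kj).
rewrite [trE _ _ _ _](_ : _ = trE P H T (fun x => psum phi (obs i j x))); last first.
  by apply: eq_bigr => x _; rewrite E.
have -> : \prod_(k < K | k != i) bernE (mu i k) T (F k) = bernE (mu i j) T (psum phi).
  rewrite (bigD1 j) 1?eq_sym //= {1}/F eqxx big1 ?mulr1 // => k /andP[_ kj].
  by rewrite /F (negbTE kj) bernE_cst.
apply.
- by move=> k s; rewrite /F; case: ifP => _ //; exact: psum_ge0.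
- by move=> k s s'; rewrite /F; case: ifP => _ //; exact: psum_cat.
Qed.

Lemma trE_psum_prod a (phi : seq bool -> R) : (forall s, 0 <= phi s) ->
  trE P H T (fun x => \prod_(j < K | j != a) psum phi (obs a j x)) <=
  \prod_(j < K | j != a) \sum_(n < T.+1) bernE (mu a j) n phi.
Proof.
move=> phi0; rewrite (eq_bigr (fun j => bernE (mu a j) T (psum phi))); last first.
  by move=> j _; rewrite bernE_psum.
apply: (@trE_star a (fun=> psum phi)) => j s; first exact: psum_ge0.
by move=> s'; exact: psum_cat.
Qed.

End Star.

(** * Expected regret as an expectation over traces *)

Section ExpectedRegret.
Variables (R : realType) (K : nat) (mu : 'M[R]_K) (w : 'I_K) (T : nat).
Hypothesis hmu : preference_matrix mu.
Hypothesis hwin : condorcet_winner mu w.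
Variables (d : measure_display) (Om : measurableType d) (P : probability Om R).
Variable H : Om -> path K.
Hypothesis hfb : dueling_feedback mu T P H.

Lemma gap_ge0 j : 0 <= gap mu w j.
Proof.
rewrite /gap; have [->|/hwin] := eqVneq j w; last by lra.
by case: hmu => _ _ ->; lra.
Qed.

Lemma gap_le j : gap mu w j <= 1 / 2.
Proof. by rewrite /gap; case: hmu => /(_ w j) /andP[_ h] _ _; lra. Qed.

Definition trace_regret (x : seq (outcome K)) : R :=
  \sum_(a <- x) (gap mu w a.1.1 + gap mu w a.1.2) / 2.

Lemma regret_trace h n : regret mu w h n = trace_regret (trace h n).
Proof.
rewrite /regret /trace_regret; elim: n => [|n IH]; first by rewrite big_geq // big_nil.
by rewrite big_nat_recr //= IH big_cons addrC.
Qed.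

Lemma expected_regret_le (f : seq (outcome K) -> R) :
  (forall om, regret mu w (H om) T <= f (trace (H om) T)) ->
  (expected_regret mu w T P H <= (trE P H T f)%:E)%E.
Proof.
move=> hf; rewrite /expected_regret unlock.
under eq_integral do rewrite regret_trace.
rewrite (integral_trace hfb).
  by rewrite lee_fin; apply: le_trE => om; rewrite -regret_trace.
by move=> x; apply: sumr_ge0 => a _; rewrite divr_ge0 // addr_ge0 ?gap_ge0.
Qed.

End ExpectedRegret.

(** * Counts and estimates along one run *)

Section PathStatistics.
Variables (R : realType) (K : nat) (h : path K).
Implicit Types (i j : 'I_K) (t n : nat).

Definition drawn i j t : bool :=
  ((left_arm h t == i) && (right_arm h t == j)) ||
  ((left_arm h t == j) && (right_arm h t == i)).

Lemma ncmpS i j n : ncmp h i j n.+2 = (ncmp h i j n.+1 + drawn i j n.+1)%N.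
Proof. by rewrite /ncmp big_nat_recr. Qed.

Lemma ncmpC i j t : ncmp h i j t = ncmp h j i t.
Proof. by apply: eq_bigr => s _; rewrite orbC. Qed.

Lemma leq_ncmp i j s t : (s <= t)%N -> (ncmp h i j s <= ncmp h i j t)%N.
Proof.
case: s => [|s]; first by rewrite /ncmp big_geq.
by move=> st; rewrite /ncmp [leqRHS](big_cat_nat _ st) //= leq_addr.
Qed.

Lemma ncmp_add i j s k : (ncmp h i j (s + k) <= ncmp h i j s + k)%N.
Proof.
elim: k => [|k IH]; first by rewrite !addn0.
rewrite addnS; case: (s + k)%N IH => [|m] IH; last first.
  rewrite ncmpS addnS; apply: (leq_trans (leq_add IH (leq_b1 _))).
  by rewrite addn1.
by rewrite /ncmp big_geq.
Qed.

Lemma size_obs_trace i j n : i != j -> size (obs i j (trace h n)) = ncmp h i j n.+1.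
Proof.
move=> ij; elim: n => [|n IH]; first by rewrite /ncmp big_geq.
rewrite ncmpS -IH /= /drawn; case: ifP => h1; first by rewrite size_rcons addn1.
by case: ifP => h2; rewrite ?size_rcons ?addn1 // addn0.
Qed.

Lemma count_obs_trace i j n : i != j -> count id (obs i j (trace h n)) = nwin h i j n.+1.
Proof.
move=> ij; elim: n => [|n IH]; first by rewrite /nwin big_geq.
rewrite /nwin big_nat_recr //= -/(nwin h i j n.+1) -IH.
rewrite !andbA; case: ifP => h1; last case: ifP => h2.
- move/andP: h1 => [/eqP -> /eqP ->]; rewrite (negbTE ij) /= orbF.
  by rewrite -cats1 count_cat /= addn0.
- by rewrite -cats1 count_cat /= addn0.
- by rewrite addn0.
Qed.

(** Statistics at round [n.+1] see the rounds 1 to [n], hence the shift. *)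
Lemma muhat_phat i j n : i != j -> muhat R h n.+1 i j = phat R (obs i j (trace h n)).
Proof.
move=> ij; rewrite /muhat (negbTE ij) /= -count_obs_trace // -size_obs_trace //.
by case: (obs i j (trace h n)).
Qed.

Lemma obs_prefix i j n k :
  exists s, obs i j (trace h (n + k)) = obs i j (trace h n) ++ s.
Proof.
elim: k => [|k [s IH]]; first by exists [::]; rewrite addn0 cats0.
rewrite addnS /=; case: ifP => _; last case: ifP => _.
- by exists (rcons s (feedback h (n + k).+1)); rewrite IH rcons_cat.
- by exists (rcons s (~~ feedback h (n + k).+1)); rewrite IH rcons_cat.
- by exists s.
Qed.

Lemma obs_take i j n N : i != j -> (n <= N)%N ->
  obs i j (trace h n) = take (ncmp h i j n.+1) (obs i j (trace h N)).
Proof.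
move=> ij nN; have [s] := obs_prefix i j n (N - n).
by rewrite subnKC // => ->; rewrite -size_obs_trace // take_size_cat.
Qed.

(** All estimates of a pair up to the horizon are read off prefixes of one list, the final sample;
    this is how an event at a random round becomes a term of [psum]. *)
Lemma muhat_take i j t N : i != j -> (t <= N)%N ->
  muhat R h t.+1 i j = phat R (take (ncmp h i j t.+1) (obs i j (trace h N))).
Proof. by move=> ij tN; rewrite muhat_phat // (obs_take ij tN). Qed.

Lemma muhat01 i j t : 0 <= muhat R h t i j <= 1.
Proof.
case: t => [|t]; first by rewrite /muhat /ncmp big_geq // eqxx orbT; lra.
have [->|ij] := eqVneq i j; first by rewrite /muhat eqxx /=; lra.
by rewrite muhat_phat // phat01.
Qed.

Lemma nwinD i j t : i != j -> (nwin h i j t + nwin h j i t)%N = ncmp h i j t.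
Proof.
move=> ij; rewrite /nwin -big_split; apply: eq_bigr => s _ /=.
case: (eqVneq (left_arm h s) i) => [->|_]; case: (eqVneq (right_arm h s) j) => [->|_] /=;
  rewrite ?(negbTE ij) ?[j == i]eq_sym ?(negbTE ij) /= ?andbF //; case: (feedback h s);
  rewrite ?orbF ?andbF ?andbT //=; by case: (_ && _).
Qed.

Lemma muhatC i j t : muhat R h t i j = 1 - muhat R h t j i.
Proof.
have [->|ij] := eqVneq i j; first by rewrite /muhat eqxx /=; lra.
rewrite /muhat [j == i]eq_sym (negbTE ij) /= [ncmp h j i t]ncmpC.
case: eqVneq => [_|n0]; first by lra.
rewrite -[X in X - _](divff (_ : (ncmp h i j t)%:R != 0)) ?pnatr_eq0 //.
by rewrite -mulrBl -{2}(nwinD t ij) natrD addrK.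
Qed.

Lemma sum_drawn i j n (f : nat -> R) :
  \sum_(1 <= t < n.+1) (drawn i j t)%:R * f (ncmp h i j t) =
  \sum_(k < ncmp h i j n.+1) f k.
Proof.
elim: n => [|n IH]; first by rewrite /ncmp !big_geq // big_ord0.
rewrite big_nat_recr //= IH ncmpS; case: (drawn i j n.+1).
  by rewrite addn1 big_ord_recr /= mul1r.
by rewrite addn0 mul0r addr0.
Qed.

(* Distinct rounds comparing {i, j} have distinct values of N_{i,j}. *)
Lemma count_drawn_le i j n (Q : pred nat) (f : nat -> R) : (forall k, 0 <= f k) ->
  (forall t, (1 <= t <= n)%N -> Q t -> drawn i j t /\ 1 <= f (ncmp h i j t)) ->
  \sum_(1 <= t < n.+1) (Q t)%:R <= \sum_(k < ncmp h i j n.+1) f k.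
Proof.
move=> f0 HQ; rewrite -sum_drawn; apply: ler_sum_nat => t tn.
case: (boolP (Q t)) => [Qt|_]; last by rewrite mulr_ge0.
by have [-> h1] := HQ t tn Qt; rewrite mul1r.
Qed.

End PathStatistics.

(** * Entry and delay in the loop over candidate arms *)

Section Loop.
Variables (R : realType) (K : nat) (alpha fK : R) (T : nat).
Variables (order : seq 'I_K) (h : path K).
Variables (istar : nat -> 'I_K) (bhat : 'I_K -> 'I_K).
Hypothesis Hf : RMED2FH_follows alpha fK T order h istar bhat.
Hypothesis Ho : perm_eq order (enum 'I_K).

Let st := loop_at alpha fK T order h istar.
Let T0 := Tinit K alpha T.
Let J := evJ fK h istar.

Lemma mem_order x : x \in order.
Proof. by rewrite (perm_mem Ho) mem_enum. Qed.

Lemma size_order : size order = K.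
Proof. by rewrite (perm_size Ho) size_enum_ord. Qed.

Lemma loop_head n : (T0 + n.+1 <= T)%N ->
  exists rest, todo (st n) = left_arm h (T0 + n.+1) :: rest.
Proof.
case: Hf => _ _ _ /(_ (T0 + n.+1)%N) H nT.
have [|] := H; first by rewrite nT -/T0 addnS ltnS leq_addr.
rewrite (_ : (T0 + n.+1 - (Tinit K alpha T).+1)%N = n); last by rewrite -/T0; lia.
by rewrite -/st; case: (todo (st n)) => //= l rest [->] _; exists rest.
Qed.

Lemma mem_todo_start (LC : {set 'I_K}) x : x \in todo (start_loop order LC) = (x \in LC).
Proof. by rewrite mem_filter mem_order andbT. Qed.

Lemma loop_atS n : st n.+1 = loop_step fK order h istar (T0 + n.+1) (st n).
Proof. by []. Qed.

(** As [LR] stays inside the waiting list, an arm that is not waiting enters [LN] at any round where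
    its J holds. The size bound limits a loop to [K] rounds. *)
Lemma loop_inv n : (size (todo (st n)) <= K)%N /\
  forall x, x \in LR (st n) -> x \in todo (st n).
Proof.
have start LC : (size (todo (start_loop order LC)) <= K)%N /\
    forall x, x \in LR (start_loop order LC) -> x \in todo (start_loop order LC).
  split=> [|x]; last by rewrite mem_todo_start.
  by apply: (@leq_trans (size order)); [rewrite size_filter count_size|rewrite size_order].
elim: n => [|n [IH1 IH2]]; first exact: start.
rewrite loop_atS /loop_step; case E: (todo (st n)) => [|l rest]; first exact: conj.
case: rest E => [|l' rest] E; first exact: start.
rewrite E in IH1 IH2; split=> [|x] /=; first exact: ltnW.
by rewrite !inE => /andP[xl /IH2]; rewrite !inE (negbTE xl).
Qed.

Lemma todo_drawn s n x : todo (st n) = s -> x \in s -> (T0 + n + size s <= T)%N ->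
  exists2 t, (T0 + n < t <= T0 + n + size s)%N & left_arm h t = x.
Proof.
elim: s n => // l rest IH n E xs sT.
have [|r'] := @loop_head n; first by move: sT => /=; lia.
rewrite E => -[hl hr]; have [xl|xl] := eqVneq x l.
  by exists (T0 + n.+1)%N; [rewrite /=; lia | rewrite xl hl].
move: xs; rewrite inE (negbTE xl) /= => xr.
have E' : todo (st n.+1) = rest.
  by rewrite loop_atS /loop_step E; case: rest xr {IH E sT hr}.
have [|t ht <-] := IH n.+1 E' xr; first by move: sT => /=; lia.
by exists t => //; move: ht => /=; lia.
Qed.

Lemma LN_todo s n x : todo (st n) = s -> s != [::] -> x \in LN (st n) ->
  x \in todo (st (n + size s)).
Proof.
elim: s n => // l [|l' rest] IH n E _ xL.
  by rewrite addn1 loop_atS /loop_step E mem_todo_start inE xL.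
rewrite [size _]/= addnS -addSn; apply: IH => //.
  by rewrite loop_atS /loop_step E.
by rewrite loop_atS /loop_step E /= inE xL.
Qed.

(** An arm waiting in the current loop is drawn within [K] rounds. One that is not waiting joins
    [LN] at round [t], stays there until the loop ends, and is drawn in the next one. *)
Lemma J_drawn t x : (T0 < t)%N -> (t + 2 * K <= T)%N -> J t x ->
  exists2 t', (t <= t' < t + 2 * K)%N & left_arm h t' = x.
Proof.
move=> t0 tT Jx; have [n tE] : exists n, t = (T0 + n.+1)%N.
  by exists (t - T0.+1)%N; lia.
have [|rest E] := @loop_head n; first by lia.
have [sz LRt] := loop_inv n.
set l := left_arm h _ in E.
have [xt|xt] := boolP (x \in todo (st n)).
  have [|t' ht' <-] := todo_drawn erefl xt; first by lia.
  by exists t' => //; lia.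
have xLR : x \notin LR (st n) :\ l.
  by rewrite !inE; apply/negP => /andP[_ /LRt xr]; rewrite xr in xt.
have xn : x \in todo (st (n + size (l :: rest))).
  case: rest E => [|l' rest] E.
    rewrite addn1 loop_atS /loop_step E mem_todo_start !inE -tE -/J Jx andbT.
    by move: xLR; rewrite !inE => ->; rewrite orbT.
  have -> : (n + size [:: l, l' & rest] = n.+1 + size (l' :: rest))%N by rewrite /= addnS.
  apply: LN_todo => //.
    by rewrite loop_atS /loop_step E.
  rewrite loop_atS /loop_step E /= !inE -tE -/J Jx andbT.
  by move: xLR; rewrite !inE => ->; rewrite orbT.
have [sz' _] := loop_inv (n + size (l :: rest)).
rewrite E in sz.
have [|t' ht' <-] := todo_drawn erefl xn; first by lia.
by exists t' => //; lia.
Qed.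

(** A converse of [J_drawn]: after the first loop, which draws every arm unconditionally, an arm is
    drawn only because its J held during the preceding loop. *)
Lemma drawn_J t : (T0 + K < t <= T)%N ->
  exists2 t', (T0 < t' < t)%N && (t <= t' + 2 * K)%N & J t' (left_arm h t).
Proof.
(* [c] counts the rounds spent in the current loop. Arms of [LN] had their J within these [c]
   rounds, waiting arms within the loop before, unless [n = c], when the first loop is still
   running. *)
have inv n : (T0 + n <= T)%N -> exists2 c, (c <= n)%N && (c + size (todo (st n)) <= K)%N &
    (forall x, x \in LN (st n) -> exists2 n0, (n0 < n <= n0 + c)%N & J (T0 + n0.+1) x) /\
    (forall x, x \in todo (st n) -> n = c \/
       exists2 n0, (n0 < n <= n0 + K + c)%N & J (T0 + n0.+1) x).
  elim: n => [|n IH] nT.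
    exists 0%N; last by split=> x; [rewrite inE|left].
    by apply: (@leq_trans (size order)); [rewrite size_filter count_size|rewrite size_order].
  have [|c /andP[cn csz] [h1 h2]] := IH; first by lia.
  have [//|rest E] := @loop_head n; rewrite E /= in csz.
  have hLN x : x \in LN (st n) :|: [set j | (j \notin LR (st n) :\ left_arm h (T0 + n.+1)) &&
      J (T0 + n.+1) j] -> exists2 n0, (n0 < n.+1 <= n0 + c.+1)%N & J (T0 + n0.+1) x.
    rewrite 2!inE => /orP[/h1[n0 n0n Jx]|/andP[_ Jx]].
      by exists n0 => //; lia.
    by exists n => //; lia.
  rewrite loop_atS /loop_step E; case: rest E csz => [|l' rest] E csz.
    exists 0%N.
      by apply: (@leq_trans (size order)); [rewrite size_filter count_size|rewrite size_order].
    split=> x; first by rewrite inE.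
    rewrite mem_todo_start => /hLN[n0 n0n Jx]; right; exists n0 => //; lia.
  exists c.+1; first by rewrite /= in csz *; lia.
  split=> x /=; first exact: hLN.
  move=> xr; have [|->|[n0 n0n Jx]] := h2 x; first by rewrite E inE xr orbT.
    by left.
  by right; exists n0 => //; lia.
move=> tT; have [n tE] : exists n, t = (T0 + n.+1)%N by exists (t - T0.+1)%N; lia.
have [|c /andP[cn csz] [_ h2]] := inv n; first by lia.
have [|rest E] := @loop_head n; first by lia.
rewrite E /= in csz.
have [|nc|[n0 n0n Jx]] := h2 (left_arm h t); first by rewrite E -tE mem_head.
  by lia.
by exists (T0 + n0.+1)%N => //; lia.
Qed.

End Loop.

(** * Stability of b^* *)

Section Modulus.
Variable R : realType.
Implicit Types (f : R -> R) (x p : R).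

(** Endpoints are included because entries of [mu] and empirical frequencies may be 0 or 1, where
    one of the logarithms in the divergence is not continuous. *)
Definition cts01 f := forall x (eta : R), 0 <= x <= 1 -> 0 < eta ->
  exists2 e : R, 0 < e & forall p, 0 <= p <= 1 -> `|p - x| <= e -> `|f p - f x| <= eta.

Lemma cts01_xln : cts01 (fun p => p * ln (2 * p)).
Proof.
move=> x eta /andP[]; rewrite le_eqVlt => /orP[/eqP <- _ eta0|x0 _ eta0].
  (* For [2 * p <= 1], [ln_ge_1BV] at the square root of [2 * p] bounds [p * ln (2 * p)] in absolute
     value by that root, which is at most [eta] when [p <= eta ^+ 2 / 2]. *)
  exists (eta ^+ 2 / 2); first by rewrite divr_gt0 // exprn_gt0.
  move=> p /andP[p0 p1]; rewrite subr0 mul0r subr0 ger0_norm // => hp.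
  move: p0; rewrite le_eqVlt => /orP[/eqP <-|p0]; first by rewrite mul0r normr0 ltW.
  have [p2|p2] := leP (2 * p) 1; last first.
    have l0 : 0 <= ln (2 * p) by apply: ln_ge0; exact: ltW.
    have l1 : ln (2 * p) < 2 * p by apply: ln_sublinear; lra.
    have e1 : 1 < eta ^+ 2 by lra.
    have e2 : 1 <= eta.
      by rewrite leNgt; apply/negP => e3; move: e1; rewrite ltNge expr_le1 ?ltW.
    have h : ln (2 * p) <= 2 * p - 1.
      by have := @le_ln1Dx R (2 * p - 1); rewrite (_ : 1 + (2 * p - 1) = 2 * p); [apply; lra|ring].
    rewrite ger0_norm ?mulr_ge0 ?(ltW p0) //; nra.
  set s := Num.sqrt (2 * p).
  have s0 : 0 < s by rewrite sqrtr_gt0; lra.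
  have s2 : s ^+ 2 = 2 * p by rewrite sqr_sqrtr //; lra.
  have ln0 : ln (2 * p) <= 0 by exact: ln_le0.
  have h1 : 1 - s^-1 <= ln s by exact: ln_ge_1BV.
  have h2 : ln (2 * p) = 2 * ln s by rewrite -s2 lnXn // mulr_natl.
  have ss : s * s^-1 = 1 by rewrite divff // gt_eqF.
  have h3 : s <= eta.
    rewrite -(@ler_pXn2r _ 2) ?nnegrE ?(ltW s0) ?(ltW eta0) //; lra.
  rewrite ler0_norm; last by rewrite mulr_ge0_le0 // ltW.
  have h4 : p * (- ln (2 * p)) <= p * (2 * s^-1).
    by rewrite ler_pM2l // h2; lra.
  have h5 : p * (2 * s^-1) = s by rewrite mulrA [p * 2]mulrC -s2 expr2 -mulrA ss mulr1.
  by rewrite -mulrN; lra.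
have c : {for x, continuous (fun p : R => p * ln (2 * p))}.
  apply: cvgM; first exact: cvg_id.
  apply: (@continuous_comp _ _ _ (fun p : R => 2 * p) (@ln R)).
    by apply: cvgM; [exact: cvg_cst|exact: cvg_id].
  by apply: continuous_ln; rewrite mulr_gt0.
have /cvgrPdist_le /(_ eta eta0) := c.
move/nbhs_ballP => [e /= e0 he]; exists (e / 2); first by rewrite divr_gt0.
move=> p _ hp; rewrite distrC; apply: he.
rewrite /ball /= distrC; apply: le_lt_trans hp _; lra.
Qed.

Lemma cts01_kl : cts01 (fun p => kl p (1 / 2)).
Proof.
move=> x eta hx eta0.
have h2 : 0 < eta / 2 by rewrite divr_gt0.
have hx' : 0 <= 1 - x <= 1 by lra.
have [e1 e10 H1] := cts01_xln hx h2.
have [e2 e20 H2] := cts01_xln hx' h2.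
exists (Num.min e1 e2); first by rewrite lt_min e10.
move=> p hp; rewrite le_min => /andP[d1 d2].
have hp' : 0 <= 1 - p <= 1 by lra.
have a1 := H1 p hp d1.
have := H2 (1 - p) hp'.
rewrite (_ : 1 - p - (1 - x) = - (p - x)) ?normrN; last by ring.
move=> /(_ d2) a2; rewrite !klE //.
rewrite opprD addrACA; apply: le_trans (ler_normD _ _) _.
by rewrite [leRHS](splitr eta) lerD.
Qed.

(** The two branches of [klp] meet at 1/2, where [kl] vanishes. *)
Lemma cts01_klp : cts01 (fun p => klp p (1 / 2)).
Proof.
move=> x eta hx eta0; have [e1 e10 H1] := cts01_kl hx eta0.
have [x2|x2|x2] := ltgtP x (1 / 2).
- exists (Num.min e1 ((1 / 2 - x) / 2)).
    by rewrite lt_min e10 divr_gt0 //; lra.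
  move=> p hp; rewrite le_min => /andP[d1 d2].
  have p2 : p < 1 / 2 by have := ler_norm (p - x); lra.
  by rewrite /klp x2 p2; exact: H1.
- exists ((x - 1 / 2) / 2); first by rewrite divr_gt0 //; lra.
  move=> p hp d2.
  have p2 : 1 / 2 < p by move: d2; rewrite distrC; have := ler_norm (x - p); lra.
  by rewrite /klp [x < _]ltNge [p < _]ltNge (ltW x2) (ltW p2) /= subrr normr0 ltW.
- exists e1 => // p hp d1; have := H1 p hp d1.
  have -> : kl x (1 / 2) = 0.
    rewrite klE // x2 (_ : 2 * (1 / 2) = 1); last by field.
    by rewrite (_ : 2 * (1 - 1 / 2) = 1) ?ln1; [ring|field].
  rewrite /klp [x < _]ltNge x2 lexx /=; case: ifP => // _ _.
  by rewrite subrr normr0 ltW.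
Qed.

End Modulus.

Section Stability.
Variables (R : realType) (K : nat) (mu : 'M[R]_K) (w : 'I_K).
Hypothesis hmu : preference_matrix mu.
Hypothesis hwin : condorcet_winner mu w.
Variable bstar : 'I_K -> 'I_K.
Hypothesis hbstar : forall i, i != w -> is_bstar mu w i (bstar i).

Lemma mu_ge0 i j : 0 <= mu i j. Proof. by case: hmu => /(_ i j)/andP[]. Qed.

Lemma bstar_lt i : i != w -> mu i (bstar i) < 1 / 2.
Proof. by move=> /hbstar[]; rewrite inE. Qed.

Lemma mu_winner_lt i : i != w -> mu i w < 1 / 2.
Proof. by move=> iw; case: hmu => _ -> _; have := hwin iw; lra. Qed.

Lemma kl_bstar_gt0 i : i != w -> 0 < kl (mu i (bstar i)) (1 / 2).
Proof. by move=> iw; apply: kl_gt0; rewrite mu_ge0 bstar_lt. Qed.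

Lemma gap_gt0 i : i != w -> 0 < gap mu w i.
Proof. by move=> iw; rewrite /gap; have := hwin iw; lra. Qed.

Definition close_to (eps : R) (p : 'I_K -> 'I_K -> R) :=
  (forall i j, 0 <= p i j <= 1) /\ forall i j, `|p i j - mu i j| <= eps.

(** Cross-multiplying removes infinite objectives: for [j] outside O_i the left side is 0, and the
    right side is positive because arm [i] has a positive gap. *)
Lemma objective_cross i j : i != w -> j != bstar i ->
  (gap mu w i + gap mu w (bstar i)) * klp (mu i j) (1 / 2) <
  (gap mu w i + gap mu w j) * klp (mu i (bstar i)) (1 / 2).
Proof.
move=> iw jb; have k0 := kl_bstar_gt0 iw.
have kb : klp (mu i (bstar i)) (1 / 2) = kl (mu i (bstar i)) (1 / 2).
  by rewrite /klp bstar_lt.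
have [m2|m2] := ltP (mu i j) (1 / 2); last first.
  rewrite {1}/klp [mu i j < _]ltNge m2 /= mulr0 kb mulr_gt0 //.
  by have := gap_gt0 iw; have := gap_ge0 hmu hwin j; lra.
have [_ /(_ j)] := hbstar iw; rewrite inE => /(_ m2 jb).
have k2 : 0 < kl (mu i j) (1 / 2) by apply: kl_gt0; rewrite mu_ge0 m2.
by rewrite kb {1}/klp m2 ltr_pdivrMr // mulrAC ltr_pdivlMr.
Qed.

(* Cross-multiplied, the comparison of two objectives is a strict inequality between
   continuous functions of the estimates. *)
Lemma ediv_stable i j : i != w -> j != bstar i ->
  exists2 eps : R, 0 < eps & forall p, close_to eps p ->
    (ediv (p w i - 1 / 2 + (p w (bstar i) - 1 / 2)) (klp (p i (bstar i)) (1 / 2)) <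
     ediv (p w i - 1 / 2 + (p w j - 1 / 2)) (klp (p i j) (1 / 2)))%E.
Proof.
move=> iw jb; have := objective_cross iw jb.
set b := bstar i; set d1 := klp (mu i b) _; set d2 := klp (mu i j) _.
set c1 := gap mu w i + gap mu w b; set c2 := gap mu w i + gap mu w j => hlt.
have mu01 k l : 0 <= mu k l <= 1 by case: hmu.
have d10 : 0 < d1 by rewrite /d1 /klp bstar_lt // kl_bstar_gt0.
have d20 : 0 <= d2 by exact: klp_ge0.
pose g := c2 * d1 - c1 * d2.
have g0 : 0 < g by rewrite subr_gt0.
(* Error budget: the two products move by at most [eta + 2 * e3 * d2] and [eta + 2 * e3 * d1],
   together at most [g / 2]. The bound [d1 / 2] keeps the perturbed denominator [d1'] positive. *)
pose eta := Num.min (g / 8) (d1 / 2).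
have eta0 : 0 < eta by rewrite lt_min !divr_gt0.
have eta1 : eta <= g / 8 by rewrite ge_min lexx.
have eta2 : eta <= d1 / 2 by rewrite ge_min lexx orbT.
have [e1 e10 H1] := cts01_klp (mu01 i b) eta0.
have [e2 e20 H2] := cts01_klp (mu01 i j) eta0.
pose e3 := g / (8 * (1 + d1 + d2)).
have D0 : 0 < 8 * (1 + d1 + d2) by lra.
have e30 : 0 < e3 by rewrite divr_gt0.
exists (Num.min e1 (Num.min e2 e3)); first by rewrite !lt_min e10 e20.
move=> p [p01 pc].
have hp k l : (`|p k l - mu k l| <= e1) /\ (`|p k l - mu k l| <= e2) /\
    (`|p k l - mu k l| <= e3).
  by have := pc k l; rewrite !le_min => /andP[-> /andP[-> ->]].
set c1' := p w i - 1 / 2 + (p w b - 1 / 2); set c2' := p w i - 1 / 2 + (p w j - 1 / 2).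
set d1' := klp (p i b) _; set d2' := klp (p i j) _.
have hd1 : `|d1' - d1| <= eta by apply: H1 => //; case: (hp i b).
have hd2 : `|d2' - d2| <= eta by apply: H2 => //; case: (hp i j) => _ [].
have hc k : `|p w i - 1 / 2 + (p w k - 1 / 2) - (gap mu w i + gap mu w k)| <= 2 * e3.
  rewrite /gap (_ : _ - _ = (p w i - mu w i) + (p w k - mu w k)); last by ring.
  apply: le_trans (ler_normD _ _) _.
  have [_ [_ a1]] := hp w i; have [_ [_ a2]] := hp w k; move: a1 a2.
  by move: `|_| `|_| => u v; lra.
have hc1 := hc b; have hc2 := hc j; rewrite -/c1' -/c1 in hc1; rewrite -/c2' -/c2 in hc2.
have d1'0 : 0 < d1'.
  by move: hd1; rewrite ler_norml => /andP[h _]; lra.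
have d2'0 : 0 <= d2' by exact: klp_ge0.
have c1'1 : -1 <= c1' <= 1 by have := p01 w i; have := p01 w b; rewrite /c1'; lra.
have c2'1 : -1 <= c2' <= 1 by have := p01 w i; have := p01 w j; rewrite /c2'; lra.
have e3E : e3 * (8 * (1 + d1 + d2)) = g by rewrite divfK // gt_eqF.
have key : c1' * d2' < c2' * d1'.
  have k1 : `|c1' * d2' - c1 * d2| <= eta + d2 * (2 * e3).
    rewrite (_ : _ - _ = c1' * (d2' - d2) + d2 * (c1' - c1)); last by ring.
    apply: le_trans (ler_normD _ _) _; rewrite !normrM (ger0_norm d20).
    apply: lerD; last by rewrite ler_wpM2l.
    rewrite -[eta]mul1r ler_pM //; by rewrite ler_norml.
  have k2 : `|c2' * d1' - c2 * d1| <= eta + d1 * (2 * e3).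
    rewrite (_ : _ - _ = c2' * (d1' - d1) + d1 * (c2' - c2)); last by ring.
    apply: le_trans (ler_normD _ _) _; rewrite !normrM (gtr0_norm d10).
    apply: lerD; last by rewrite ler_wpM2l // ltW.
    rewrite -[eta]mul1r ler_pM //; by rewrite ler_norml.
  move: k1 k2; rewrite !ler_norml => /andP[_ k1] /andP[k2 _].
  have gE : g = c2 * d1 - c1 * d2 by [].
  have : 0 <= e3 by exact: ltW.
  move: gE e3E eta1 k1 k2 g0.
  move: (c1' * d2') (c2' * d1') (c1 * d2) (c2 * d1) => a1 a2 a3 a4.
  by move=> gE e3E eta1 k1 k2 g0 e3p; lra.
rewrite /ediv (gt_eqF d1'0); case: eqVneq => [_|d2n]; first by rewrite ltry.
have d2p : 0 < d2' by rewrite lt_def d2n.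
by rewrite lte_fin ltr_pdivrMr // mulrAC ltr_pdivlMr.
Qed.

(** A minimum of finitely many radii. As they are at most half the gaps, arm 1 also wins in every
    estimate, which makes it i^* when [bhat] is computed. *)
Lemma bstar_stable : exists2 eps : R, 0 < eps <= 1 &
  forall p, close_to eps p -> forall i, i != w -> 1 / 2 < p w i /\
    forall j, j != bstar i ->
    (ediv (p w i - 1 / 2 + (p w (bstar i) - 1 / 2)) (klp (p i (bstar i)) (1 / 2)) <
     ediv (p w i - 1 / 2 + (p w j - 1 / 2)) (klp (p i j) (1 / 2)))%E.
Proof.
have /choice[e he] : forall ij : 'I_K * 'I_K, exists e : R, 0 < e /\
    (ij.1 != w -> 1 / 2 + e < mu w ij.1 /\
     (ij.2 != bstar ij.1 -> forall p, close_to e p ->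
    (ediv (p w ij.1 - 1 / 2 + (p w (bstar ij.1) - 1 / 2)) (klp (p ij.1 (bstar ij.1)) (1 / 2)) <
     ediv (p w ij.1 - 1 / 2 + (p w ij.2 - 1 / 2)) (klp (p ij.1 ij.2) (1 / 2)))%E)).
  move=> [i j] /=; have [iw|iw] := eqVneq i w; first by exists 1.
  have g0 := gap_gt0 iw.
  have [jb|jb] := eqVneq j (bstar i).
    exists (gap mu w i / 2); split; first by rewrite divr_gt0.
    by move=> _; split=> //; move: g0; rewrite /gap; lra.
  have [e e0 He] := ediv_stable iw jb.
  exists (Num.min e (gap mu w i / 2)); split; first by rewrite lt_min e0 divr_gt0.
  move=> _; split.
    have : Num.min e (gap mu w i / 2) <= gap mu w i / 2 by rewrite ge_min lexx orbT.
    by move: g0; rewrite /gap; lra.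
  move=> _ p [p01 pc]; apply: He; split=> // k l; apply: le_trans (pc k l) _.
  by rewrite ge_min lexx.
pose eps := Num.min 1 (\big[Num.min/1]_(ij : 'I_K * 'I_K) e ij).
have eps0 : 0 < eps.
  rewrite lt_min ltr01; apply: (big_ind (fun x => 0 < x)) => // [x y x0 y0|ij _]; first by rewrite lt_min x0.
  by case: (he ij).
have epsle ij : eps <= e ij by rewrite /eps (bigD1 ij) //= !ge_min lexx orbT.
have eps1 : eps <= 1 by rewrite ge_min lexx.
exists eps => [|p [p01 pc]]; first by rewrite eps0.
move=> i iw; split.
  have [_ /(_ iw)[h _]] := he (i, i); move: h => /= h.
  have := pc w i; have := epsle (i, i); rewrite ler_norml => h2 /andP[h1 _]; lra.
move=> j jb; have [_ /(_ iw)[_ /(_ jb) H]] := he (i, j).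
by apply: H; split=> // k l; apply: le_trans (pc k l) (epsle _).
Qed.

End Stability.

(** * Counting rounds along a path *)

Section Counting.
Variable R : realType.
Implicit Types (f : nat -> R) (Q : pred nat).

Lemma sum_inj_le (I : seq nat) f (g : nat -> nat) Q : uniq I -> (forall n, 0 <= f n) ->
  (forall m n, Q m -> Q n -> g m = g n -> m = n) -> {in I, forall n, Q n -> g n \in I} ->
  \sum_(n <- I | Q n) f (g n) <= \sum_(n <- I) f n.
Proof.
move=> uI f0 inj gI; rewrite -big_filter -(big_map g xpredT f).
set J := map g _.
have uJ : uniq J.
  rewrite map_inj_in_uniq ?filter_uniq // => x y.
  by rewrite !mem_filter => /andP[xQ _] /andP[yQ _]; exact: inj.
have pJ : perm_eq J [seq n <- I | n \in J].
  apply: uniq_perm => //; first exact: filter_uniq.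
  move=> n; rewrite mem_filter andb_idr // => /mapP[m]; rewrite mem_filter.
  by move=> /andP[mQ mI] ->; exact: gI.
rewrite (perm_big _ pJ) /= big_filter big_mkcond /=; apply: ler_sum => n _.
by case: ifP.
Qed.

Lemma sum_pred_le (a b c e : nat) Q : (forall n, (a <= n < b)%N -> Q n -> (c <= n < e)%N) ->
  \sum_(a <= n < b) (Q n)%:R <= (e - c)%:R :> R.
Proof.
move=> HQ; rewrite -natr_sum ler_nat.
rewrite (_ : (\sum_(a <= n < b) Q n = size [seq n <- index_iota a b | Q n])%N); last first.
  by rewrite size_filter -sum1_count [RHS]big_mkcond; apply: eq_bigr => n _; case: (Q n).
rewrite -(size_iota c (e - c)); apply: uniq_leq_size; first by rewrite filter_uniq ?iota_uniq.
move=> n; rewrite mem_filter mem_index_iota => /andP[Qn nab].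
by rewrite -[iota _ _]/(index_iota c e) mem_index_iota; exact: HQ.
Qed.

Lemma sum_lt_le (b : nat) (M : R) : 0 <= M ->
  \sum_(1 <= n < b) (n%:R < M)%R%:R <= M.
Proof.
move=> M0; have /andP[h1 h2] := truncn_itv M0.
apply: le_trans h1; apply: le_trans (@sum_pred_le 1 b 1 (Num.truncn M).+1 (fun n => n%:R < M) _) _.
  move=> n /andP[-> _] nM /=; rewrite -(ltr_nat R); exact: lt_trans nM h2.
by rewrite subSS subn0.
Qed.

Lemma sum_le_le (b : nat) (q : R) : 0 <= q ->
  \sum_(n < b) (n%:R <= q)%R%:R <= q + 1.
Proof.
move=> M0; have /andP[h1 h2] := truncn_itv M0.
rewrite -(big_mkord xpredT (fun n => (n%:R <= q)%R%:R)).
apply: le_trans (@sum_pred_le 0 b 0 (Num.truncn q).+1 (fun n => n%:R <= q) _) _.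
  move=> n _ nM /=; rewrite -(ltr_nat R); exact: le_lt_trans nM h2.
by rewrite subn0 -natr1 lerD2r.
Qed.

(** At a fixed lag each round is charged at most once, so charging to an event up to [2 * K] rounds
    away costs a factor of that order. *)
Lemma sum_shift_up_le (a b k : nat) f : (forall n, 0 <= f n) ->
  \sum_(a <= n < b | (n + k < b)%N) f (n + k)%N <= \sum_(a <= n < b) f n.
Proof.
move=> f0; apply: (@sum_inj_le _ f (fun n => n + k)%N) => //; first exact: iota_uniq.
  by move=> x y _ _ /addIn.
by move=> n; rewrite !mem_index_iota; lia.
Qed.

Lemma sum_shift_down_le (a b k : nat) f : (forall n, 0 <= f n) ->
  \sum_(a <= n < b | (a + k <= n)%N) f (n - k)%N <= \sum_(a <= n < b) f n.
Proof.
move=> f0; apply: (@sum_inj_le _ f (fun n => n - k)%N) => //; first exact: iota_uniq.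
  by move=> x y; lia.
by move=> n; rewrite !mem_index_iota; lia.
Qed.

End Counting.

(** * Deterministic bounds on a single run *)

Section Pathwise.
Variables (R : realType) (K : nat) (mu : 'M[R]_K) (w : 'I_K).
Hypothesis hmu : preference_matrix mu.
Hypothesis hwin : condorcet_winner mu w.
Variables (alpha fK : R) (T : nat).
Variables (order : seq 'I_K) (h : path K).
Variables (istar : nat -> 'I_K) (bhat : 'I_K -> 'I_K).
Hypothesis Hf : RMED2FH_follows alpha fK T order h istar bhat.
Hypothesis Ho : perm_eq order (enum 'I_K).
Hypothesis fK0 : 0 <= fK.
Hypothesis hn : (0 < ninit alpha T)%N.

Let T0 := Tinit K alpha T.
Let res i j := obs i j (trace h T).
Let N := ncmp h.
Let muh := muhat R h.
Let L := log R T.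

Definition unopposed t := opponents R h t w == finset.set0.

Lemma unopposed_muhat t j : unopposed t -> j != w -> 1 / 2 < muh t w j.
Proof.
move=> /eqP Ut jw; rewrite ltNge; apply/negP => hj.
have : j \in opponents R h t w by rewrite inE jw.
by rewrite Ut inE.
Qed.

Lemma unopposed_muhatC t i : unopposed t -> i != w -> muh t i w < 1 / 2.
Proof. by move=> Ut iw; rewrite /muh muhatC; have := unopposed_muhat Ut iw; rewrite /muh; lra. Qed.

Lemma divI_ge0 t i : 0 <= divI R h t i.
Proof. by apply: sumr_ge0 => j _; rewrite mulr_ge0 ?kl_ge0 ?muhat01. Qed.

Lemma divI_ge t i j : i != j ->
  (N i j t)%:R * klp (muh t i j) (1 / 2) <= divI R h t i.
Proof.
move=> ij; rewrite /klp; case: ifP => hm; last by rewrite mulr0 divI_ge0.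
have jo : j \in opponents R h t i by rewrite inE eq_sym ij ltW.
rewrite /divI (bigD1 j) //= lerDl; apply: sumr_ge0 => k _.
by rewrite mulr_ge0 ?kl_ge0 ?muhat01.
Qed.

Lemma unopposed_divI t : unopposed t -> divI R h t w = 0.
Proof. by move=> /eqP Ut; rewrite /divI Ut finset.big_set0. Qed.

(** I_1 is 0, so the minimum is 0. Any other arm has an estimate below 1/2 against arm 1, hence at
    least one comparison with it, since the default is 1/2, and its I is positive. *)
Lemma unopposed_istar t : unopposed t -> istar t = w.
Proof.
move=> Ut; case: Hf => H _ _ _; have [_] := H t w (finset.in_setT w).
rewrite unopposed_divI // => le0; apply/eqP/negPn/negP => iw.
have hm := unopposed_muhatC Ut iw.
have N0 : (0 < N (istar t) w t)%N.
  rewrite lt0n; apply/eqP => n0; move: hm; rewrite /muh /muhat -/N n0 eqxx orbT; lra.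
have := divI_ge t iw; rewrite /klp hm.
have k0 : 0 < kl (muh t (istar t) w) (1 / 2).
  by apply: kl_gt0; rewrite hm andbT; case/andP: (muhat01 R h (istar t) w t).
have : 0 < (N (istar t) w t)%:R * kl (muh t (istar t) w) (1 / 2) :> R.
  by rewrite mulr_gt0 // ltr0n.
by move=> h1 h2; have := lt_le_trans h1 (le_trans h2 le0); rewrite ltxx.
Qed.

Lemma muhat_notdrawn i j t : i != j -> (0 < t)%N -> ~~ drawn h i j t -> muh t.+1 i j = muh t i j.
Proof.
move=> ij; case: t => // t _; rewrite /drawn negb_or => /andP[h1 h2].
by rewrite /muh !muhat_phat //= (negbTE h1) (negbTE h2).
Qed.

(** An estimate moves only when its pair is drawn, and the draw that carries it past 1/2 is made
    while it is still at most 1/2. *)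
Lemma muhat_crossing i j s t : i != j -> (0 < s <= t)%N ->
  muh s i j <= 1 / 2 -> 1 / 2 < muh t i j ->
  exists2 t1, (s <= t1 < t)%N & drawn h i j t1 && (muh t1 i j <= 1 / 2).
Proof.
move=> ij /andP[s0 st] hs ht.
elim: t st ht => [|t IH] st ht; first by rewrite leqn0 in st; rewrite (eqP st) in s0.
have [e|sn] := eqVneq s t.+1; first by move: hs; rewrite e leNgt ht.
have st' : (s <= t)%N by rewrite leq_eqVlt (negbTE sn) in st.
have [ht'|ht'] := leP (muh t i j) (1 / 2); last first.
  have [t1 /andP[h1 h2] h3] := IH st' ht'; exists t1 => //.
  by rewrite h1 ltnS ltnW.
exists t; first by rewrite st' ltnSn.
rewrite ht' andbT; apply/negPn/negP => nd.
by move: ht; rewrite (muhat_notdrawn ij _ nd) ?ltNge ?ht' //; exact: leq_trans st'.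
Qed.

Let Z j := psum (@zeta R) (res w j).
Definition zeta_prod := \prod_(j < K | j != w) psum (@zeta R) (obs w j (trace h T)).

Lemma zeta_nil : zeta R [::] = 1.
Proof. by rewrite /zeta /= mul0r expR0 mulr1 lexx. Qed.

(** The empty prefix contributes 1. Arms that are not opponents, absent from I_1, can therefore be
    given their factor in [zeta_prod]. *)
Lemma psum_zeta_ge1 j : 1 <= Z j.
Proof.
apply: (@le_trans _ _ (zeta R (take 0 (res w j)))); first by rewrite take0 zeta_nil.
by apply: psum_ge => // s; exact: zeta_ge0.
Qed.

Lemma zeta_prod_ge1 : 1 <= zeta_prod.
Proof. by apply: (big_ind (fun x => 1 <= x)) => // [x y x1 y1|j _]; [rewrite mulr_ege1|exact: psum_zeta_ge1]. Qed.

Lemma psum_zeta_le_prod j : j != w -> Z j <= zeta_prod.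
Proof.
move=> jw; rewrite /zeta_prod (bigD1 j) //= ler_peMr //.
  exact: le_trans ler01 (psum_zeta_ge1 j).
by apply: (big_ind (fun x => 1 <= x)) => // [x y x1 y1|k _]; [rewrite mulr_ege1|exact: psum_zeta_ge1].
Qed.

(** The factor of an opponent is one term of its prefix sum, the term of the current sample size;
    the bound is thus the same for all rounds. *)
Lemma expR_divI_le t : (0 < t <= T.+1)%N -> expR (divI R h t w) <= zeta_prod.
Proof.
case: t => // t /andP[_ tT]; rewrite /divI expR_sum /zeta_prod.
rewrite big_mkcond [leRHS]big_mkcond /=; apply: ler_prod => j _.
rewrite inE; case: eqVneq => [_|jw] /=; first by rewrite ler01 lexx.
case: ifP => hm; last by rewrite ler01 psum_zeta_ge1.
rewrite expR_ge0 /=; have wj : w != j by rewrite eq_sym.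
have sz : (N w j t.+1 <= size (res w j))%N.
  by rewrite size_obs_trace // leq_ncmp.
apply: le_trans (psum_ge (@zeta_ge0 R) sz).
rewrite /zeta -/N (muhat_take R h wj (tT : (t <= T)%N)) size_take_min (minn_idPl sz).
by rewrite -(muhat_take R h wj (tT : (t <= T)%N)) hm [leRHS]mul1r.
Qed.

Definition nbad : R := \sum_(T0.+1 <= t < T.+1) (~~ unopposed t)%:R.

Let y j t := (j != w) && drawn h w j t && (muh t w j <= 1 / 2).

(** These draws happen at distinct sample sizes, and at each of them [zeta] is at least 1 because
    its exponent is nonnegative. *)
Lemma sum_y_le j : \sum_(1 <= t < T.+1) (y j t)%:R <= (j != w)%:R * Z j.
Proof.
have [->|jw] := eqVneq j w.
  by rewrite mul0r big1 // => t _; rewrite /y eqxx.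
rewrite mul1r; have wj : w != j by rewrite eq_sym.
apply: le_trans (@count_drawn_le R _ h w j T (y j) (fun k => zeta R (take k (res w j))) _ _) _.
- by move=> k; exact: zeta_ge0.
- case=> // t /andP[_ tT] /andP[/andP[_ dt] hm]; split => //.
  rewrite /zeta -(muhat_take R h wj (ltnW tT)) -/muh hm [leRHS]mul1r -[leLHS]expR0 ler_expR.
  by rewrite mulr_ge0 // kl_ge0 // muhat01.
- rewrite /Z /psum size_obs_trace // big_ord_recr /= lerDl; exact: zeta_ge0.
Qed.

(** Every branch of the rule ends on an opponent; in the last one, the arm of least estimate does at
    least as badly as any opponent. *)
Lemma right_arm_opp t : (T0 < t <= T)%N -> left_arm h t = w -> ~~ unopposed t ->
  right_arm h t \in opponents R h t w.
Proof.
move=> tT lw nU; case: Hf => _ _ _ /(_ t tT)[_]; rewrite /right_arm_rule lw.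
case: ifP => [/andP[hb _] -> //|_]; rewrite -/(unopposed t) (negbTE nU) orbF.
case: ifP => [hi -> //|_] harg.
have [j jo] : exists j, j \in opponents R h t w by apply/finset.set0Pn.
have [|mw mj] := harg j; first by move: jo; rewrite !inE => /andP[].
by move: jo mw; rewrite !inE => /andP[_ hj] ->; rewrite (le_trans mj).
Qed.

Lemma right_arm_good t : (T0 < t <= T)%N -> left_arm h t = w -> unopposed t -> right_arm h t = w.
Proof.
move=> tT lw Ut; case: Hf => _ _ _ /(_ t tT)[_]; rewrite /right_arm_rule lw.
have /eqP-> := Ut; rewrite inE eqxx orbT /= => ->; exact: unopposed_istar.
Qed.

Lemma bad_cases s : (T0 < s)%N -> (s + 2 * K <= T)%N -> ~~ unopposed s -> zeta_prod <= s%:R ->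
  exists k j, (k < 2 * K)%N && y j (s + k).
Proof.
move=> s0 sT nU hM.
have J : evJ fK h istar s w.
  rewrite /evJ; have s1 : 0 < s%:R :> R by rewrite ltr0n; lia.
  have : divI R h s w <= log R s.
    rewrite -(expRK (divI R h s w)) /log ler_ln ?posrE ?expR_gt0 //.
    by apply: le_trans hM; apply: expR_divI_le; lia.
  have := divI_ge0 s (istar s); move: (divI R h s w) (divI R h s _) (log R s) => a b c.
  by move: fK0; lra.
have [t' t'in lw] := J_drawn Hf Ho s0 sT J.
have [j jo] : exists j, j \in opponents R h s w by apply/finset.set0Pn.
(* If the opponents have vanished by [t'], the estimate of [j] crossed 1/2 in between, which takes a
   draw of its pair; otherwise the rule itself picks an opponent at [t']. *)
have [Ut|nUt] := boolP (unopposed t').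
  move: jo; rewrite inE => /andP[jw hj]; have wj : w != j by rewrite eq_sym.
  have [|t1 t1in ht1] := muhat_crossing wj _ hj (unopposed_muhat Ut jw).
    by case/andP: t'in => -> _; rewrite andbT; exact: leq_trans s0.
  case/andP: t1in => s1 s2; case/andP: t'in => _ s4.
  exists (t1 - s)%N, j; rewrite /y subnKC //.
  by rewrite jw ht1 andbT ltn_subLR // (ltn_trans s2 s4).
have tin : (T0 < t' <= T)%N by lia.
have := right_arm_opp tin lw nUt; rewrite inE => /andP[mw hm].
case/andP: t'in => s3 s4; exists (t' - s)%N, (right_arm h t'); rewrite /y subnKC //.
by rewrite mw /drawn lw !eqxx hm /= !andbT ltn_subLR.
Qed.

(* If J_1(s) fails then s < exp(I_1(s)) <= zeta_prod.  Otherwise arm 1 is drawn within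
   two loops, and by then some pair {1, j} has been compared with muhat_{1,j} <= 1/2. *)
Lemma nbad_le : nbad <= (1 + 2 * K%:R * K%:R + 2 * K%:R) * zeta_prod.
Proof.
pose yk k t := \sum_(j < K) (y j (t + k))%:R : R.
have y0 k t : 0 <= yk k t by exact: sumr_ge0.
have step : nbad <= \sum_(T0.+1 <= s < T.+1) (s%:R < zeta_prod)%R%:R +
   \sum_(T0.+1 <= s < T.+1) (T < s + 2 * K)%N%:R +
   \sum_(k < (2 * K)%N) \sum_(T0.+1 <= s < T.+1 | (s + k < T.+1)%N) yk k s.
  rewrite (exchange_big_dep xpredT) //= -!big_split /=.
  apply: ler_sum_nat => s /andP[s0 sT].
  have Y0 : 0 <= \sum_(k < (2 * K)%N | (s + k < T.+1)%N) yk k s by exact: sumr_ge0.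
  case: (boolP (unopposed s)) => /= [_|nU]; first by rewrite !addr_ge0.
  case: ltP => [_|hM]; first by rewrite -addrA lerDl addr_ge0.
  case: ltnP => [_|sK]; first by rewrite add0r lerDl.
  rewrite !add0r; have [k [j /andP[kK hy]]] := bad_cases s0 sK nU hM.
  rewrite (bigD1 (Ordinal kK)) /=; last by lia.
  apply: ler_wpDr; first exact: sumr_ge0.
  rewrite /yk (bigD1 j) //= hy lerDl; exact: sumr_ge0.
have b1 : \sum_(T0.+1 <= s < T.+1) (s%:R < zeta_prod)%R%:R <= zeta_prod.
  have M0 : 0 <= zeta_prod by apply: le_trans zeta_prod_ge1.
  apply: le_trans (sum_lt_le T.+1 M0).
  case: (leqP T0.+1 T.+1) => TT; last by rewrite big_geq ?sumr_ge0 // ltnW.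
  by rewrite [leRHS](big_cat_nat _ TT) //= lerDr sumr_ge0.
have b2 : \sum_(T0.+1 <= s < T.+1) (T < s + 2 * K)%N%:R <= (2 * K)%:R :> R.
  apply: le_trans (@sum_pred_le R _ _ (T.+1 - 2 * K)%N T.+1 (fun s => T < s + 2 * K)%N _) _.
    by move=> n; lia.
  by rewrite ler_nat; lia.
have b3 k : \sum_(T0.+1 <= s < T.+1 | (s + k < T.+1)%N) yk k s <= K%:R * zeta_prod.
  rewrite /yk exchange_big /=.
  rewrite [leRHS](_ : _ = \sum_(j < K) zeta_prod); last by rewrite sumr_const card_ord mulr_natl.
  apply: ler_sum => j _.
  apply: (@le_trans _ _ (\sum_(1 <= t < T.+1) (y j t)%:R)).
    apply: (le_trans (@sum_shift_up_le R T0.+1 T.+1 k (fun t => (y j t)%:R) _)) => //.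
    case: (leqP T0.+1 T.+1) => TT; last by rewrite big_geq ?sumr_ge0 // ltnW.
    by rewrite [leRHS](big_cat_nat _ TT) //= lerDr sumr_ge0.
  apply: le_trans (sum_y_le j) _; case: eqVneq => [_|jw].
    by rewrite mul0r; apply: le_trans zeta_prod_ge1.
  by rewrite mul1r psum_zeta_le_prod.
have b4 : \sum_(k < (2 * K)%N) \sum_(T0.+1 <= s < T.+1 | (s + k < T.+1)%N) yk k s <=
   (2 * K)%:R * (K%:R * zeta_prod).
  rewrite [leRHS](_ : _ = \sum_(k < (2 * K)%N) (K%:R * zeta_prod)); last first.
    by rewrite sumr_const card_ord mulr_natl.
  by apply: ler_sum => k _; exact: b3.
apply: (le_trans step); apply: (le_trans (lerD (lerD b1 b2) b4)).
rewrite natrM.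
have : 2 * K%:R <= 2 * K%:R * zeta_prod by rewrite ler_peMr ?zeta_prod_ge1 // mulr_ge0.
by move: zeta_prod (K%:R : R) => a b; lra.
Qed.


(** An arm drawn at [t] owes its turn to a J that held up to [2 * K] rounds earlier; the window
    guarantees that I^* was 0 there. The first clause keeps the window after the initial phase. *)
Definition good t := (T0 + 2 * K < t)%N && [forall k : 'I_(2 * K).+1, unopposed (t - k)].
Definition nbad_window : R := \sum_(T0.+1 <= t < T.+1) (~~ good t)%:R.

Lemma good_window t k : good t -> (k <= 2 * K)%N -> unopposed (t - k).
Proof. by move=> /andP[_ /forallP H] kK; have := H (Ordinal (kK : (k < (2 * K).+1)%N)). Qed.

(** A round that is not good is among the first [2 * K] after the initial phase or has an opposed
    round in its window; each opposed round lies in at most [2 * K + 1] windows. *)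
Lemma nbad_window_le : nbad_window <= 2 * K%:R + (2 * K%:R + 1) * nbad.
Proof.
have step : nbad_window <= \sum_(T0.+1 <= t < T.+1) (t <= T0 + 2 * K)%N%:R +
    \sum_(k < (2 * K).+1) \sum_(T0.+1 <= t < T.+1 | (T0.+1 + k <= t)%N) (~~ unopposed (t - k))%:R.
  rewrite (exchange_big_dep xpredT) //= -!big_split /=.
  apply: ler_sum_nat => t _; rewrite /good.
  case: leqP => h0 /=; first by rewrite lerDl; apply: sumr_ge0.
  rewrite add0r; case: forallP => //= h1; first by apply: sumr_ge0.
  have [k hk] : exists k : 'I_(2 * K).+1, ~~ unopposed (t - k).
    by apply/existsP; rewrite -negb_forall; apply/forallP.
  rewrite (bigD1 k) /=; last by have := ltn_ord k; lia.
  rewrite hk lerDl; exact: sumr_ge0.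
apply: le_trans step _; apply: lerD.
  apply: le_trans (@sum_pred_le R _ _ T0.+1 (T0 + 2 * K).+1 (fun t => t <= T0 + 2 * K)%N _) _.
    by move=> n; lia.
  by rewrite -natrM ler_nat; lia.
rewrite [leRHS](_ : _ = \sum_(k < (2 * K).+1) nbad); last first.
  by rewrite sumr_const card_ord -[RHS]mulr_natl -(natr1 (2 * K)) natrM.
apply: ler_sum => k _.
by apply: (@sum_shift_down_le R T0.+1 T.+1 k (fun t => (~~ unopposed t)%:R)).
Qed.

Lemma good_range t : good t -> (t <= T)%N -> (T0 < t <= T)%N && (T0 + K < t)%N.
Proof. by by move=> /andP[ht _] tT; lia. Qed.

Lemma good_istar t : good t -> istar t = w.
Proof. by move=> gt; apply: unopposed_istar; rewrite -[t]subn0; exact: good_window. Qed.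

Lemma good_unopposed t : good t -> unopposed t.
Proof. by move=> gt; rewrite -[t]subn0; exact: good_window. Qed.

(* Arm i is in play at a good round because J_i held shortly before, when I^* was 0. *)
Lemma good_recent t j : good t -> (t <= T)%N -> left_arm h t != j ->
  exists2 t', (T0 < t' < t)%N && (t <= t' + 2 * K)%N &
    (N (left_arm h t) j t')%:R * klp (muh t' (left_arm h t) j) (1 / 2) <= L + fK.
Proof.
move=> gt tT ij; have /andP[r1 r2] := good_range gt tT.
have [|t' t'in Jt'] := @drawn_J R K alpha fK T order h istar bhat Hf Ho t.
  by lia.
exists t' => //; apply: le_trans (divI_ge t' ij) _.
have Ut' : unopposed t'.
  have -> : t' = (t - (t - t'))%N by lia.
  by apply: good_window => //; lia.
move: Jt'; rewrite /evJ (unopposed_istar Ut') (unopposed_divI Ut') subr0 => /le_trans; apply.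
rewrite lerD2r /L /log ler_ln ?posrE ?ltr0n ?ler_nat; lia.
Qed.

Definition quota (delta : R) i j := (1 + delta) * (L + fK) / kl (mu i j) (1 / 2).
Definition ndev (delta : R) i j : R := psum (fun s => (dev delta (mu i j) s)%:R) (obs i j (trace h T)).
Definition ngood i j : R :=
  \sum_(1 <= t < T.+1) (good t && (left_arm h t == i) && (right_arm h t == j))%:R.

Lemma log_ge0 : 0 <= L.
Proof.
rewrite /L /log; case: T => [|n]; first by rewrite ln0.
by apply: ln_ge0; rewrite ler1n.
Qed.

Lemma quota_ge0 delta i j : 0 <= delta -> 0 <= quota delta i j.
Proof.
move=> d0; apply: divr_ge0; last by apply: kl_ge0; case: hmu.
by rewrite mulr_ge0 // addr_ge0 // log_ge0.
Qed.

Lemma quota_le delta i j n t : 0 < delta -> 0 < kl (mu i j) (1 / 2) -> i != j ->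
  (t <= T)%N -> n = N i j t.+1 ->
  (N i j t.+1)%:R * klp (muh t.+1 i j) (1 / 2) <= L + fK ->
  ~~ dev delta (mu i j) (take n (res i j)) -> n%:R <= quota delta i j.
Proof.
move=> d0 k0 ij tT ->; rewrite /muh (muhat_take R h ij tT) /dev -leNgt => h1 h2.
rewrite /quota ler_pdivlMr //; apply: (le_trans (ler_wpM2l (ler0n _ _) h2)).
by rewrite mulrCA ler_wpM2l //; lra.
Qed.

(** [n] is the sample size when J_i held. At most [2 * K] comparisons separate it from the current
    count, and it is at least the initial sample size, so only late deviations matter. *)
Lemma good_quota delta t j : 0 < delta -> good t -> (t <= T)%N ->
  let i := left_arm h t in i != j -> 0 < kl (mu i j) (1 / 2) ->
  exists2 n, (n <= N i j t)%N && (N i j t <= n + 2 * K)%N &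
    (ninit alpha T <= n <= size (res i j))%N /\
    (dev delta (mu i j) (take n (res i j)) \/ n%:R <= quota delta i j).
Proof.
move=> d0 gt tT i ij k0; have [[|t'] /andP[t'in tK] hq] := good_recent gt tT ij; first by [].
exists (N i j t'.+1).
  apply/andP; split; first by apply: leq_ncmp; lia.
  apply: leq_trans (ncmp_add h i j t'.+1 (2 * K)); exact: leq_ncmp.
split.
  rewrite size_obs_trace // leq_ncmp; last by lia.
  case: Hf => _ /(_ i j ij) <- _ _; rewrite andbT; apply: leq_ncmp; rewrite -/T0; lia.
case: (boolP (dev _ _ _)) => hd; [by left|right].
by apply: (quota_le d0 k0 ij _ erefl hq hd); lia.
Qed.

(** A draw has either a count of at most [q + 2 * K] or a deviating sample size at most [2 * K]
    below its count; each such size is charged at most [2 * K + 1] times. *)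
Lemma ngood_le delta i j : 0 < delta -> i != j -> 0 < kl (mu i j) (1 / 2) ->
  ngood i j <= quota delta i j + (2 * K%:R + 1) * (1 + ndev delta i j).
Proof.
move=> d0 ij k0; set q := quota delta i j.
have q0 : 0 <= q by apply: quota_ge0; exact: ltW.
pose dv n : R := (dev delta (mu i j) (take n (res i j)))%:R.
pose f n : R := (n%:R <= q + 2 * K%:R)%R%:R +
   \sum_(k < (2 * K).+1) (if (k <= n)%N then dv (n - k)%N else 0).
have dv0 n : 0 <= dv n by [].
have S0 n : 0 <= \sum_(k < (2 * K).+1) (if (k <= n)%N then dv (n - k)%N else 0).
  by apply: sumr_ge0 => k _; case: ifP.
apply: le_trans (@count_drawn_le R _ h i j T
    (fun t => good t && (left_arm h t == i) && (right_arm h t == j)) f _ _) _.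
- by move=> n; rewrite addr_ge0.
- move=> t /andP[_ tT] /andP[/andP[gt /eqP li] /eqP mj].
  split; first by rewrite /drawn li mj !eqxx.
  have := @good_quota delta t j d0 gt tT; rewrite /= li => /(_ ij k0).
  move=> [n /andP[n1 n2] [_ [hd|hq]]].
    have nk : (N i j t - n < (2 * K).+1)%N by lia.
    rewrite /f; apply: ler_wpDl => //.
    rewrite (bigD1 (Ordinal nk)) //= leq_subr subKn // /dv hd lerDl.
    by apply: sumr_ge0 => k _; case: ifP.
  rewrite /f; apply: ler_wpDr => //.
  suff -> : (ncmp h i j t)%:R <= q + 2 * K%:R :> R by [].
  have : (N i j t)%:R <= n%:R + 2 * K%:R :> R by rewrite -natrM -natrD ler_nat.
  by move=> /le_trans; apply; rewrite lerD2r.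
- rewrite /f big_split /= exchange_big /=.
  have a1 := @sum_le_le R (ncmp h i j T.+1) (q + 2 * K%:R) (addr_ge0 q0 (mulr_ge0 (ler0n _ 2) (ler0n _ K))).
  have a2 (k : 'I_(2 * K).+1) :
      \sum_(n < ncmp h i j T.+1) (if (k <= n)%N then dv (n - k)%N else 0) <= ndev delta i j.
    rewrite -big_mkcond -(big_mkord (fun n => (k <= n)%N) (fun n => dv (n - k)%N)) /=.
    apply: (le_trans (@sum_shift_down_le R 0 (ncmp h i j T.+1) k dv dv0)).
    rewrite big_mkord /ndev /psum size_obs_trace // big_ord_recr /= lerDl //.
  have a3 : \sum_(k < (2 * K).+1) \sum_(n < ncmp h i j T.+1) (if (k <= n)%N then dv (n - k)%N else 0)
      <= (2 * K%:R + 1) * ndev delta i j.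
    rewrite [leRHS](_ : _ = \sum_(k < (2 * K).+1) ndev delta i j); first exact: ler_sum.
    by rewrite sumr_const card_ord -[RHS]mulr_natl -(natr1 (2 * K)) natrM.
  by apply: le_trans (lerD a1 a3) _; move: (ndev _ _ _) (K%:R : R) => a b; lra.
Qed.

Let lam : R := loglog R T.
Hypothesis lam0 : 0 < lam.
Hypothesis T0T : (T0 <= T)%N.

Lemma bhat_neq i : i != w -> bhat i != i.
Proof.
move=> iw; case: Hf => _ _ /(_ i) H _.
by have [|] := H w; rewrite !inE // eq_sym.
Qed.

Lemma good_right t : good t -> (t <= T)%N -> left_arm h t != w ->
  right_arm h t = w \/
  right_arm h t = bhat (left_arm h t) /\
  (N (left_arm h t) (bhat (left_arm h t)) t)%:R / lam <= (N (left_arm h t) w t)%:R.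
Proof.
move=> gt tT iw; have /andP[r1 _] := good_range gt tT.
case: Hf => _ _ _ /(_ t r1)[_]; rewrite /right_arm_rule (good_istar gt).
case: ifP => [/andP[_ h1] ->|_]; first by right.
have -> : w \in opponents R h t (left_arm h t).
  by rewrite inE eq_sym iw /= ltW // unopposed_muhatC // good_unopposed.
by move=> ->; left.
Qed.

Lemma good_right_arm1 t : good t -> (t <= T)%N -> left_arm h t = w -> right_arm h t = w.
Proof.
move=> gt tT lw; have /andP[r1 _] := good_range gt tT.
exact: right_arm_good (good_unopposed gt).
Qed.

Definition any_dev i j : bool :=
  [exists n : 'I_(size (obs i j (trace h T))).+1,
     (ninit alpha T <= n)%N && dev 1 (mu i j) (take n (obs i j (trace h T)))].

(** Without deviation [klp] of the estimate stays positive and [b] remains an opponent. Drawing arm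
    1 then means that the ratio test failed: N_{i,1} is below N_{i,b} / loglog T, and N_{i,b} is
    capped by its quota at [delta = 1], up to [2 * K]. *)
Lemma ngood_arm1_le i b : i != w -> bhat i = b -> b != w -> mu i b < 1 / 2 ->
  ~~ any_dev i b -> ngood i w <= (quota 1 i b + 2 * K%:R) / lam + 1.
Proof.
move=> iw bE bw mub nd; have ib : i != b by rewrite -bE eq_sym bhat_neq.
have k0 : 0 < kl (mu i b) (1 / 2).
  by apply: kl_gt0; rewrite mub andbT; case: hmu => /(_ i b) /andP[].
set x := (quota 1 i b + 2 * K%:R) / lam.
have q0 : 0 <= quota 1 i b by apply: quota_ge0.
have x0 : 0 <= x by rewrite divr_ge0 ?(ltW lam0) // addr_ge0 // mulr_ge0.
apply: le_trans (sum_le_le (ncmp h i w T.+1) x0).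
apply: (@count_drawn_le R _ h i w T
    (fun t => good t && (left_arm h t == i) && (right_arm h t == w))
    (fun n => (n%:R <= x)%R%:R)) => // t /andP[t0 tT] /andP[/andP[gt /eqP li] /eqP mw].
split; first by rewrite /drawn li mw !eqxx.
have := @good_quota 1 t b ltr01 gt tT; rewrite /= li => /(_ ib k0).
have dn n : (ninit alpha T <= n <= size (res i b))%N -> ~~ dev 1 (mu i b) (take n (res i b)).
  move=> /andP[n1 n2]; apply: contra nd => hd; apply/existsP.
  by exists (Ordinal (n2 : (n < (size (res i b)).+1)%N)); rewrite /= n1.
move=> [n /andP[n1 n2] [n3 [|hq]]]; first by move=> hd; move: (dn n n3); rewrite hd.
have /andP[r1 _] := good_range gt tT.
have bo : b \in opponents R h t i.
  rewrite inE eq_sym ib /=; case: t t0 tT gt li mw n1 n2 r1 => // t _ tT gt li mw n1 n2 r1.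
  rewrite (muhat_take R h ib (ltnW tT)); set s := take _ _.
  have : ~~ dev 1 (mu i b) s.
    apply: dn; case/andP: n3 => n3 _; rewrite (leq_trans n3 n1) /=.
    by rewrite size_obs_trace // leq_ncmp // ltnW.
  rewrite /dev /klp; case: ifP => [h1 _|_]; first exact: ltW.
  by rewrite mulr0 k0.
case: Hf => _ _ _ /(_ t r1)[_]; rewrite /right_arm_rule (good_istar gt) li bE bo /=.
case: ifP => [_ mb|]; first by move: bw; rewrite -mb mw eqxx.
move=> /negbT; rewrite -ltNge => hlt _.
suff -> : (ncmp h i w t)%:R <= x by [].
apply: le_trans (ltW hlt) _; rewrite ler_pM2r ?invr_gt0 //.
have : (N i b t)%:R <= n%:R + 2 * K%:R :> R by rewrite -natrM -natrD ler_nat.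
by move=> /le_trans; apply; rewrite lerD2r.
Qed.

(** On good rounds arm 1 on the left is paired with itself, so {i, 1} is compared only with [i] on
    the left; other rounds are counted in full. *)
Lemma ncmp_arm1_le i : i != w ->
  (N i w T.+1)%:R <= (ninit alpha T)%:R + nbad_window + ngood i w.
Proof.
move=> iw; have E n : (T0 <= n)%N ->
    (N i w n.+1)%:R = (ninit alpha T)%:R + \sum_(T0.+1 <= t < n.+1) (drawn h i w t)%:R :> R.
  elim: n => [|n IH] n0.
    by rewrite big_geq ?ltnS // addr0; case: Hf => _ /(_ i w iw) <- _ _;
      rewrite -/T0; move: n0; rewrite leqn0 => /eqP ->.
  have [e|ne] := eqVneq T0 n.+1.
    by rewrite e big_geq // addr0; case: Hf => _ /(_ i w iw) <- _ _; rewrite -/T0 e.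
  have n0' : (T0 <= n)%N by rewrite leq_eqVlt (negbTE ne) in n0.
  by rewrite [X in _ + X]big_nat_recr //= addrA -IH // /N ncmpS natrD.
rewrite (E T T0T) -addrA lerD2l /nbad_window /ngood.
have -> : \sum_(1 <= t < T.+1) (good t && (left_arm h t == i) && (right_arm h t == w))%:R =
    \sum_(T0.+1 <= t < T.+1) (good t && (left_arm h t == i) && (right_arm h t == w))%:R :> R.
  rewrite (@big_cat_nat _ _ _ T0.+1) //= [X in X + _]big_nat [X in X + _]big1 ?add0r //.
  move=> t /andP[_ tT]; rewrite /good (_ : (T0 + 2 * K < t)%N = false) //.
  by apply/negbTE; rewrite -leqNgt; apply: leq_trans (leq_addr _ _); rewrite -ltnS.
rewrite -big_split /=; apply: ler_sum_nat => t /andP[t0 tT].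
case: (boolP (good t)) => /= gt; last first.
  by rewrite addr0 ler_nat leq_b1.
rewrite add0r ler_nat /drawn.
have [lw|lw] := eqVneq (left_arm h t) w.
  rewrite (good_right_arm1 gt tT lw) [w == i]eq_sym (negbTE iw) /= ?andbF orbF.
  by [].
by rewrite andFb orbF.
Qed.

(** The ratio test holds whenever [bhat i], different from arm 1, is drawn on a good round, even if
    it is the wrong arm; this caps the cost of a wrong choice. *)
Lemma ngood_bhat_le i : i != w -> bhat i != w ->
  ngood i (bhat i) <= lam * (N i w T.+1)%:R + 1.
Proof.
move=> iw bw; set x := lam * _.
have x0 : 0 <= x by rewrite mulr_ge0 ?(ltW lam0).
apply: le_trans (sum_le_le (ncmp h i (bhat i) T.+1) x0).
apply: (@count_drawn_le R _ h i (bhat i) T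
    (fun t => good t && (left_arm h t == i) && (right_arm h t == bhat i))
    (fun n => (n%:R <= x)%R%:R)) => // t /andP[t0 tT] /andP[/andP[gt /eqP li] /eqP mw].
split; first by rewrite /drawn li mw !eqxx.
have [||[_]] := good_right gt tT; rewrite ?li //.
  by rewrite mw => e; move: bw; rewrite e eqxx.
rewrite ler_pdivrMr // mulrC => hle.
suff -> : (ncmp h i (bhat i) t)%:R <= x by [].
apply: le_trans hle _; rewrite ler_pM2l // ler_nat; apply: leq_ncmp; exact: leqW.
Qed.

Definition mgap i j : R := (gap mu w i + gap mu w j) / 2.

Lemma mgap_ge0 i j : 0 <= mgap i j.
Proof. by rewrite divr_ge0 // addr_ge0 // gap_ge0. Qed.

Lemma mgap_le1 i j : mgap i j <= 1.
Proof.
rewrite /mgap; have := gap_le w hmu i; have := gap_le w hmu j.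
by move: (gap mu w i) (gap mu w j) => a b; lra.
Qed.

(** On a good round arm 1 meets itself, without regret, or [i] meets arm 1 or [bhat i]. All other
    rounds cost at most 1. The factor [(bhat i != w)%:R] avoids counting {i, 1} twice. *)
Lemma regret_le : regret mu w h T <= T0%:R + nbad_window +
  \sum_(i < K | i != w) (mgap i w * ngood i w +
     (bhat i != w)%:R * (mgap i (bhat i) * ngood i (bhat i))).
Proof.
pose c i j t : R := (good t && (left_arm h t == i) && (right_arm h t == j))%:R.
have -> : \sum_(i < K | i != w) (mgap i w * ngood i w +
     (bhat i != w)%:R * (mgap i (bhat i) * ngood i (bhat i))) =
   \sum_(1 <= t < T.+1) \sum_(i < K | i != w) (mgap i w * c i w t +
     (bhat i != w)%:R * (mgap i (bhat i) * c i (bhat i) t)).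
  rewrite exchange_big /=; apply: eq_bigr => i _.
  by rewrite big_split /= /ngood !mulr_sumr.
have c0 i j t : 0 <= c i j t by [].
have rhs0 i t : 0 <= mgap i w * c i w t + (bhat i != w)%:R * (mgap i (bhat i) * c i (bhat i) t).
  have m0 j : 0 <= mgap i j * c i j t by apply: mulr_ge0 => //; exact: mgap_ge0.
  by apply: addr_ge0 => //; apply: mulr_ge0.
have -> : T0%:R + nbad_window =
    \sum_(1 <= t < T.+1) ((t <= T0)%N%:R + (T0 < t)%N%:R * (~~ good t)%:R) :> R.
  rewrite big_split /=; congr (_ + _).
    rewrite (@big_cat_nat _ _ _ T0.+1) //= [X in _ = _ + X]big_nat [X in _ = _ + X]big1 ?addr0.
      rewrite big_nat (eq_bigr (fun=> 1)) -?big_nat; last by move=> t /andP[_]; rewrite ltnS => ->.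
      by rewrite sumr_const_nat subSS subn0.
    by move=> t /andP[h1 _]; rewrite leqNgt h1.
  rewrite (@big_cat_nat _ _ _ T0.+1) //= [X in _ = X + _]big_nat [X in _ = X + _]big1 ?add0r.
    rewrite /nbad_window !big_nat; apply: eq_bigr => t /andP[h1 _]; by rewrite h1 mul1r.
  by move=> t /andP[_]; rewrite ltnS leqNgt => /negbTE ->; rewrite mul0r.
rewrite -big_split /= /regret; apply: ler_sum_nat => t /andP[t1 tT].
have S0 : 0 <= \sum_(i < K | i != w) (mgap i w * c i w t +
     (bhat i != w)%:R * (mgap i (bhat i) * c i (bhat i) t)) by exact: sumr_ge0.
rewrite -/(mgap (left_arm h t) (right_arm h t)).
have r1 := mgap_le1 (left_arm h t) (right_arm h t).
case: (leqP t T0) => tT0 /=.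
  by rewrite mul0r addr0; apply: (le_trans r1); rewrite lerDl.
case: (boolP (good t)) => gt /=; last first.
  by rewrite mulr1 add0r; apply: (le_trans r1); rewrite lerDl.
rewrite mulr0 !add0r.
have [lw|lw] := eqVneq (left_arm h t) w.
  have gw : gap mu w w = 0 by rewrite /gap; case: hmu => _ _ ->; rewrite subrr.
  suff -> : mgap (left_arm h t) (right_arm h t) = 0 by exact: S0.
  by rewrite lw (good_right_arm1 gt tT lw) /mgap gw addr0 mul0r.
rewrite (bigD1 (left_arm h t)) //=; apply: ler_wpDr; first by apply: sumr_ge0.
have [mw|[mb _]] := good_right gt tT lw.
  rewrite mw /c gt eqxx mw eqxx mulr1 lerDl.
  by rewrite mulr_ge0 // mulr_ge0 ?mgap_ge0.
have [bw|bw] := eqVneq (bhat (left_arm h t)) w.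
  rewrite mb bw /c gt eqxx mb bw eqxx mulr1 mul0r addr0; exact: lexx.
rewrite mb /c gt eqxx mb eqxx mulr1 mul1r lerDr.
by rewrite mulr_ge0 ?mgap_ge0.
Qed.


Variable eps : R.
Hypothesis eps0 : 0 < eps.
Variable bstar : 'I_K -> 'I_K.
Hypothesis hbstar : forall i, i != w -> is_bstar mu w i (bstar i).
Hypothesis stable : forall p, close_to mu eps p -> forall i, i != w -> 1 / 2 < p w i /\
    forall j, j != bstar i ->
    (ediv (p w i - 1 / 2 + (p w (bstar i) - 1 / 2)) (klp (p i (bstar i)) (1 / 2)) <
     ediv (p w i - 1 / 2 + (p w j - 1 / 2)) (klp (p i j) (1 / 2)))%E.

(** The first [ninit] entries of the final sample are those of the initial phase, which draws each
    pair exactly that often. *)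
Definition misled : bool :=
  [exists i : 'I_K, exists j : 'I_K, (i != j) &&
    (eps < `|phat R (take (ninit alpha T) (obs i j (trace h T))) - mu i j|)%R].

Lemma not_misled : ~~ misled -> close_to mu eps (muh T0.+1).
Proof.
move=> /existsPn H; split=> i j; first exact: muhat01.
have [<-|ij] := eqVneq i j.
  by rewrite /muh /muhat eqxx /=; case: hmu => _ _ ->; rewrite subrr normr0 ltW.
have := H i; move/existsPn/(_ j); rewrite ij /= -leNgt.
rewrite /muh (muhat_take R h ij T0T).
by case: Hf => _ /(_ i j ij) -> _ _.
Qed.

(** Close estimates leave arm 1 unopposed, so i^* is arm 1 when [bhat] is computed, and the strict
    inequalities of [stable] exclude all arms but b^*(i). *)
Lemma bhat_bstar : ~~ misled -> forall i, i != w -> bhat i = bstar i.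
Proof.
move=> /not_misled /stable H i iw; have [_ Hi] := H i iw.
have iT : istar T0.+1 = w.
  apply: unopposed_istar; rewrite /unopposed; apply/eqP/setP => j; rewrite !inE.
  by apply/negbTE; apply/negP => /andP[/H[h1 _]]; rewrite leNgt h1.
apply/eqP/negPn/negP => /Hi hlt.
case: Hf => _ _ /(_ i) /(_ (bstar i)) + _.
have bi : bstar i != i.
  apply: contraTneq (bstar_lt hbstar iw) => ->; case: hmu => _ _ ->; rewrite ltxx //.
rewrite inE => /(_ bi)[_]; rewrite /bhat_objective -/T0 iT /gaphat -/muh.
by rewrite leNgt hlt.
Qed.

Lemma ndev_ge0 delta i j : 0 <= ndev delta i j.
Proof. exact: psum_ge0. Qed.

Lemma ngood_ge0 i j : 0 <= ngood i j.
Proof. exact: sumr_ge0. Qed.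

Lemma nbad_window_ge0 : 0 <= nbad_window.
Proof. exact: sumr_ge0. Qed.

Lemma winner_kl_gt0 i : i != w -> 0 < kl (mu i w) (1 / 2).
Proof. by move=> iw; apply: kl_gt0; rewrite mu_ge0 ?mu_winner_lt. Qed.

(** Three cases share one right side. If [misled], comparisons with arm 1 obey their quota at
    [delta = 1] and those with [bhat i] the ratio test. If b^*(i) is arm 1, the main term covers
    all. Otherwise the ratio test, or the quota after a late deviation, bounds the comparisons with
    arm 1. *)
Lemma arm_regret_le delta i : 0 < delta -> i != w ->
  mgap i w * ngood i w + (bhat i != w)%:R * (mgap i (bhat i) * ngood i (bhat i)) <=
  mgap i (bstar i) * (quota delta i (bstar i) + (2 * K%:R + 1) * (1 + ndev delta i (bstar i)))
  + ((quota 1 i (bstar i) + 2 * K%:R) / lam + 1)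
  + (any_dev i (bstar i))%:R * (quota 1 i w + (2 * K%:R + 1))
  + (2 * K%:R + 1) * ndev 1 i w
  + misled%:R * ((1 + lam) * (quota 1 i w + (2 * K%:R + 1)) + 1 + lam * (ninit alpha T)%:R)
  + lam * nbad_window + (1 + lam) * ((2 * K%:R + 1) * ndev 1 i w).
Proof.
move=> d0 iw; set b := bstar i.
have kb : 0 < kl (mu i b) (1 / 2) := kl_bstar_gt0 hmu hbstar iw.
have ib : i != b.
  apply: contraTneq (bstar_lt hbstar iw) => e; rewrite -/b -e.
  by case: hmu => _ _ ->; rewrite ltxx.
have A := @ngood_le 1 i w ltr01 iw (winner_kl_gt0 iw).
have gw : mgap i w * ngood i w <= ngood i w.
  by apply: ler_piMl; [exact: ngood_ge0|exact: mgap_le1].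
have qd0 : 0 <= quota delta i b by apply: quota_ge0; exact: ltW.
have qb0 : 0 <= quota 1 i b by apply: quota_ge0.
have qw0 : 0 <= quota 1 i w by apply: quota_ge0.
have K0 : 0 <= 2 * K%:R + 1 :> R by rewrite addr_ge0 // mulr_ge0.
have Kd : 0 <= (2 * K%:R + 1) * ndev 1 i w :> R by rewrite mulr_ge0 // ndev_ge0.
have B : mgap i b * ngood i b <=
    mgap i b * (quota delta i b + (2 * K%:R + 1) * (1 + ndev delta i b)).
  by rewrite ler_wpM2l ?mgap_ge0 //; exact: ngood_le.
have t1 : 0 <= mgap i b * (quota delta i b + (2 * K%:R + 1) * (1 + ndev delta i b)).
  by rewrite mulr_ge0 ?mgap_ge0 // addr_ge0 // mulr_ge0 // addr_ge0 // ndev_ge0.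
have t2 : 0 <= (quota 1 i b + 2 * K%:R) / lam.
  by rewrite divr_ge0 ?(ltW lam0) // addr_ge0 // mulr_ge0.
have t3 : 0 <= (any_dev i b)%:R * (quota 1 i w + (2 * K%:R + 1)).
  by rewrite mulr_ge0 // addr_ge0.
have nb0 := nbad_window_ge0.
have t5 : 0 <= lam * nbad_window by rewrite mulr_ge0 // ltW.
have t6 : 0 <= lam * ((2 * K%:R + 1) * ndev 1 i w) by rewrite mulr_ge0 // ltW.
have A' : ngood i w <= quota 1 i w + (2 * K%:R + 1) + (2 * K%:R + 1) * ndev 1 i w.
  by apply: (le_trans A); rewrite -addrA lerD2l mulrDr mulr1.
have [ms|/bhat_bstar/(_ i iw) bE] := boolP misled.
  rewrite mul1r.
  have C : (bhat i != w)%:R * (mgap i (bhat i) * ngood i (bhat i)) <=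
      lam * ((ninit alpha T)%:R + nbad_window + ngood i w) + 1.
    have [bw|bw] := eqVneq (bhat i) w.
      rewrite mul0r addr_ge0 // mulr_ge0 ?(ltW lam0) // addr_ge0 ?ngood_ge0 //.
      by rewrite addr_ge0.
    rewrite mul1r; apply: (@le_trans _ _ (ngood i (bhat i))).
      by apply: ler_piMl; [exact: ngood_ge0|exact: mgap_le1].
    apply: (le_trans (ngood_bhat_le iw bw)).
    by rewrite lerD2r ler_wpM2l ?(ltW lam0) // ncmp_arm1_le.
  have D : lam * ngood i w <=
      lam * (quota 1 i w + (2 * K%:R + 1) + (2 * K%:R + 1) * ndev 1 i w).
    by rewrite ler_wpM2l // ltW.
  move: gw C D A' t1 t2 t3 t5 t6 Kd; rewrite !mulrDr !mulrDl !mul1r.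
  move: (mgap i w * _) (_ * (mgap i (bhat i) * _)) (mgap i b * _) (mgap i b * _).
  move=> a1 a2 a3 a4; lra.
rewrite bE mul0r addr0 -/b; have [bw|bw] := eqVneq b w.
  rewrite mul0r addr0 -{1 2}bw; move: B t2 t3 t5 t6 Kd.
  rewrite mulrDl mul1r; move: (mgap i b * _) (mgap i b * _) => a1 a2; lra.
rewrite mul1r.
have E : ngood i w <= ((quota 1 i b + 2 * K%:R) / lam + 1)
  + (any_dev i b)%:R * (quota 1 i w + (2 * K%:R + 1)) + (2 * K%:R + 1) * ndev 1 i w.
  have [ad|nd] := boolP (any_dev i b).
    by rewrite mul1r; move: A' t2; move: (_ / lam) => a; lra.
  rewrite mul0r addr0; apply: ler_wpDr => //.
  exact: ngood_arm1_le iw bE bw (bstar_lt hbstar iw) nd.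
move: B E gw t5 t6 Kd; rewrite mulrDl mul1r.
move: (mgap i b * _) (mgap i b * _) (mgap i w * _) => a1 a2 a3; lra.
Qed.

End Pathwise.

(** * Expected regret *)

Section TraceBounds.
Variables (R : realType) (K : nat) (mu : 'M[R]_K) (T : nat).
Variables (d : measure_display) (Om : measurableType d) (P : probability Om R).
Variable H : Om -> path K.
Hypothesis hfb : dueling_feedback mu T P H.
Implicit Types (f g : seq (outcome K) -> R) (a b k : R).

Lemma trE_leD f g a b : trE P H T f <= a -> trE P H T g <= b ->
  trE P H T (fun x => f x + g x) <= a + b.
Proof. by move=> fa gb; rewrite trED lerD. Qed.

Lemma trE_leZ f a k : 0 <= k -> trE P H T f <= a -> trE P H T (fun x => k * f x) <= k * a.
Proof. by move=> k0 fa; rewrite trEZ ler_wpM2l. Qed.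

Lemma trE_leZr f a k : 0 <= k -> trE P H T f <= a -> trE P H T (fun x => f x * k) <= a * k.
Proof.
move=> k0 fa; rewrite mulrC (_ : (fun x => f x * k) = (fun x => k * f x)).
  exact: trE_leZ.
by apply: funext => x; rewrite mulrC.
Qed.

Lemma trE_le_sum (I : finType) (Q : pred I) (F : I -> seq (outcome K) -> R) (c : I -> R) :
  (forall i, Q i -> trE P H T (F i) <= c i) ->
  trE P H T (fun x => \sum_(i | Q i) F i x) <= \sum_(i | Q i) c i.
Proof. by move=> h; rewrite trE_sum; apply: ler_sum. Qed.

End TraceBounds.

Section Growth.
Variable R : realType.
Implicit Types (c x : R).

Lemma quad_le_expR x : 0 <= x -> x ^+ 2 / 2 <= expR x.
Proof.
move=> x0; have := @expR_ge1Dxn R x 1 x0.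
by rewrite (_ : 2`!%:R = 2 :> R) //; apply: le_trans; rewrite lerDr.
Qed.

Lemma quad_expRN_le c x : 0 < c -> 0 <= x -> x ^+ 2 * expR (- (c * x)) <= 2 / c ^+ 2.
Proof.
move=> c0 x0; have h := quad_le_expR (mulr_ge0 (ltW c0) x0).
rewrite expRN -ler_pdivlMr ?invr_gt0 ?expR_gt0 // invrK.
have -> : x ^+ 2 = 2 / c ^+ 2 * ((c * x) ^+ 2 / 2) by field; rewrite gt_eqF.
by rewrite ler_wpM2l // divr_ge0 // exprn_ge0 // ltW.
Qed.

End Growth.

(** * From the pathwise bound to explicit constants *)

Section Assembly.
Variables (R : realType) (K : nat) (mu : 'M[R]_K) (w : 'I_K).
Hypothesis hmu : preference_matrix mu.
Hypothesis hwin : condorcet_winner mu w.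
Variable bstar : 'I_K -> 'I_K.
Hypothesis hbstar : forall i, i != w -> is_bstar mu w i (bstar i).
Variable eps : R.
Hypothesis eps0 : 0 < eps <= 1.
Hypothesis stable : forall p, close_to mu eps p -> forall i, i != w -> 1 / 2 < p w i /\
    forall j, j != bstar i ->
    (ediv (p w i - 1 / 2 + (p w (bstar i) - 1 / 2)) (klp (p i (bstar i)) (1 / 2)) <
     ediv (p w i - 1 / 2 + (p w j - 1 / 2)) (klp (p i j) (1 / 2)))%E.
Variables (alpha fK : R).
Hypothesis alpha0 : 0 < alpha.
Hypothesis fK0 : 0 <= fK.

Let lam T : R := loglog R T.
Let L T : R := log R T.
Let ni T := ninit alpha T.
Let W : R := 2 * K%:R + 1.
Let Cb : R := 1 + 2 * K%:R * K%:R + 2 * K%:R.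

Let W0 : 0 <= W. Proof. by rewrite addr_ge0 // mulr_ge0. Qed.
Let Cb0 : 0 <= Cb. Proof. by rewrite !addr_ge0 // !mulr_ge0. Qed.

(** [nbadX], [tailX] and [misX] dominate [nbad_window], [any_dev] and [misled] by prefix sums, the
    form to which [trE_psum] and [trE_psum_prod] apply. *)
Definition nbadX (x : seq (outcome K)) : R :=
  2 * K%:R + W * (Cb * \prod_(j < K | j != w) psum (@zeta R) (obs w j x)).
Definition tail_dev T i s : R := ((ni T <= size s)%N && dev 1 (mu i (bstar i)) s)%:R.
Definition tailX T i (x : seq (outcome K)) : R := psum (tail_dev T i) (obs i (bstar i) x).
(** The size test keeps a single prefix of [psum], the sample of the initial phase. *)
Definition init_dev T i j s : R :=
  ((size s == ni T) && (eps < `|phat R s - mu i j|)%R)%:R.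
Definition misX T (x : seq (outcome K)) : R :=
  \sum_(i < K) \sum_(j < K | i != j) psum (init_dev T i j) (obs i j x).
Definition devX delta i j (x : seq (outcome K)) : R :=
  psum (fun s => (dev delta (mu i j) s)%:R) (obs i j x).

(** Affine and, for the horizons considered, nondecreasing in its last five arguments, so that one
    expression bounds a run, at trace functions, and the expectation, at bounds on their means. *)
Definition arm_bound T delta i (dv tl ms nb dw : R) : R :=
  mgap mu w i (bstar i) * (quota mu fK T delta i (bstar i) + W * (1 + dv))
  + ((quota mu fK T 1 i (bstar i) + 2 * K%:R) / lam T + 1)
  + tl * (quota mu fK T 1 i w + W) + W * dw
  + ms * ((1 + lam T) * (quota mu fK T 1 i w + W) + 1 + lam T * (ni T)%:R)
  + lam T * nb + (1 + lam T) * (W * dw).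

Definition path_bound T delta (x : seq (outcome K)) : R :=
  (Tinit K alpha T)%:R + nbadX x + \sum_(i < K | i != w)
    arm_bound T delta i (devX delta i (bstar i) x) (tailX T i x) (misX T x) (nbadX x)
      (devX 1 i w x).

Section FixedHorizon.
Variable T : nat.
Hypothesis lam1 : 1 <= lam T.

Let lam0 : 0 < lam T. Proof. exact: lt_le_trans lam1. Qed.

Let ceil_pos : (0 < Num.ceil (alpha * lam T))%R.
Proof. by rewrite ceil_gt0 mulr_gt0. Qed.

Lemma ninitE : (ni T)%:R = (Num.ceil (alpha * lam T))%:~R :> R.
Proof. by rewrite /ni /ninit natr_absz gtr0_norm. Qed.

Lemma ninit_ge : alpha * lam T <= (ni T)%:R.
Proof. by rewrite ninitE; exact: ceil_ge. Qed.

Lemma ninit_le : (ni T)%:R <= (alpha + 1) * lam T.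
Proof.
have h : (ni T)%:R - 1 < alpha * lam T.
  by rewrite ninitE; have := ceilB1_lt (alpha * lam T); rewrite rmorphB rmorph1.
by rewrite mulrDl mul1r; move: lam1 h; move: (_%:R) (alpha * lam T) (lam T) => a b c; lra.
Qed.

Lemma ninit_gt0 : (0 < ni T)%N.
Proof. by rewrite -(ltr_nat R); apply: lt_le_trans ninit_ge; rewrite mulr_gt0. Qed.

Lemma log_loglogK : L T = expR (lam T).
Proof.
rewrite /lam /loglog lnK // posrE; case: (ltP 0 (L T)) => // h.
by move: lam0; rewrite /lam /loglog ln0 // ltxx.
Qed.

Lemma devX_ge0 delta i j x : 0 <= devX delta i j x.
Proof. exact: psum_ge0. Qed.

Lemma tailX_ge0 i x : 0 <= tailX T i x.
Proof. exact: psum_ge0. Qed.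

Lemma misX_ge0 x : 0 <= misX T x.
Proof. by apply: sumr_ge0 => i _; apply: sumr_ge0 => j _; exact: psum_ge0. Qed.

Lemma nbadX_ge0 x : 0 <= nbadX x.
Proof.
apply: addr_ge0; first by rewrite mulr_ge0.
apply: mulr_ge0 => //; apply: mulr_ge0 => //.
by apply: prodr_ge0 => j _; apply: psum_ge0 => s; exact: zeta_ge0.
Qed.

Lemma init_coef_ge0 i : 0 <= (1 + lam T) * (quota mu fK T 1 i w + W) + 1 + lam T * (ni T)%:R.
Proof.
have l0 := ltW lam0; have q0 : 0 <= quota mu fK T 1 i w by apply: quota_ge0.
rewrite addr_ge0 //; last by rewrite mulr_ge0.
by rewrite addr_ge0 // mulr_ge0 // addr_ge0.
Qed.

Lemma arm_bound_le delta i dv dv' tl tl' ms ms' nb nb' dw dw' :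
  dv <= dv' -> tl <= tl' -> ms <= ms' -> nb <= nb' -> dw <= dw' ->
  arm_bound T delta i dv tl ms nb dw <= arm_bound T delta i dv' tl' ms' nb' dw'.
Proof.
move=> h1 h2 h3 h4 h5; have l0 := ltW lam0.
have q0 : 0 <= quota mu fK T 1 i w by apply: quota_ge0.
rewrite /arm_bound; apply: lerD; last first.
  by rewrite ler_wpM2l ?addr_ge0 // ler_wpM2l.
apply: lerD; last by rewrite ler_wpM2l.
apply: lerD; last by rewrite ler_wpM2r ?init_coef_ge0.
apply: lerD; last by rewrite ler_wpM2l.
apply: lerD; last by rewrite ler_wpM2r ?addr_ge0.
by rewrite lerD2r ler_wpM2l ?mgap_ge0 // lerD2l ler_wpM2l // lerD2l.
Qed.

Lemma arm_bound_ge0 delta i dv tl ms nb dw : 0 <= delta ->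
  0 <= dv -> 0 <= tl -> 0 <= ms -> 0 <= nb -> 0 <= dw ->
  0 <= arm_bound T delta i dv tl ms nb dw.
Proof.
move=> d0 h1 h2 h3 h4 h5; have l0 := ltW lam0.
have q0 D j k : 0 <= D -> 0 <= quota mu fK T D j k by move=> D0; apply: quota_ge0.
have q1 j k : 0 <= quota mu fK T 1 j k by exact: q0.
apply: addr_ge0; last by apply: mulr_ge0; [exact: addr_ge0|exact: mulr_ge0].
apply: addr_ge0; last exact: mulr_ge0.
apply: addr_ge0; last by apply: mulr_ge0 => //; exact: init_coef_ge0.
apply: addr_ge0; last exact: mulr_ge0.
apply: addr_ge0; last by apply: mulr_ge0 => //; exact: addr_ge0.
apply: addr_ge0.
  by rewrite mulr_ge0 ?mgap_ge0 // addr_ge0 ?q0 // mulr_ge0 // addr_ge0.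
by rewrite addr_ge0 // divr_ge0 // addr_ge0 // mulr_ge0.
Qed.

Lemma regret_path_bound delta order h : 0 < delta -> perm_eq order (enum 'I_K) ->
  RMED2FH_path alpha fK T order h -> regret mu w h T <= path_bound T delta (trace h T).
Proof.
move=> d0 Ho [istar [bhat Hf]]; rewrite /path_bound.
have S0 : 0 <= \sum_(i < K | i != w) arm_bound T delta i (devX delta i (bstar i) (trace h T))
    (tailX T i (trace h T)) (misX T (trace h T)) (nbadX (trace h T)) (devX 1 i w (trace h T)).
  apply: sumr_ge0 => i _; apply: arm_bound_ge0 (ltW d0) _ _ _ _ _;
    by rewrite ?devX_ge0 ?tailX_ge0 ?misX_ge0 ?nbadX_ge0.
have hn := ninit_gt0.
(* The horizon may fall inside the initial phase; the regret is then at most [T], less than the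
   length of that phase. *)
have [T0T|TT0] := leqP (Tinit K alpha T) T; last first.
  rewrite -addrA; apply: ler_wpDr; first by rewrite addr_ge0 // nbadX_ge0.
  apply: (@le_trans _ _ T%:R); last by rewrite ler_nat ltnW.
  rewrite /regret [leRHS](_ : _ = \sum_(1 <= t < T.+1) 1).
    by apply: ler_sum => t _; exact: mgap_le1.
  by rewrite sumr_const_nat subSS subn0.
have nb : nbad_window w alpha T h <= nbadX (trace h T).
  apply: (le_trans (nbad_window_le w h Ho fK0 hn)).
  by rewrite lerD2l ler_wpM2l // (nbad_le w Hf Ho fK0 hn).
apply: (le_trans (regret_le hmu hwin Hf Ho fK0 hn T0T)).
apply: lerD; first by rewrite lerD2l.
apply: ler_sum => i iw; have [e0 e1] := andP eps0.
apply: (le_trans (arm_regret_le hmu hwin Hf Ho fK0 hn lam0 T0T e0 hbstar stable d0 iw)).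
have ib : i != bstar i.
  apply: contraTneq (bstar_lt hbstar iw) => e; rewrite -e.
  by case: hmu => _ _ ->; rewrite ltxx.
apply: arm_bound_le => //.
- case: (boolP (any_dev _ _ _ _ _ _)) => [/existsP[n /andP[n1 n2]]|_]; last exact: tailX_ge0.
  have ns : (n <= size (obs i (bstar i) (trace h T)))%N by rewrite -ltnS.
  apply: le_trans (psum_ge (phi := tail_dev T i) _ ns); last by [].
  by rewrite /tail_dev size_take_min (minn_idPl ns) n1 n2.
- case: (boolP (misled _ _ _ _ _)) => [/existsP[k /existsP[j /andP[kj hd]]]|_]; last exact: misX_ge0.
  have ns : (ni T <= size (obs k j (trace h T)))%N.
    by rewrite size_obs_trace // /ni; case: Hf => _ /(_ k j kj) <- _ _; exact: leq_ncmp.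
  rewrite /misX (bigD1 k) //= (bigD1 j) //= -addrA; apply: ler_wpDr.
    by rewrite addr_ge0 ?sumr_ge0 // => *; rewrite ?sumr_ge0 // => *; exact: psum_ge0.
  apply: le_trans (psum_ge (phi := init_dev T k j) _ ns); last by [].
  by rewrite /init_dev size_take_min (minn_idPl ns) eqxx hd.
Qed.

Lemma sum_eq_le (N m : nat) (c : R) : 0 <= c -> \sum_(n < N) (if n == m :> nat then c else 0) <= c.
Proof.
move=> c0; case: (ltnP m N) => mN.
  rewrite (bigD1 (Ordinal mN)) //= eqxx big1 ?addr0 // => n; rewrite -val_eqE /= => /negbTE -> //.
rewrite big1 // => n _; case: eqP => // e; by move: (ltn_ord n); rewrite e ltnNge mN.
Qed.

Lemma bernE_init_dev i j n : bernE (mu i j) n (init_dev T i j) <=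
  if n == ni T then 2 * expR (- (eps ^+ 2 / 8 * (ni T)%:R)) else 0.
Proof.
have mu01 : 0 <= mu i j <= 1 by case: hmu.
case: eqVneq => [->|nn]; last first.
  rewrite -(bernE_cst (mu i j) n 0); apply: le_bernE => // s sn.
  by rewrite /init_dev sn (negbTE nn).
have e01 : 0 <= eps <= 1 by case/andP: eps0 => e0 ->; rewrite ltW.
have U := chernoff_up (ni T) mu01 e01; have D := chernoff_lo (ni T) mu01 e01.
rewrite mulr_natl mulr2n; apply: le_trans (lerD U D); rewrite -bernED.
apply: le_bernE => // s sn; rewrite /init_dev sn eqxx /=.
case: (ltP eps) => [hd|_]; last by rewrite addr_ge0.
have n0 : 0 < (ni T)%:R :> R by rewrite ltr0n ninit_gt0.
rewrite nsucc_phat sn !ler_pM2l //.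
case: (lerP (mu i j + eps) (phat R s)) => h1; first by rewrite lerDl.
suff -> : phat R s <= mu i j - eps by rewrite lerDr.
move: hd; rewrite ltNge ler_norml => /negP h2; rewrite leNgt; apply/negP => h3.
by apply: h2; apply/andP; split; lra.
Qed.

Variable CZ : 'I_K -> R.
Hypothesis CZ_ge0 : forall j, 0 <= CZ j.
Hypothesis CZ_le : forall j, j != w -> forall N, \sum_(n < N) bernE (mu w j) n (@zeta R) <= CZ j.
Variable rate : 'I_K -> 'I_K -> R.
Hypothesis rate_gt0 : forall i j, 0 < rate i j <= 1.
Hypothesis rate_le : forall i j, mu i j < 1 / 2 -> forall delta n, 0 < delta <= 1 ->
  bernE (mu i j) n (fun s => (dev delta (mu i j) s)%:R) <=
  expR (- (rate i j * delta ^+ 2 * n%:R)).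

(** [CZ] and [rate] are to be fixed without reference to the horizon, so that [T] enters these
    bounds only through [ni T]. *)
Definition nbadE : R := 2 * K%:R + W * (Cb * \prod_(j < K | j != w) CZ j).
Definition devE (delta : R) i j : R := 2 / (rate i j * delta ^+ 2).
Definition tailE i : R :=
  expR (- (rate i (bstar i) * (ni T)%:R)) * (2 / rate i (bstar i)).
Definition misE : R := \sum_(i < K) \sum_(j < K | i != j)
  2 * expR (- (eps ^+ 2 / 8 * (ni T)%:R)).

Section Expectation.
Variables (d : measure_display) (Om : measurableType d) (P : probability Om R).
Variable H : Om -> path K.
Hypothesis hfb : dueling_feedback mu T P H.

Lemma trE_nbadX : trE P H T nbadX <= nbadE.
Proof.
apply: (trE_leD (trE_cst_le hfb _)); first by rewrite mulr_ge0.
apply: (trE_leZ W0); apply: (trE_leZ Cb0).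
apply: (le_trans (trE_psum_prod hmu hfb w (@zeta_ge0 R))).
apply: ler_prod => j jw; rewrite CZ_le // andbT; apply: sumr_ge0 => n _.
by apply: bernE_ge0 => [|s]; [case: hmu|exact: zeta_ge0].
Qed.

Lemma trE_devX delta i j : 0 < delta <= 1 -> i != j -> mu i j < 1 / 2 ->
  trE P H T (devX delta i j) <= devE delta i j.
Proof.
move=> hd ij mij; have /andP[r0 r1] := rate_gt0 i j; have /andP[d0 d1] := hd.
apply: (le_trans (trE_psum hmu hfb ij _)) => //.
have c01 : 0 < rate i j * delta ^+ 2 <= 1.
  by rewrite mulr_gt0 ?exprn_gt0 //= mulr_ile1 ?exprn_ge0 ?exprn_ile1 // ltW.
have := sum_expRN_le 0 T.+1 c01; rewrite mulr0 oppr0 expR0 mul1r; apply: le_trans.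
by apply: ler_sum => n _; exact: rate_le.
Qed.

Lemma trE_tailX i : i != w -> trE P H T (tailX T i) <= tailE i.
Proof.
move=> iw; have mib := bstar_lt hbstar iw; have /andP[r0 r1] := rate_gt0 i (bstar i).
have ib : i != bstar i.
  by apply: contraTneq mib => <-; case: hmu => _ _ ->; rewrite ltxx.
have mu01 : 0 <= mu i (bstar i) <= 1 by case: hmu.
apply: (le_trans (trE_psum hmu hfb ib _)) => //.
apply: le_trans (sum_expRN_le (ni T) T.+1 (rate_gt0 i (bstar i))).
rewrite [leRHS]big_mkcond /=; apply: ler_sum => n _; case: leqP => hn.
  have rl := @rate_le i (bstar i) mib 1 n; rewrite expr1n mulr1 in rl.
  apply: le_trans (rl _); last by rewrite ltr01 lexx.
  apply: le_bernE => // s sn; rewrite /tail_dev ler_nat; by case: (dev _ _ _); rewrite ?andbF ?leq_b1.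
rewrite -(bernE_cst (mu i (bstar i)) n 0); apply: le_bernE => // s sn.
by rewrite /tail_dev sn leqNgt hn.
Qed.

Lemma trE_misX : trE P H T (misX T) <= misE.
Proof.
apply: trE_le_sum => i _; apply: trE_le_sum => j ij.
apply: (le_trans (trE_psum hmu hfb ij _)) => //.
apply: (@le_trans _ _ (\sum_(n < T.+1) (if n == ni T :> nat then
    2 * expR (- (eps ^+ 2 / 8 * (ni T)%:R)) else 0))).
  by apply: ler_sum => n _; exact: bernE_init_dev.
by apply: sum_eq_le; rewrite mulr_ge0 // expR_ge0.
Qed.

Lemma trE_path_bound delta : 0 < delta <= 1 ->
  trE P H T (path_bound T delta) <= (Tinit K alpha T)%:R + nbadE + \sum_(i < K | i != w)
    arm_bound T delta i (devE delta i (bstar i)) (tailE i) misE nbadE (devE 1 i w).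
Proof.
move=> hd; have l0 := ltW lam0; have /andP[d0 d1] := hd.
have q0 D j k : 0 <= D -> 0 <= quota mu fK T D j k by move=> D0; apply: quota_ge0.
have q1 j k : 0 <= quota mu fK T 1 j k by exact: q0.
have cst c : 0 <= c -> trE P H T (fun=> c) <= c by exact: (trE_cst_le hfb).
apply: trE_leD; first by apply: trE_leD (cst _ _) trE_nbadX.
apply: trE_le_sum => i iw.
have ib : i != bstar i.
  apply: contraTneq (bstar_lt hbstar iw) => e; rewrite -e.
  by case: hmu => _ _ ->; rewrite ltxx.
have dw : trE P H T (devX 1 i w) <= devE 1 i w.
  by apply: trE_devX => //; [rewrite ltr01 lexx|exact: mu_winner_lt].
apply: trE_leD; last by apply: trE_leZ; [exact: addr_ge0|exact: trE_leZ].
apply: trE_leD; last by apply: trE_leZ => //; exact: trE_nbadX.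
apply: trE_leD; last by apply: trE_leZr; [exact: init_coef_ge0|exact: trE_misX].
apply: trE_leD; last exact: trE_leZ.
apply: trE_leD; last by apply: trE_leZr; [exact: addr_ge0|exact: trE_tailX].
apply: trE_leD; last first.
  by apply: cst; rewrite addr_ge0 // divr_ge0 // addr_ge0 // mulr_ge0.
apply: trE_leZ; first exact: mgap_ge0.
apply: trE_leD; first by apply: cst; apply: q0; exact: ltW.
apply: trE_leZ => //; apply: trE_leD; first exact: cst.
by apply: trE_devX => //; exact: (bstar_lt hbstar).
Qed.

End Expectation.

Let X : R := L T / lam T.

Lemma loglog_le_log : lam T <= L T.
Proof.
rewrite log_loglogK; apply: le_trans (expR_ge1Dx (lam T)); by rewrite lerDr ler01.
Qed.

Lemma log_div_loglog_ge1 : 1 <= X.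
Proof. by rewrite /X ler_pdivlMr // mul1r loglog_le_log. Qed.

(** From [lam ^+ 2 / 2 <= expR lam], which is log T. It absorbs the initial phase and all costs of
    order loglog T into log T / loglog T. *)
Lemma loglog_le_log_div : lam T <= 2 * X.
Proof.
rewrite /X mulrA ler_pdivlMr // log_loglogK -expr2.
by have := quad_le_expR (ltW lam0); rewrite ler_pdivrMr // mulrC.
Qed.

(** The exponential is a negative power of log T, and any such power beats (loglog T)^2. *)
Lemma expRN_loglog_log (c : R) : 0 < c -> expR (- (c * lam T)) * (lam T * L T) <= 2 / c ^+ 2 * X.
Proof.
move=> c0; rewrite (_ : _ * _ = (lam T ^+ 2 * expR (- (c * lam T))) * X).
  by rewrite ler_wpM2r ?quad_expRN_le // ?(ltW lam0) // (le_trans ler01 log_div_loglog_ge1).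
by rewrite /X; field; rewrite gt_eqF.
Qed.

Definition coefC i : R :=
  2 * (2 * (1 + fK) / kl (mu i w) (1 / 2) + W) + 1 + (alpha + 1).

Lemma coefC_ge0 i : i != w -> 0 <= coefC i.
Proof.
move=> iw; have kw := ltW (winner_kl_gt0 hmu hwin iw); have a0 := ltW alpha0.
apply: addr_ge0; last exact: addr_ge0.
apply: addr_ge0 => //; apply: mulr_ge0 => //; apply: addr_ge0 => //.
by apply: divr_ge0 => //; apply: mulr_ge0 => //; exact: addr_ge0.
Qed.

Lemma log_ge1 : 1 <= L T.
Proof. exact: le_trans lam1 loglog_le_log. Qed.

Lemma coef_le i : i != w -> (1 + lam T) * (quota mu fK T 1 i w + W) + 1 + lam T * (ni T)%:R <=
  coefC i * (lam T * L T).
Proof.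
move=> iw; have kw := winner_kl_gt0 hmu hwin iw.
have L1 := log_ge1; have l0 := ltW lam0.
set q := 2 * (1 + fK) / kl (mu i w) (1 / 2).
have q0 : 0 <= q by apply: divr_ge0; [rewrite mulr_ge0 // addr_ge0|exact: ltW].
have h1 : quota mu fK T 1 i w + W <= (q + W) * L T.
  rewrite mulrDl; apply: lerD; last by rewrite ler_peMr.
  rewrite /quota /q -/(L T) [leRHS]mulrAC ler_pM2r ?invr_gt0 //.
  by have := ler_peMr fK0 L1; move: (L T) => l; lra.
have h2 : (1 + lam T) * (quota mu fK T 1 i w + W) <= (2 * lam T) * ((q + W) * L T).
  apply: ler_pM => //; [exact: addr_ge0| |by move: lam1; move: (lam T) => a; lra].
  by rewrite addr_ge0 // quota_ge0.
have h3 : 1 <= lam T * L T by rewrite mulr_ege1.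
have h4 : lam T * (ni T)%:R <= (alpha + 1) * (lam T * L T).
  rewrite [leRHS]mulrCA ler_wpM2l //; apply: (le_trans ninit_le).
  by rewrite ler_wpM2l ?loglog_le_log // addr_ge0 // ltW.
rewrite /coefC -/q; apply: le_trans (lerD (lerD h2 h3) h4) _.
by rewrite le_eqVlt; apply/orP; left; apply/eqP; ring.
Qed.

Lemma expRN_ninit_le (c : R) : 0 < c ->
  expR (- (c * (ni T)%:R)) <= expR (- (c * alpha * lam T)).
Proof. by move=> c0; rewrite ler_expR lerN2 -mulrA ler_pM2l // ninit_ge. Qed.

(* The exponentially small probability of a wrong bhat offsets its cost
   O(log T loglog T). *)
Lemma expRN_coef_le (c : R) i : i != w -> 0 < c ->
  expR (- (c * (ni T)%:R)) *
    ((1 + lam T) * (quota mu fK T 1 i w + W) + 1 + lam T * (ni T)%:R) <=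
  coefC i * (2 / (c * alpha) ^+ 2) * X.
Proof.
move=> iw c0; have ca : 0 < c * alpha by rewrite mulr_gt0.
apply: (le_trans (ler_pM (expR_ge0 _) (init_coef_ge0 i) (expRN_ninit_le c0) (coef_le iw))).
rewrite mulrCA -[leRHS]mulrA; apply: ler_wpM2l; [exact: coefC_ge0|exact: expRN_loglog_log].
Qed.

Definition arm_main (delta : R) i : R :=
  ((gap mu w i + gap mu w (bstar i)) * ((1 + delta) * L T)) / (2 * kl (mu i (bstar i)) (1 / 2)).

Definition armC i : R :=
  (2 * fK / kl (mu i (bstar i)) (1 / 2) + (W + 2 * W / rate i (bstar i)))
  + (2 / kl (mu i (bstar i)) (1 / 2) + (2 * fK / kl (mu i (bstar i)) (1 / 2) + 2 * K%:R + 1))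
  + 2 / rate i (bstar i) * (coefC i * (2 / (rate i (bstar i) * alpha) ^+ 2))
  + W * devE 1 i w
  + K%:R * K%:R * 2 * (coefC i * (2 / (eps ^+ 2 / 8 * alpha) ^+ 2))
  + 2 * nbadE + 3 * (W * devE 1 i w).

Lemma nbadE_ge0 : 0 <= nbadE.
Proof.
apply: addr_ge0; first by rewrite mulr_ge0.
by apply: mulr_ge0 => //; apply: mulr_ge0 => //; apply: prodr_ge0 => j _; exact: CZ_ge0.
Qed.

Lemma devE_ge0 delta i j : 0 <= devE delta i j.
Proof.
have /andP[r0 _] := rate_gt0 i j.
by rewrite divr_ge0 // mulr_ge0 ?sqr_ge0 // ltW.
Qed.

Lemma armC_ge0 i : i != w -> 0 <= armC i.
Proof.
move=> iw; have kb := ltW (kl_bstar_gt0 hmu hbstar iw).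
have /andP[/ltW r0 _] := rate_gt0 i (bstar i).
have c0 := coefC_ge0 iw; have n0 := nbadE_ge0; have d0 := devE_ge0 1 i w.
have a0 := ltW alpha0; have /andP[/ltW e0 _] := eps0.
apply: addr_ge0; last by apply: mulr_ge0 => //; exact: mulr_ge0.
apply: addr_ge0; last exact: mulr_ge0.
apply: addr_ge0; last by apply: mulr_ge0; [do 2 apply: mulr_ge0 => //|apply: mulr_ge0 => //; apply: divr_ge0 => //; exact: sqr_ge0].
apply: addr_ge0; last exact: mulr_ge0.
apply: addr_ge0; last by apply: mulr_ge0; [exact: divr_ge0|apply: mulr_ge0 => //; apply: divr_ge0 => //; exact: sqr_ge0].
apply: addr_ge0.
  by apply: addr_ge0; [apply: divr_ge0 => //; exact: mulr_ge0|apply: addr_ge0 => //; apply: divr_ge0 => //; exact: mulr_ge0].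
by apply: addr_ge0; [exact: divr_ge0|apply: addr_ge0 => //; apply: addr_ge0; [apply: divr_ge0 => //; exact: mulr_ge0|exact: mulr_ge0]].
Qed.

(** The deviations counted with [delta] are compared with [delta ^- 2], all other terms with log T /
    loglog T. Both are at least 1, so constants are absorbed; only the log T part of the quota is
    kept exactly. *)
Lemma arm_bound_final delta i : 0 < delta <= 1 -> i != w ->
  arm_bound T delta i (devE delta i (bstar i)) (tailE i) misE nbadE (devE 1 i w) <=
  arm_main delta i + armC i * (X + delta ^- 2).
Proof.
move=> /andP[d0 d1] iw; have kb := kl_bstar_gt0 hmu hbstar iw.
have kw := winner_kl_gt0 hmu hwin iw.
have /andP[r0 r1] := rate_gt0 i (bstar i).
set D := delta ^- 2; set Y := X + D; set b := bstar i in kb r0 r1 *.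
have l0 := ltW lam0; have X1 := log_div_loglog_ge1; have X0 : 0 <= X := le_trans ler01 X1.
have D1 : 1 <= D by rewrite /D invf_ge1 ?exprn_gt0 // exprn_ile1 // ltW.
have D0 : 0 <= D := le_trans ler01 D1.
have YX : X <= Y by rewrite lerDl.
have YD : D <= Y by rewrite lerDr.
have up c x : 0 <= c -> x <= c * X -> x <= c * Y.
  by move=> c0 h; apply: (le_trans h); rewrite ler_wpM2l.
have cX c : 0 <= c -> c <= c * X by move=> c0; rewrite ler_peMr.
have cf0 := coefC_ge0 iw; have dw0 := devE_ge0 1 i w; have nb0 := nbadE_ge0.
have Wd0 : 0 <= W * devE 1 i w by rewrite mulr_ge0.
have fb0 : 0 <= 2 * fK / kl (mu i b) (1 / 2).
  by apply: divr_ge0; [exact: mulr_ge0|exact: ltW].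
have qw0 : 0 <= quota mu fK T 1 i w by apply: quota_ge0.
have lni0 : 0 <= lam T * (ni T)%:R by rewrite mulr_ge0.
have t1 : mgap mu w i b * (quota mu fK T delta i b + W * (1 + devE delta i b)) <=
    arm_main delta i + (2 * fK / kl (mu i b) (1 / 2) + (W + 2 * W / rate i b)) * Y.
  have m0 := mgap_ge0 hmu hwin i b; have m1 := mgap_le1 w hmu i b.
  have -> : arm_main delta i = mgap mu w i b * ((1 + delta) * L T / kl (mu i b) (1 / 2)).
    by rewrite /arm_main /mgap -/b; field; rewrite gt_eqF.
  have e1 : quota mu fK T delta i b = (1 + delta) * L T / kl (mu i b) (1 / 2) +
      (1 + delta) * fK / kl (mu i b) (1 / 2) by rewrite /quota mulrDr mulrDl.
  rewrite e1 -addrA mulrDr lerD2l.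
  have z0 : 0 <= (1 + delta) * fK / kl (mu i b) (1 / 2) + W * (1 + devE delta i b).
    rewrite addr_ge0 //; last by rewrite mulr_ge0 // addr_ge0 // devE_ge0.
    apply: divr_ge0; last exact: ltW.
    by apply: mulr_ge0 => //; apply: addr_ge0 => //; exact: ltW.
  apply: (le_trans (ler_piMl z0 m1)); rewrite [leRHS]mulrDl; apply: lerD.
    apply: (@le_trans _ _ (2 * fK / kl (mu i b) (1 / 2))).
      rewrite ler_pM2r ?invr_gt0 // ler_wpM2r //; lra.
    by apply: up => //; exact: cX.
  apply: (@le_trans _ _ ((W + 2 * W / rate i b) * D)).
    rewrite [leLHS]mulrDr mulr1 [leRHS]mulrDl; apply: lerD; first by rewrite ler_peMr.
    rewrite le_eqVlt; apply/orP; left; apply/eqP.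
    by rewrite /devE /D; field; rewrite !gt_eqF.
  by rewrite ler_wpM2l // addr_ge0 // divr_ge0 ?mulr_ge0 // ltW.
have t2 : (quota mu fK T 1 i b + 2 * K%:R) / lam T + 1 <=
    (2 / kl (mu i b) (1 / 2) + (2 * fK / kl (mu i b) (1 / 2) + 2 * K%:R + 1)) * Y.
  have g0 : 0 <= 2 * fK / kl (mu i b) (1 / 2) + 2 * K%:R by rewrite addr_ge0 // mulr_ge0.
  apply: up.
    by apply: addr_ge0; [apply: divr_ge0 => //; exact: ltW|exact: addr_ge0].
  rewrite [leRHS]mulrDl [Z in _ <= _ + Z]mulrDl (mul1r X) [leRHS]addrA.
  apply: lerD => //.
  have -> : (quota mu fK T 1 i b + 2 * K%:R) / lam T = 2 / kl (mu i b) (1 / 2) * X +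
      (2 * fK / kl (mu i b) (1 / 2) + 2 * K%:R) / lam T.
    by rewrite /quota /X -/(L T); field; rewrite !gt_eqF.
  rewrite lerD2l; apply: (@le_trans _ _ (2 * fK / kl (mu i b) (1 / 2) + 2 * K%:R)); last exact: cX.
  by rewrite ler_pdivrMr // ler_peMr.
have t3 : tailE i * (quota mu fK T 1 i w + W) <=
    2 / rate i b * (coefC i * (2 / (rate i b * alpha) ^+ 2)) * Y.
  have r2 : 0 <= 2 / rate i b by rewrite divr_ge0 // ltW.
  apply: up.
    by rewrite !mulr_ge0 // ?invr_ge0 ?sqr_ge0 // ltW.
  rewrite -[leRHS]mulrA /tailE -/b [leLHS]mulrAC [leLHS]mulrC; apply: ler_wpM2l => //.
  apply: le_trans (expRN_coef_le iw r0); rewrite ler_wpM2l ?expR_ge0 //.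
  rewrite -[leLHS]mul1r -addrA; apply: ler_wpDr; first by rewrite addr_ge0.
  by rewrite ler_wpM2r ?addr_ge0 // lerDl.
have t4 : W * devE 1 i w <= W * devE 1 i w * Y by apply: up => //; exact: cX.
have t5 : misE * ((1 + lam T) * (quota mu fK T 1 i w + W) + 1 + lam T * (ni T)%:R) <=
    K%:R * K%:R * 2 * (coefC i * (2 / (eps ^+ 2 / 8 * alpha) ^+ 2)) * Y.
  have /andP[e0 _] := eps0.
  have e20 : 0 < eps ^+ 2 / 8 by rewrite divr_gt0 // exprn_gt0.
  apply: up; first by rewrite !mulr_ge0 // ?invr_ge0 ?sqr_ge0.
  have m2 : misE <= K%:R * K%:R * 2 * expR (- (eps ^+ 2 / 8 * (ni T)%:R)).
    rewrite /misE -!mulrA; set z := 2 * _.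
    have z0 : 0 <= z by rewrite mulr_ge0 // expR_ge0.
    rewrite mulr_natl -[X in _ *+ X](card_ord K) -sumr_const; apply: ler_sum => k _.
    rewrite mulr_natl -[X in _ *+ X](card_ord K) -sumr_const big_mkcond; apply: ler_sum => j _.
    by case: ifP.
  apply: (le_trans (ler_wpM2r (init_coef_ge0 i) m2)).
  rewrite -[leLHS]mulrA -[leRHS]mulrA; apply: ler_wpM2l; first by rewrite !mulr_ge0.
  exact: expRN_coef_le.
have t6 : lam T * nbadE <= 2 * nbadE * Y.
  apply: up; first by rewrite mulr_ge0.
  by rewrite mulrAC ler_wpM2r // loglog_le_log_div.
have t7 : (1 + lam T) * (W * devE 1 i w) <= 3 * (W * devE 1 i w) * Y.
  apply: up; first by rewrite mulr_ge0.
  rewrite mulrAC ler_wpM2r //; have := loglog_le_log_div; move: X1; move: X (lam T) => a c; lra.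
apply: (le_trans (lerD (lerD (lerD (lerD (lerD (lerD t1 t2) t3) t4) t5) t6) t7)).
have sum7 (m a1 a2 a3 a4 a5 a6 a7 : R) : m + a1 * Y + a2 * Y + a3 * Y + a4 * Y +
  a5 * Y + a6 * Y + a7 * Y = m + (a1 + a2 + a3 + a4 + a5 + a6 + a7) * Y by ring.
by rewrite sum7.
Qed.

Definition initC : R := 2 * (alpha + 1) * (K%:R * K%:R) + nbadE.

Lemma init_final : (Tinit K alpha T)%:R + nbadE <= initC * X.
Proof.
have X1 := log_div_loglog_ge1; have a0 := ltW alpha0.
rewrite /initC mulrDl; apply: lerD; last by rewrite ler_peMr // nbadE_ge0.
apply: (@le_trans _ _ ((ni T)%:R * (K%:R * K%:R))).
  rewrite -!natrM ler_nat /Tinit; apply: (leq_trans (leq_div _ _)).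
  by rewrite !leq_mul2l leq_pred !orbT.
rewrite [leRHS]mulrAC; apply: ler_wpM2r; first by rewrite mulr_ge0.
apply: (le_trans ninit_le); rewrite [2 * _]mulrC -mulrA.
by rewrite ler_wpM2l ?addr_ge0 // loglog_le_log_div.
Qed.

End FixedHorizon.
End Assembly.

(** * A constant uniform in the horizon and the two regret bounds *)

Section Core.
Variables (R : realType) (K : nat) (mu : 'M[R]_K) (w : 'I_K).
Hypothesis hmu : preference_matrix mu.
Hypothesis hwin : condorcet_winner mu w.
Variable bstar : 'I_K -> 'I_K.
Hypothesis hbstar : forall i, i != w -> is_bstar mu w i (bstar i).

(** The constant precedes the horizon, [delta] and the probability space: it is built from [eps],
    [CZ] and [rate], which depend on the instance alone, and from [alpha] and [fK]. *)
Lemma expected_regret_bound (alpha fK : R) : 0 < alpha -> 0 <= fK ->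
  exists2 C : R, 0 <= C & forall (T : nat) (delta : R), 1 <= loglog R T -> 0 < delta <= 1 ->
  forall (d : measure_display) (Om : measurableType d) (P : probability Om R)
    (H : Om -> path K), RMED2FH_process mu alpha fK T P H ->
  (expected_regret mu w T P H <=
   (\sum_(i < K | i != w) ((gap mu w i + gap mu w (bstar i)) * ((1 + delta) * log R T)) /
        (2 * kl (mu i (bstar i)) (1 / 2))
    + C * (log R T / loglog R T + delta ^- 2))%:E)%E.
Proof.
move=> alpha0 fK0.
have [eps eps0 stable] := bstar_stable hmu hwin hbstar.
have /choice[CZ HCZ] : forall j : 'I_K, exists c : R, 0 <= c /\
    (j != w -> forall N, \sum_(n < N) bernE (mu w j) n (@zeta R) <= c).
  move=> j; have [jw|jw] := eqVneq j w; first by exists 0.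
  have [|c c0 hc] := @sum_bernE_zeta R (mu w j); last by exists c.
  by rewrite hwin //=; case: hmu => /(_ w j)/andP[].
have /choice[r Hr] : forall ij : 'I_K * 'I_K, exists r : R, 0 < r <= 1 /\
    (mu ij.1 ij.2 < 1 / 2 -> forall delta n, 0 < delta <= 1 ->
     bernE (mu ij.1 ij.2) n (fun s => (dev delta (mu ij.1 ij.2) s)%:R) <=
     expR (- (r * delta ^+ 2 * n%:R))).
  move=> [i j] /=; have [m2|m2] := ltP (mu i j) (1 / 2); last first.
    by exists 1; split; [rewrite ltr01 lexx|].
  have [|c c0 hc] := @bernE_dev R (mu i j); first by rewrite mu_ge0.
  by exists c.
pose rate i j := r (i, j).
have CZ0 j : 0 <= CZ j by case: (HCZ j).
have CZle j : j != w -> forall N, \sum_(n < N) bernE (mu w j) n (@zeta R) <= CZ j.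
  by case: (HCZ j).
have rate0 i j : 0 < rate i j <= 1 by case: (Hr (i, j)).
have ratele i j : mu i j < 1 / 2 -> forall delta n, 0 < delta <= 1 ->
    bernE (mu i j) n (fun s => (dev delta (mu i j) s)%:R) <=
    expR (- (rate i j * delta ^+ 2 * n%:R)) by case: (Hr (i, j)).
pose aC i := armC mu w bstar eps alpha fK CZ rate i.
have aC0 i : i != w -> 0 <= aC i by apply: armC_ge0.
pose C := initC w alpha CZ + \sum_(i < K | i != w) aC i.
have iC0 : 0 <= initC w alpha CZ.
  by apply: addr_ge0; [rewrite !mulr_ge0 // addr_ge0 // ltW|exact: nbadE_ge0].
exists C; first by rewrite addr_ge0 // sumr_ge0.
move=> T delta lam1 hd d Om P H [hfb [order Ho HP]].
have /andP[d0 d1] := hd.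
have path om := regret_path_bound hmu hwin hbstar eps0 stable alpha0 fK0 lam1 d0 Ho (HP om).
apply: (le_trans (expected_regret_le hmu hwin hfb path)); rewrite lee_fin.
apply: (le_trans (trE_path_bound hmu hwin hbstar eps0 alpha0 fK0 lam1 CZle rate0 ratele hfb hd)).
set X := log R T / loglog R T; set Y := X + delta ^- 2.
have XY : X <= Y by rewrite lerDl invr_ge0 exprn_ge0 // ltW.
have i1 := init_final w alpha0 lam1 CZ0; rewrite -/X in i1.
apply: (@le_trans _ _ (initC w alpha CZ * Y + \sum_(i < K | i != w)
    (arm_main mu w bstar T delta i + aC i * Y))).
  apply: lerD; first by apply: (le_trans i1); rewrite ler_wpM2l.
  apply: ler_sum => i iw; exact: arm_bound_final.
by rewrite big_split /= -mulr_suml addrCA -mulrDl.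
Qed.

End Core.

Lemma loglog_eventually (R : realType) (B : R) :
  exists T0 : nat, forall T, (T0 <= T)%N -> B <= loglog R T.
Proof.
exists (Num.truncn (expR (expR B))).+1 => T hT.
have h : expR (expR B) <= T%:R.
  apply: le_trans (ltW (truncnS_gt _)) _; by rewrite ler_nat.
have h2 : expR B <= ln T%:R.
  by rewrite -[leLHS]expRK ler_ln ?posrE ?expR_gt0 //; apply: lt_le_trans h; exact: expR_gt0.
rewrite /loglog -[leLHS]expRK ler_ln ?posrE ?expR_gt0 //.
by apply: lt_le_trans h2; exact: expR_gt0.
Qed.

Theorem theorem4 (R : realType) (K : nat) (hK : (0 < K)%N) (mu : 'M[R]_K)
    (hmu : preference_matrix mu) (hwin : condorcet_winner mu (arm1 hK))
    (bstar : 'I_K -> 'I_K)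
    (hbstar : forall i, i != arm1 hK -> is_bstar mu (arm1 hK) i (bstar i)) :
  (exists2 A : R, 0 < A &
   forall alpha fK : R, 0 < alpha -> 0 <= fK ->
   exists (delta0 C1 C2 C3 C4 C5 : R) (T0 : nat), 0 < delta0 /\
   forall (delta : R) (T : nat), 0 < delta < delta0 -> (T0 <= T)%N ->
   forall (d : measure_display) (Om : measurableType d) (P : probability Om R)
     (H : Om -> path K), RMED2FH_process mu alpha fK T P H ->
   (expected_regret mu (arm1 hK) T P H <=
     (\sum_(i < K | i != arm1 hK)
        ((gap mu (arm1 hK) i + gap mu (arm1 hK) (bstar i)) *
           ((1 + delta) * log R T)) / (2 * kl (mu i (bstar i)) (1 / 2))
      + C1 * (alpha * K%:R ^+ 2 * loglog R T)
      + C2 * (K%:R * expR (A * K%:R - fK))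
      + C3 * (K%:R * log R T / loglog R T)
      + C4 * (K%:R / delta ^+ 2)
      + C5 * (K%:R * fK))%:E)%E)
  /\
  (forall alpha c eps : R, 0 < alpha -> 0 < c -> 0 < eps ->
   exists (C1 C2 C3 : R) (T0 : nat),
   forall T : nat, (T0 <= T)%N ->
   forall (d : measure_display) (Om : measurableType d) (P : probability Om R)
     (H : Om -> path K),
   RMED2FH_process mu alpha (c * K%:R `^ (1 + eps)) T P H ->
   (expected_regret mu (arm1 hK) T P H <=
     (\sum_(i < K | i != arm1 hK)
        ((gap mu (arm1 hK) i + gap mu (arm1 hK) (bstar i)) * log R T) /
          (2 * kl (mu i (bstar i)) (1 / 2))
      + C1 * (alpha * K%:R ^+ 2 * loglog R T)
      + C2 * (K%:R * log R T / loglog R T)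
      + C3 * (K%:R `^ (2 + eps)))%:E)%E).
Proof.
have K1 : 1 <= K%:R :> R by rewrite ler1n.
have X_ge0 T : 1 <= loglog R T -> 0 <= log R T / loglog R T.
  by move=> lam1; apply: le_trans ler01 (log_div_loglog_ge1 lam1).
have Kpos C T : 0 <= C -> 1 <= loglog R T ->
    C * (log R T / loglog R T) <= C * (K%:R * log R T / loglog R T).
  move=> C0 lam1; rewrite ler_wpM2l // -mulrA ler_peMl // X_ge0 //.
split.
  exists 1 => // alpha fK alpha0 fK0.
  have [C C0 HC] := expected_regret_bound hmu hwin hbstar alpha0 fK0.
  have [T0 HT0] := loglog_eventually (1 : R).
  (* [C] has already absorbed the initial phase and all terms that do not grow with [T], hence the
     zero coefficients; the two [C] belong to log T / loglog T and [delta ^- 2]. *)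
  exists 1, 0, 0, C, C, 0, T0; split=> // delta T /andP[d0 d1] hT d Om P H HP.
  have lam1 := HT0 T hT; have hd : 0 < delta <= 1 by rewrite d0 ltW.
  apply: (le_trans (HC T delta lam1 hd d Om P H HP)); rewrite lee_fin.
  rewrite !mul0r !addr0 mulrDr addrA; apply: lerD.
    by rewrite lerD2l; exact: Kpos.
  by rewrite ler_wpM2l // ler_peMl // invr_ge0 exprn_ge0 // ltW.
move=> alpha c eps alpha0 c0 eps0.
have fK0 : 0 <= c * K%:R `^ (1 + eps) by rewrite mulr_ge0 ?powR_ge0 // ltW.
have [C C0 HC] := expected_regret_bound hmu hwin hbstar alpha0 fK0.
have [T0 HT0] := loglog_eventually (1 : R).
pose M := \sum_(i < K | i != arm1 hK)
  (gap mu (arm1 hK) i + gap mu (arm1 hK) (bstar i)) / (2 * kl (mu i (bstar i)) (1 / 2)).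
have M0 : 0 <= M.
  apply: sumr_ge0 => i iw; have kb := kl_bstar_gt0 hmu hbstar iw.
  apply: divr_ge0; last by apply: mulr_ge0 => //; exact: ltW.
  by apply: addr_ge0; exact: (gap_ge0 hmu hwin).
(* [18 * M] pays for the excess [delta * log R T] in the main term, and 19 is 1 + 18, for
   [X + delta ^- 2]. *)
exists 0, (18 * M + C * 19), 0, T0 => T hT d Om P H HP.
have lam1 := HT0 T hT; have lam0 : 0 < loglog R T by exact: lt_le_trans lam1.
set X := log R T / loglog R T; have X0 := X_ge0 T lam1.
(* delta = (log T)^(-1/3) *)
pose delta : R := expR (- (1 / 3 * loglog R T)).
have hd : 0 < delta <= 1.
  by rewrite expR_gt0 expR_le1 oppr_le0 mulr_ge0 // ltW.
have hL : log R T = expR (loglog R T) := log_loglogK lam1.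
(* 18 is the constant [2 / c ^+ 2] of [expRN_loglog_log] at [c = 1 / 3]. *)
have dL : delta * log R T <= 18 * X.
  have h := @expRN_loglog_log R T lam1 (1 / 3) (divr_gt0 ltr01 (ltr0Sn _ _)).
  rewrite (_ : 18 = 2 / (1 / 3) ^+ 2 :> R); last by field.
  apply: le_trans h; rewrite ler_wpM2l ?expR_ge0 // ler_peMl //.
  by rewrite hL expR_ge0.
(* The exponent 1/3 balances the two costs of [delta], the excess of the main term and the count of
   deviations. *)
have d2 : delta ^- 2 = delta * log R T.
  by rewrite /delta hL -expRM_natr -expRN -expRD; congr expR; field.
apply: (le_trans (HC T delta lam1 hd d Om P H HP)); rewrite lee_fin.
rewrite !mul0r !addr0 d2.
have -> : \sum_(i < K | i != arm1 hK)
    (gap mu (arm1 hK) i + gap mu (arm1 hK) (bstar i)) * ((1 + delta) * log R T) /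
      (2 * kl (mu i (bstar i)) (1 / 2)) =
  \sum_(i < K | i != arm1 hK)
    (gap mu (arm1 hK) i + gap mu (arm1 hK) (bstar i)) * log R T /
      (2 * kl (mu i (bstar i)) (1 / 2)) + M * (delta * log R T).
  by rewrite /M mulr_suml -big_split /=; apply: eq_bigr => i _; ring.
rewrite -addrA lerD2l.
have h1 : M * (delta * log R T) <= M * (18 * X) by rewrite ler_wpM2l.
have h2 : C * (X + delta * log R T) <= C * (X + 18 * X) by rewrite ler_wpM2l // lerD2l.
apply: (le_trans (lerD h1 h2)).
apply: le_trans (Kpos _ T _ lam1); last first.
  by rewrite addr_ge0 // mulr_ge0.
by rewrite le_eqVlt; apply/orP; left; apply/eqP; rewrite -/X; ring.
Qed.
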